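(* Let $d\ge 1$, let $\alpha,\beta$ be positive constants, and let $\{X_t,t\ge 0\}$ be the super-Brownian motion on $\mathbb{R}^d$ corresponding to the operator $\frac12\Delta u+\beta u-\alpha u^2$. Assume $f\in\mathscr{A}$. Then for every $\varepsilon$ with $0<\varepsilon<\frac{\beta}{2}$ and every $x\in\mathbb{R}^d$ there exists $\delta>0$ such that, $\mathbb{P}_{\delta_x}$-almost surely, as $t\to\infty$, $$\langle X_t,f\rangle=\frac{1}{(2\pi)^d}\int_{\{\lambda\in\mathbb{R}^d:\,2\rho(\lambda)-\beta\ge\varepsilon\}}W(\lambda)\,e^{t\rho(\lambda)}\,\widehat f(\lambda)\,d\lambda+o\big(e^{(\beta-\delta)t}\big).$$
   Context: $M_F(\mathbb{R}^d)$ is the space of finite Borel measures on $\mathbb{R}^d$ with the topology of weak convergence, and $\langle\mu,f\rangle=\langle f,\mu\rangle=\int f\,d\mu$. Let $P_t$ be the transition semigroup of standard Brownian motion on $\mathbb{R}^d$ (generator $\frac12\Delta$) and $P_t^\beta=e^{\beta t}P_t$. The super-Brownian motion on $\mathbb{R}^d$ corresponding to the operator $\frac12\Delta u+\beta u-\alpha u^2$ is the time-homogeneous càdlàg $M_F(\mathbb{R}^d)$-valued Markov process $\{X_t,t\ge0\}$, with laws $\mathbb{P}_\mu$ for $\mu\in M_F(\mathbb{R}^d)$ (under $\mathbb{P}_\mu$, $X_0=\mu$), such that for every bounded non-negative Borel function $f$, $$\mathbb{E}_\mu[e^{-\langle f,X_t\rangle}]=e^{-\langle u(t,\cdot),\mu\rangle},$$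 where $\mathbb{E}_\mu$ is expectation under $\mathbb{P}_\mu$ and $u$ is the unique solution of $u(t,x)+\int_0^t P^\beta_{t-s}(\alpha\, u(s,\cdot)^2)(x)\,ds=P_t^\beta f(x)$. $\delta_x$ is the unit mass at $x$. For $\lambda,x\in\mathbb{R}^d$, $\lambda x$ is the inner product, $\varphi_\lambda(x)=e^{i\lambda x}$, and $\rho(\lambda)=\beta-\frac12|\lambda|^2$. The Fourier transform is $\widehat f(\lambda)=\int_{\mathbb{R}^d}f(x)\varphi_\lambda(x)\,dx$. $\mathscr{A}$ is the set of $f\in L^2(\mathbb{R}^d)$ such that $f$ is continuous, $\widehat f(\lambda)$ exists and is continuous in $\lambda$, $f(x)=\int_{\mathbb{R}^d}\widehat f(\lambda)\overline{\varphi_\lambda(x)}\frac{d\lambda}{(2\pi)^d}$, and $\int_{\mathbb{R}^d}e^{-\varepsilon'\rho(\lambda)}|\widehat f(\lambda)|\frac{d\lambda}{(2\pi)^d}<\infty$ for some $\varepsilon'>0$. $W_t(\lambda)=e^{-\rho(\lambda)t}\langle X_t,\overline{\varphi_\lambda}\rangle$, and for $\lambda$ with $2\rho(\lambda)-\beta>0$, $W(\lambda)=\lim_{t\to\infty}W_t(\lambda)$ (the $\mathbb{P}_{\delta_x}$-almost sure limit; $\mathbb{P}_{\delta_x}$-almost surely the convergence is uniform on $\{\lambda: 2\rho(\lambda)-\beta\ge\varepsilon\}$ for each $0<\varepsilon<\beta$, so that $W$ is almost surely defined simultaneously at all such $\lambda$). *)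

(* Defs.v *)
From HB Require Import structures.
From mathcomp Require Import all_boot all_order all_algebra.
From mathcomp Require Import all_classical all_reals all_analysis.
From mathcomp Require Import measurable_realfun giry complex.
Set Implicit Arguments.
Unset Strict Implicit.
Unset Printing Implicit Defensive.
Import Order.TTheory GRing.Theory Num.Theory numFieldNormedType.Exports.
Local Open Scope classical_set_scope.
Local Open Scope ring_scope.
Local Open Scope complex_scope.

(* The usual topology and norm of the complex plane, as R[i]-normed space. *)
HB.instance Definition _ (R : rcfType) := NormedModule.copy R[i] R[i]^o.

(* Landau's notations need a canonical filter structure on pinfty_nbhs. *)
Canonical pinfty_filter_on (R : numFieldType) : filter_on R :=
  FilterType (pinfty_nbhs R) _.

(* 'rV[R]_d carries the Borel sigma-algebra. *)
HB.instance Definition _ (R : realType) (d : nat) :=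
  @isMeasurable.Build (sigma_display (@open 'rV[R]_d)) 'rV[R]_d
    <<s @open 'rV[R]_d >> (@sigma_algebra0 _ setT _)
    (@sigma_algebraC _ _) (@sigma_algebra_bigcup _ setT _).

Section lebesgue_rV.
Context {R : realType}.

Definition rV_cons n (p : 'rV[R]_n * R) : 'rV[R]_n.+1 :=
  \row_i (if unlift ord0 i is Some j then p.1 ord0 j else p.2).

Lemma open_rV_countable_balls n (U : set 'rV[R]_n) : open U ->
  U = \bigcup_(q in [set q : 'rV[rat]_n * nat |
        ball (map_mx ratr q.1 : 'rV[R]_n) (q.2.+1%:R^-1) `<=` U])
      ball (map_mx ratr q.1 : 'rV[R]_n) (q.2.+1%:R^-1).
Proof.
move=> oU; apply/seteqP; split=> [x Ux|x [q /= qU]]; last exact: qU.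
have /nbhs_ballP[e /= e0 xeU] := open_nbhs_nbhs (conj oU Ux).
have e20 : 0 < e / 2 by rewrite divr_gt0.
have [k _ /(_ k (leqnn k))] := near_infty_natSinv_lt (PosNum e20).
rewrite /= => ke.
have k0 : 0 < k.+1%:R^-1 :> R by rewrite invr_gt0.
have /choice[c xc] : forall i, exists r : rat,
    x ord0 i - k.+1%:R^-1 < ratr r < x ord0 i + k.+1%:R^-1.
  move=> i; have /rat_in_itvoo[r] : x ord0 i - k.+1%:R^-1 < x ord0 i + k.+1%:R^-1.
    by rewrite ltrBlDr -addrA ltrDl addr_gt0.
  by rewrite in_itv/=; exists r.
have cx : ball (map_mx ratr (\row_i c i) : 'rV[R]_n) k.+1%:R^-1 x.
  split=> // i j; rewrite (ord1 i : i = ord0) !mxE.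
  by rewrite /ball/= ltr_distl; exact: xc.
exists (\row_i c i, k) => //= y cy.
apply: xeU; apply: (@le_ball _ _ _ (k.+1%:R^-1 + k.+1%:R^-1)).
  by rewrite [leRHS](splitr e) lerD// ltW.
exact: ball_triangle (ball_sym cx) cy.
Qed.

Lemma measurable_rV_cons n : measurable_fun [set: 'rV[R]_n * R] (@rV_cons n).
Proof.
apply: (@measurability _ _ _ _ setT (@rV_cons n) (@open 'rV[R]_n.+1)) => //.
move=> _ [U oU <-]; rewrite setTI (open_rV_countable_balls oU) preimage_bigcup.
rewrite bigcup_mkcond.
have [g gsurj] : exists g : nat -> option ('rV[rat]_n.+1 * nat),
    forall q, exists i, g i = Some q.
  by exists unpickle => q; exists (pickle q); rewrite pickleK.
set F := (F in \bigcup_i F i).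
have -> : \bigcup_i F i = \bigcup_i (if g i is Some q then F q else set0).
  apply/seteqP; split=> [p [q _ Fqp]|p [i _]].
    by have [i gi] := gsurj q; exists i => //=; rewrite gi.
  by case: (g i) => // q Fqp; exists q.
apply: bigcupT_measurable => i; case: (g i) => [q|//].
rewrite /F; case: ifP => // _.
set c := map_mx _ _; set r := _^-1.
have -> : @rV_cons n @^-1` ball c r =
    ball (\row_j c ord0 (lift ord0 j)) r `*` ball (c ord0 ord0) r.
  apply/seteqP; split=> [p [r0 cp]|p [/= [r0 cp1] cp2]].
    split=> /=; last by have := cp ord0 ord0; rewrite [X in ball _ _ X]mxE unlift_none.
    split=> // i0 j; have := cp ord0 (lift ord0 j).
    by rewrite (ord1 i0 : i0 = ord0) [X in ball _ _ X -> _]mxE liftK [X in _ -> ball X _ _]mxE.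
  split=> // i0 j; rewrite (ord1 i0 : i0 = ord0) [X in ball _ _ X]mxE.
  case: unliftP => [k ->|-> //].
  by have := cp1 ord0 k; rewrite [X in ball X _ _]mxE.
apply: measurableX; last exact: measurable_ball.
by apply: sub_sigma_algebra; exact: ball_open.
Qed.

Definition lebesgue_rV_succ n (mu : {measure set 'rV[R]_n -> \bar R}) :
  {measure set 'rV[R]_n.+1 -> \bar R}.
Proof.
refine (pushforward (mu \x lebesgue_measure)%E (@rV_cons n)
        : {measure set _ -> \bar R}).
exact: measurable_rV_cons.
Defined.

Fixpoint lebesgue_rV n : {measure set 'rV[R]_n -> \bar R} :=
  if n is m.+1 return {measure set 'rV[R]_n -> \bar R}
  then lebesgue_rV_succ (lebesgue_rV m)
  else \d_(0 : 'rV[R]_0).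

End lebesgue_rV.

Section complex_integral.
Context d (T : measurableType d) (R : realType).
Variables (mu : {measure set T -> \bar R}) (D : set T) (f : T -> R[i]).

Definition Cintegrable :=
  mu.-integrable D (fun x => (complex.Re (f x))%:E) /\
  mu.-integrable D (fun x => (complex.Im (f x))%:E).

Definition Cintegral : R[i] :=
  (\int[mu]_(x in D) complex.Re (f x)) +i* (\int[mu]_(x in D) complex.Im (f x)).

End complex_integral.

Section finite_measures.
Context (R : realType) (d : nat).

(* M_F(R^d). Library measures are functions on all subsets, so one finite Borel
   measure has several (topologically indistinguishable) representatives;
   equality of measures is `≡μ`, agreement on Borel sets. *)
Definition MF : Type := {finite_measure set 'rV[R]_d -> \bar R}.

HB.instance Definition _ := gen_eqMixin MF.
HB.instance Definition _ := gen_choiceMixin MF.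
HB.instance Definition _ := isPointed.Build MF (mzero : MF).

Definition bounded_continuous : set ('rV[R]_d -> R) :=
  [set g | continuous g /\ exists M, forall x, `|g x| <= M].

Definition MF_pairing (mu : MF) : {ptws bounded_continuous -> R} :=
  fun g => \int[mu]_x \val g x.

(* The topology of weak convergence of measures. *)
HB.instance Definition _ := Topological.copy MF (initial_topology MF_pairing).

HB.instance Definition _ :=
  @isMeasurable.Build (sigma_display (@open MF)) MF
    <<s @open MF >> (@sigma_algebra0 _ setT _)
    (@sigma_algebraC _ _) (@sigma_algebra_bigcup _ setT _).

End finite_measures.

Section super_brownian_motion.
Context {R : realType} {d : nat} (alpha beta : R).
Implicit Types (x y : 'rV[R]_d) (t s : R) (f : 'rV[R]_d -> R).

(* Density in y of the law at time t > 0 of Brownian motion started at x. *)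
Definition heat_kernel t x y : R :=
  \prod_(i < d) normal_pdf (x ord0 i) (Num.sqrt t) (y ord0 i).

Definition heat_semigroup t f x : \bar R :=
  if t == 0 then (f x)%:E
  else (\int[lebesgue_rV d]_y (heat_kernel t x y * f y)%:E)%E.

Definition Pbeta t f x : \bar R :=
  ((expR (beta * t))%:E * heat_semigroup t f x)%E.

(* u is a non-negative (jointly measurable) solution of the log-Laplace equation
   u(t) + \int_0^t P^beta_{t-s}(alpha u(s)^2) ds = P^beta_t f on t >= 0. *)
Definition log_laplace_solution f (u : R -> 'rV[R]_d -> R) :=
  [/\ measurable_fun [set z : R * 'rV[R]_d | 0 <= z.1] (fun z => u z.1 z.2),
      forall t x, 0 <= t -> 0 <= u t x
    & forall t x, 0 <= t ->
        ((u t x)%:E + \int[lebesgue_measure]_(s in `[0%R, t])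
           Pbeta (t - s)%R (fun y => (alpha * u s y ^+ 2)%R) x = Pbeta t f x)%E].

Context {dO : measure_display} {Omega : measurableType dO}.
Variables (P : MF R d -> probability Omega R) (X : R -> Omega -> MF R d).

(* sigma(X_r : 0 <= r <= s) *)
Definition natural_filtration s : set (set Omega) :=
  <<s \bigcup_(r in `[0, s]) preimage_set_system setT (X r) measurable >>.

(* Only the X_t with t >= 0 matter. *)
Record super_brownian_motion : Prop := {
  sbm_measurable : forall t, 0 <= t -> measurable_fun setT (X t);
  sbm_right_continuous : forall w t, 0 <= t -> X s w @[s --> t^'+] --> X t w;
  sbm_left_limit : forall w t, 0 < t ->
    exists nu : MF R d, X s w @[s --> t^'-] --> nu;
  sbm_start : forall mu, {ae P mu, forall w, X 0 w ≡μ mu};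
  sbm_law_measurable : forall t B, 0 <= t -> measurable B ->
    measurable_fun setT (fun mu : MF R d => P mu (X t @^-1` B));
  sbm_markov : forall mu s t A B, 0 <= s -> 0 <= t ->
    natural_filtration s A -> measurable B ->
    (P mu (A `&` X (s + t)%R @^-1` B)
      = \int[P mu]_(w in A) P (X s w) (X t @^-1` B))%E;
  sbm_log_laplace : forall f, measurable_fun setT f -> (forall x, 0 <= f x) ->
    (exists M, forall x, f x <= M) ->
    exists u, [/\ log_laplace_solution f u,
      (forall v, log_laplace_solution f v ->
         forall t x, 0 <= t -> v t x = u t x)
      & forall mu t, 0 <= t ->
          ('E_(P mu)[fun w => expR (- \int[X t w]_x f x)]
            = (expR (- \int[mu]_x u t x))%:E)%E] }.

End super_brownian_motion.

Section fourier.
Context {R : realType} {d : nat}.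
Implicit Types (x lambda : 'rV[R]_d) (f : 'rV[R]_d -> R[i]).

Definition dotv lambda x : R := \sum_(i < d) lambda ord0 i * x ord0 i.

Definition phi lambda x : R[i] := cos (dotv lambda x) +i* sin (dotv lambda x).

(* |lambda| is the Euclidean norm; the library norm on 'rV is the sup norm. *)
Definition rho (beta : R) lambda : R := beta - 2^-1 * dotv lambda lambda.

Definition fourier f lambda : R[i] :=
  Cintegral (lebesgue_rV d) setT (fun x => f x * phi lambda x).

Definition classA (beta : R) f :=
  [/\ (\int[lebesgue_rV d]_x (Normc.normc (f x) ^+ 2)%:E < +oo)%E,
      continuous f,
      (forall lambda,
         Cintegrable (lebesgue_rV d) setT (fun x => f x * phi lambda x)) /\
      continuous (fourier f),
      (forall x, f x = ((2 * pi) ^- d)%:C *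
         Cintegral (lebesgue_rV d) setT
           (fun lambda => fourier f lambda * (phi lambda x)^*))
    & exists2 e, 0 < e &
        (\int[lebesgue_rV d]_lambda
           (expR (- e * rho beta lambda) * Normc.normc (fourier f lambda)
             / (2 * pi) ^+ d)%:E < +oo)%E].

Context (beta : R) {Omega : Type} (X : R -> Omega -> MF R d).

Definition pairing (mu : MF R d) f : R[i] := Cintegral mu setT f.

Definition W_at t lambda (w : Omega) : R[i] :=
  (expR (- rho beta lambda * t))%:C *
  pairing (X t w) (fun x => (phi lambda x)^*).

Definition W_lim lambda (w : Omega) : R[i] :=
  lim (W_at t lambda w @[t --> +oo]).

End fourier.

(* Main.v *)
(* Let M_t(lambda) = e^(-rho(lambda) t) <X_t, conj phi_lambda>, a martingale in t.
   Inserting <X_t, 1 +- Re phi> times a small constant into the log-Laplace equation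
   and expanding to second order gives its mean and variance; with the Markov
   property, E|M_(s+h) - M_s| = O(e^((beta/2 - rho) s)) up to the factor e^(-rho h).

   Fourier inversion turns <X_t, f> into the integral of f^ e^(rho t) M_t. Choose for h
   the exponent epsilon' of the class A, so that e^(-rho h) |f^| is integrable, and
   compare, for t in [nh, (n+1)h], with the integral of f^ e^(rho t) W over
   D = {2 rho - beta >= eps}:
   - the weak L^1 Doob inequality for the submartingale int |f^| e^(rho n h) |M_t - M_nh|
     controls the oscillation inside a block by e^(beta n h / 2) in L^1;
   - off D the second moment gives E <X_nh, phi> = O(n e^((beta + eps) n h / 2));
   - on D the increments of M_nh are geometrically small in L^1(|f^|), and M_t
     converges for almost every lambda, so that int_D |f^| |W - M_nh| decays
     geometrically.
   Borel-Cantelli makes the three bounds almost sure. *)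
Require Import Defs.
From HB Require Import structures.
From mathcomp Require Import all_boot all_order all_algebra.
From mathcomp Require Import all_classical all_reals all_analysis.
From mathcomp Require Import measurable_realfun giry complex.
From mathcomp Require Import ring lra.
Set Implicit Arguments.
Unset Strict Implicit.
Unset Printing Implicit Defensive.
Import Order.TTheory GRing.Theory Num.Theory numFieldNormedType.Exports.
Local Open Scope classical_set_scope.
Local Open Scope ring_scope.

(** The process is known only through its log-Laplace equation, whose solutions u are not explicit.
    They can be controlled because the constant 1 and the cosines cos(lambda x + th) are
    eigenfunctions of P^beta. For f affine in a cosine, u lies below P^beta_t f, again affine in
    that cosine; the square of this bound is dominated by another such affine function, and putting
    it back into the equation yields the second-order terms. Hence the analysis is carried out with
    real cosines of a free phase th, and complex numbers return only near the end. Moments are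
    computed from every initial measure, since the Markov property restarts the process at X_s.

    The obstacle is the size of e^(-rho h), which is unbounded in lambda: no estimate uniform in
    lambda is available for the increments. Suprema over time are therefore taken after integration
    over lambda, and W is used only at almost every lambda.

    The constants come from three strict losses: each L^1 rate must stay below the almost sure rate
    beta - eps / 8, and delta = eps / 16 keeps half of the remaining gap, to turn a big O into a
    little o. *)

Section RealIntegrable.
Context {dT : measure_display} {T : measurableType dT} {R : realType}.
Variables (mu : {measure set T -> \bar R}) (D : set T) (mD : measurable D).
Implicit Types f g : T -> R.

Lemma integrable_addr f g : mu.-integrable D (fun x => (f x)%:E) ->
  mu.-integrable D (fun x => (g x)%:E) -> mu.-integrable D (fun x => (f x + g x)%:E).
Proof. by move=> hf hg; exact: (integrableD mD hf hg). Qed.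

Lemma integrable_subr f g : mu.-integrable D (fun x => (f x)%:E) ->
  mu.-integrable D (fun x => (g x)%:E) -> mu.-integrable D (fun x => (f x - g x)%:E).
Proof. by move=> hf hg; exact: (integrableB mD hf hg). Qed.

Lemma integrable_mulr k f : mu.-integrable D (fun x => (f x)%:E) ->
  mu.-integrable D (fun x => (k * f x)%:E).
Proof. by move=> hf; exact: (integrableZl mD k hf). Qed.

End RealIntegrable.

Lemma affine_ge0 (R : realType) (c a u : R) : `|a| <= c -> `|u| <= 1 -> 0 <= c + a * u.
Proof.
move=> ac u1; have : `|a * u| <= c by rewrite normrM; apply: le_trans ac; rewrite ler_piMr.
by rewrite ler_norml => /andP[h _]; lra.
Qed.

Lemma normr_cos_le1 (R : realType) (y : R) : `|cos y| <= 1.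
Proof. by rewrite ler_norml cos_geN1 cos_le1. Qed.

(** * Real waves on R^d: continuity and measurability *)

Section Waves.
Context {R : realType} {d : nat}.
Implicit Types (x lam : 'rV[R]_d) (th : R).

Lemma continuous_measurable_rV (g : 'rV[R]_d -> R) :
  continuous g -> measurable_fun setT g.
Proof.
move=> cg; apply: (@measurability _ _ _ _ setT g (@RGenOpens.G R)).
  exact: RGenOpens.measurableE.
move=> _ [_ [a [b ->] <-]]; rewrite setTI; apply: sub_sigma_algebra.
by apply: open_comp => // *; exact: cg.
Qed.

Lemma measurable_rV_coord (i : 'I_d) :
  measurable_fun setT (fun x : 'rV[R]_d => x ord0 i).
Proof. by apply: continuous_measurable_rV; exact: coord_continuous. Qed.

Lemma continuous_dotv lam : continuous (dotv lam).
Proof.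
rewrite /dotv; elim: (index_enum _) => [|i r IH] x.
  rewrite (_ : (fun _ => _) = cst 0); first exact: cst_continuous.
  by apply/funext => y; rewrite big_nil.
rewrite (_ : (fun _ => _) = (fun x : 'rV[R]_d => lam ord0 i * x ord0 i) \+
    (fun x : 'rV[R]_d => \sum_(j <- r) lam ord0 j * x ord0 j)).
  apply: (@continuousD _ _ _ _ _ x); last exact: IH.
  apply: (@continuousM _ _ (cst (lam ord0 i))); first exact: cst_continuous.
  exact: coord_continuous.
by apply/funext => y; rewrite big_cons.
Qed.

Lemma dotvC lam x : dotv lam x = dotv x lam.
Proof. by apply: eq_bigr => i _; rewrite mulrC. Qed.

Lemma dotv_ge0 lam : 0 <= dotv lam lam.
Proof. by apply: sumr_ge0 => i _; rewrite -expr2 sqr_ge0. Qed.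

(* th = 0 and th = pi / 2 give the real and imaginary parts of the conjugate of phi. *)
Definition wave th lam x : R := cos (dotv lam x + th).

Lemma waveC th lam x : wave th lam x = wave th x lam.
Proof. by rewrite /wave dotvC. Qed.

Lemma continuous_wave th lam : continuous (wave th lam).
Proof.
move=> x; apply: (@continuous_comp _ _ _ (fun x => dotv lam x + th) cos).
  by apply: (@continuousD _ _ _ (dotv lam) (cst th));
    [exact: (@continuous_dotv lam)|exact: cst_continuous].
exact: continuous_cos.
Qed.

Lemma wave_le1 th lam x : `|wave th lam x| <= 1.
Proof. by rewrite ler_norml cos_geN1 cos_le1. Qed.

Lemma measurable_dotv :
  measurable_fun setT (fun z : 'rV[R]_d * 'rV[R]_d => dotv z.1 z.2).
Proof.
apply: measurable_sum => i; apply: measurable_funM.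
  exact: measurableT_comp (measurable_rV_coord i) measurable_fst.
exact: measurableT_comp (measurable_rV_coord i) measurable_snd.
Qed.

Lemma measurable_wave th :
  measurable_fun setT (fun z : 'rV[R]_d * 'rV[R]_d => wave th z.1 z.2).
Proof.
apply: (measurableT_comp (f := @cos R)).
  by apply: continuous_measurable_fun; exact: continuous_cos.
by apply: measurable_funD => //; exact: measurable_dotv.
Qed.

Lemma rV_norm_le (v : 'rV[R]_d) (k : R) : 0 <= k ->
  (`|v| <= k) <-> (forall i, `|v ord0 i| <= k).
Proof.
move=> k0; split=> [vk i|vk].
  by apply: le_trans vk; rewrite /Num.norm/= mx_normrE; apply: (le_bigmax _ _ (ord0, i)).
by rewrite /Num.norm/= mx_normrE; apply: bigmax_le => //= -[i j] _; rewrite /= (ord1 i).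
Qed.

End Waves.

(** * Lebesgue measure on row vectors: sigma-finiteness and slicing *)

Section LebesgueRV.
Context {R : realType}.

Definition rV_box d (k : nat) : set 'rV[R]_d := [set v | `|v| <= k%:R].
Arguments rV_box d k : clear implicits.

Lemma measurable_rV_box d k : measurable (rV_box d k).
Proof.
rewrite /rV_box -(setTI [set _ | _]).
apply: (measurable_fun_le _ _) => //; first exact: continuous_measurable_rV (@norm_continuous _ _).
Qed.

Lemma lebesgue_rV_box d k : (lebesgue_rV d (rV_box d k) < +oo)%E.
Proof.
elim: d => [|d IH].
  by rewrite /= diracE; case: (_ \in _); rewrite ltry.
rewrite /= /pushforward.
have -> : @rV_cons R d @^-1` rV_box d.+1 k = rV_box d k `*` `[- k%:R, k%:R].
  apply/seteqP; split => -[v y] /=; rewrite in_itv/= -ler_norml.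
    move=> /(rV_norm_le _ (ler0n _ k)) h; split.
      by apply/(rV_norm_le _ (ler0n _ k)) => i; have := h (lift ord0 i); rewrite mxE liftK.
    by have := h ord0; rewrite mxE unlift_none.
  move=> [/(rV_norm_le _ (ler0n _ k)) h y_k]; apply/(rV_norm_le _ (ler0n _ k)) => i.
  by rewrite mxE; case: unliftP => [j _|_] //; exact: h.
rewrite product_measure1E//; last exact: measurable_rV_box.
rewrite lte_mul_pinfty//; first by rewrite ge0_fin_numE.
by rewrite [X in (X < _)%E]lebesgue_measure_itv/=; case: ifP => _; rewrite ltry.
Qed.

Lemma lebesgue_rV_sigma_finite d : sigma_finite setT (lebesgue_rV d : set _ -> \bar R).
Proof.
exists (rV_box d); last by move=> k; split; [exact: measurable_rV_box|exact: lebesgue_rV_box].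
apply/seteqP; split => // v _; exists (Num.truncn `|v|).+1 => //=.
by rewrite /rV_box/=; exact/ltW/truncnS_gt.
Qed.

(** A copy of [lebesgue_rV d] that carries the sigma-finite structure required by the Fubini and
    Tonelli theorems. *)
Definition leb_rV d : set 'rV[R]_d -> \bar R := lebesgue_rV d.
HB.instance Definition _ d := Measure.copy (@leb_rV d) (lebesgue_rV d).
HB.instance Definition _ d :=
  @Measure_isSigmaFinite.Build _ _ R (@leb_rV d) (@lebesgue_rV_sigma_finite d).

Lemma lebesgue_rV_succE d (F : 'rV[R]_d.+1 -> \bar R) :
  measurable_fun setT F -> (forall v, 0 <= F v)%E ->
  (\int[lebesgue_rV d.+1]_v F v =
   \int[lebesgue_rV d]_v \int[lebesgue_measure]_y F (rV_cons (v, y)))%E.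
Proof.
move=> mF F0; rewrite /= /lebesgue_rV_succ ge0_integral_pushforward//=; last exact: measurable_rV_cons.
rewrite preimage_setT (fubini_tonelli1 (m1 := @leb_rV d) (m2 := lebesgue_measure) (F \o @rV_cons R d))//.
  by apply: measurableT_comp mF _; exact: measurable_rV_cons.
by move=> z; exact: F0.
Qed.

End LebesgueRV.

(** * Gaussian integrals of cosines *)

Section GaussianFourier.
Context {R : realType}.
Notation mu := (@lebesgue_measure R).
Implicit Types (m s c l th y : R).

(** The fundamental theorem of calculus on the growing intervals [m - n - 1, m + n + 1], with
    dominated convergence on the side of the integral. *)
Lemma Rintegral_derive_eq0 (f F : R -> R) m :
  continuous f -> (forall x : R, is_derive x 1 F (f x)) ->
  mu.-integrable setT (EFin \o f) ->
  F (m + n.+1%:R) @[n --> \oo] --> 0 -> F (m - n.+1%:R) @[n --> \oo] --> 0 ->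
  (\int[mu]_x f x)%R = 0.
Proof.
move=> cf dF intf Fp Fm.
pose A n := `[m - n.+1%:R, m + n.+1%:R]%classic : set R.
pose fn n := (EFin \o f) \_ (A n).
have mf : measurable_fun setT f by exact: continuous_measurable_fun.
have dc : (\int[mu]_x fn n x)%E @[n --> \oo] --> (\int[mu]_x (EFin \o f) x)%E.
  have [//|||||_ _] := @dominated_convergence _ _ _ mu setT measurableT fn (EFin \o f)
    (abse \o (EFin \o f)).
  - move=> n; apply/(measurable_restrictT _ _).1; first exact: measurable_itv.
    by apply: measurable_funTS; exact/measurable_EFinP.
  - exact/measurable_EFinP.
  - apply/aeW => y _; apply: cvg_near_cst.
    exists (Num.truncn `|y - m|) => // n /= yn; rewrite /fn patchE mem_set//.
    rewrite /A/= in_itv/=.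
    have : `|y - m| <= n.+1%:R.
      by apply: ltW; apply: lt_le_trans (truncnS_gt _) _; rewrite ler_nat ltnS.
    by rewrite distrC ler_distlC.
  - exact: integrable_abse.
  - apply/aeW => y n _; rewrite /fn patchE; case: ifP => // _.
    by rewrite -[point]/0%E abse0 abse_ge0.
  - exact.
have E n : (\int[mu]_x fn n x = (F (m + n.+1%:R))%:E - (F (m - n.+1%:R))%:E)%E.
  rewrite /fn -integral_mkcond.
  have ab : m - n.+1%:R < m + n.+1%:R by rewrite ltrD2l gtrN.
  apply: (@continuous_FTC2 _ f F _ _ ab).
  - exact: continuous_subspaceT.
  - have cF : continuous F.
      by move=> x; apply/differentiable_continuous/derivable1_diffP; have [] := dF x.
    split; first by move=> x _; have [] := dF x.
    + by apply: cvg_at_right_filter; exact: cF.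
    + by apply: cvg_at_left_filter; exact: cF.
  - by move=> x _; rewrite derive1E; exact: derive_val.
have E0 : (\int[mu]_x fn n x)%E @[n --> \oo] --> 0%:E.
  under eq_fun do rewrite E -EFinB; apply: cvg_EFin; first exact: nearW.
  have H : F (m + n.+1%:R) - F (m - n.+1%:R) @[n --> \oo] --> (0 - 0 : R) by exact: cvgB.
  by rewrite subr0 in H; exact: H.
by rewrite /Rintegral (cvg_unique _ dc E0).
Qed.

Lemma integrable_expR_sqr c m : 0 < c ->
  mu.-integrable setT (fun y => (expR (- (c * (y - m) ^+ 2)))%:E).
Proof.
move=> c0; pose s := Num.sqrt ((2 * c)^-1).
have s2 : s ^+ 2 = (2 * c)^-1 by rewrite sqr_sqrtr// invr_ge0 mulr_ge0// ltW.
have s0 : s != 0 by rewrite gt_eqF// sqrtr_gt0 invr_gt0 mulr_gt0.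
have := @integrable_normal_pdf R m s; rewrite /normal_pdf (negbTE s0).
move=> /(integrableZl measurableT (normal_peak s)^-1).
apply: eq_integrable => // y _; rewrite -EFinM mulrA mulVf ?mul1r; last by rewrite gt_eqF ?normal_peak_gt0.
rewrite /normal_fun s2 mulNr; congr (expR (- _))%:E.
by rewrite -mulr_natr invfM invrK mulrC; field.
Qed.

Lemma mul_expR_le (u : R) : 0 <= u -> u * expR (- u ^+ 2) <= 1.
Proof.
move=> u0; rewrite expRN -ler_pdivlMr ?invr_gt0 ?expR_gt0// invrK mul1r.
by apply: le_trans (expR_ge1Dx _); nra.
Qed.

(** Half of the Gaussian exponent absorbs the linear factor, since u e^(-u^2) <= 1; the other half
    is integrable. *)
Lemma integrable_mul_expR_sqr c m : 0 < c ->
  mu.-integrable setT (fun y => ((y - m) * expR (- (c * (y - m) ^+ 2)))%:E).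
Proof.
move=> c0; have c20 : 0 < c / 2 by rewrite divr_gt0.
apply: (le_integrable measurableT _ _
  (integrableZl measurableT ((Num.sqrt (c / 2))^-1) (integrable_expR_sqr m c20))).
  apply/measurable_EFinP; apply: measurable_funM; first exact: measurable_funB.
  apply: measurableT_comp => //; apply: measurableT_comp => //.
  by apply: measurable_funM => //; apply: measurable_funX; exact: measurable_funB.
move=> y _; rewrite /= lee_fin normrM (ger0_norm (expR_ge0 _)).
rewrite [leRHS]ger0_norm; last by rewrite mulr_ge0 ?expR_ge0// invr_ge0 sqrtr_ge0.
have -> : expR (- (c * (y - m) ^+ 2)) =
  expR (- (c / 2 * (y - m) ^+ 2)) * expR (- (c / 2 * (y - m) ^+ 2)).
  by rewrite -expRD; congr expR; field.
rewrite [leLHS]mulrA ler_wpM2r ?expR_ge0// -[leRHS]mulr1 -ler_pdivrMl ?invr_gt0 ?sqrtr_gt0// invrK mulrA.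
have -> : c / 2 * (y - m) ^+ 2 = (Num.sqrt (c / 2) * `|y - m|) ^+ 2.
  by rewrite exprMn sqr_sqrtr ?ltW// real_normK ?num_real.
by apply: mul_expR_le; rewrite mulr_ge0 ?sqrtr_ge0.
Qed.

Lemma integrable_expR_sqr_bounded c m (k : R -> R) : 0 < c ->
  measurable_fun setT k -> (forall y, `|k y| <= 1) ->
  mu.-integrable setT (fun y => (expR (- (c * (y - m) ^+ 2)) * k y)%:E).
Proof.
move=> c0 mk k1; apply: (le_integrable measurableT _ _ (integrable_expR_sqr m c0)).
  apply/measurable_EFinP; apply: measurable_funM => //.
  apply: measurableT_comp => //; apply: measurableT_comp => //.
  by apply: measurable_funM => //; apply: measurable_funX; exact: measurable_funB.
by move=> y _; rewrite /= lee_fin normrM ler_piMr.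
Qed.

Lemma cvg_expR_sqr c (u : nat -> R) : 0 < c -> (forall n, n.+1%:R <= `|u n|) ->
  expR (- (c * u n ^+ 2)) @[n --> \oo] --> (0 : R).
Proof.
move=> c0 un; apply: (@squeeze_cvgr _ _ _ _ (cst 0) (fun n => c^-1 * n.+1%:R^-1)).
- apply: nearW => n; rewrite expR_ge0/= expRN -invfM lef_pV2 ?posrE ?expR_gt0 ?mulr_gt0//.
  apply: le_trans (expR_ge1Dx _); apply: (@le_trans _ _ (c * u n ^+ 2)); last by rewrite lerDr.
  rewrite ler_pM2l// -real_normK ?num_real//.
  apply: le_trans (un n) _; rewrite expr2 ler_peMl//.
  by apply: le_trans (un n); rewrite ler1n.
- exact: cvg_cst.
- rewrite -[X in _ --> X](mulr0 c^-1); apply: cvgM; first exact: cvg_cst.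
  exact: cvg_harmonic.
Qed.

Let gw c m th l y : R := expR (- (c * (y - m) ^+ 2)) * cos (l * (y - m) + th).

(** Integration by parts: [f] is the derivative of [F], the Gaussian times the sine, and its
    integral vanishes. *)
Lemma integral_gauss_sin c m th l : 0 < c ->
  (\int[mu]_y ((y - m) * expR (- (c * (y - m) ^+ 2)) * sin (l * (y - m) + th)))%R =
  l / (2 * c) * (\int[mu]_y gw c m th l y)%R.
Proof.
move=> c0.
have mcos : measurable_fun setT (fun y => cos (l * (y - m) + th)).
  apply: measurableT_comp; first by apply: continuous_measurable_fun; exact: continuous_cos.
  by apply: measurable_funD => //; apply: measurable_funM => //; exact: measurable_funB.
have msin : measurable_fun setT (fun y => sin (l * (y - m) + th)).
  apply: measurableT_comp; first by apply: continuous_measurable_fun; exact: continuous_sin.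
  by apply: measurable_funD => //; apply: measurable_funM => //; exact: measurable_funB.
have i1 : mu.-integrable setT (EFin \o gw c m th l).
  by apply: integrable_expR_sqr_bounded => // y; rewrite ler_norml cos_geN1 cos_le1.
have i2 : mu.-integrable setT (EFin \o (fun y =>
    (y - m) * expR (- (c * (y - m) ^+ 2)) * sin (l * (y - m) + th))).
  apply: (le_integrable measurableT _ _ (integrable_mul_expR_sqr m c0)).
    apply/measurable_EFinP; apply: measurable_funM => //.
    apply: measurable_funM; first exact: measurable_funB.
    apply: measurableT_comp => //; apply: measurableT_comp => //.
    by apply: measurable_funM => //; apply: measurable_funX; exact: measurable_funB.
  by move=> y _; rewrite /= lee_fin normrM ler_piMr// ler_norml sin_geN1 sin_le1.
pose F y := expR (- (c * (y - m) ^+ 2)) * sin (l * (y - m) + th).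
pose f y := l * gw c m th l y -
  (2 * c) * ((y - m) * expR (- (c * (y - m) ^+ 2)) * sin (l * (y - m) + th)).
have dF (x : R) : is_derive x (1 : R) F (f x).
  apply: is_derive_eq; rewrite /f /gw /= /GRing.scale/=; ring.
have cf : continuous f.
  move=> x; apply/differentiable_continuous/derivable1_diffP.
  by rewrite /f /gw; apply: ex_derive.
have intf : mu.-integrable setT (EFin \o f).
  by apply: integrable_subr => //; apply: integrable_mulr => //; exact: measurableT.
have F0 (u : nat -> R) : (forall n, `|u n - m| = n.+1%:R) -> F (u n) @[n --> \oo] --> 0.
  move=> um; apply: norm_cvg0.
  apply: (@squeeze_cvgr _ _ _ _ (cst 0) (fun n => expR (- (c * (u n - m) ^+ 2)))).
  - apply: nearW => n; rewrite normr_ge0/= /F normrM ger0_norm ?expR_ge0//.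
    by rewrite ler_piMr ?expR_ge0// ler_norml sin_geN1 sin_le1.
  - exact: cvg_cst.
  - by apply: cvg_expR_sqr => // n; rewrite um.
have := @Rintegral_derive_eq0 f F m cf dF intf.
rewrite RintegralB//; last 2 first.
- by apply: integrable_mulr.
- by apply: integrable_mulr.
rewrite !RintegralZl// => /(_ _ _)/eqP H; apply/esym.
rewrite mulrAC; apply/(canLR (mulfK _)); first by rewrite gt_eqF// mulr_gt0.
apply/eqP; rewrite -subr_eq0 [X in _ - X]mulrC; apply: H.
  by apply: F0 => n; rewrite addrC addKr ger0_norm.
by apply: F0 => n; rewrite addrC addKr normrN ger0_norm.
Qed.
(** The integrating factor e^(l^2 / (4 c)) makes the product constant. *)
Lemma gauss_ode c (H : R -> R) l : c != 0 ->
  (forall l' : R, is_derive l' (1 : R) H (- (l' / (2 * c) * H l'))) ->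
  H l = expR (- (l ^+ 2 / (4 * c))) * H 0.
Proof.
move=> c0 dH.
have dK (l' : R) : is_derive l' (1 : R) (fun l => expR (l ^+ 2 * (4 * c)^-1) * H l) 0.
  apply: is_derive_eq; rewrite /GRing.scale/=.
  by field.
have := @is_derive_0_is_cst R _ l 0 dK; rewrite expr0n/= mul0r expR0 mul1r => <-.
by rewrite mulrA -expRD addNr expR0 mul1r.
Qed.

(** Differentiation under the integral sign in l produces the sine integral of [integral_gauss_sin],
    hence a linear differential equation in l. The dominating function [G] does not depend on l. *)
Lemma integral_gauss_cos c m th l : 0 < c ->
  (\int[mu]_y gw c m th l y)%R =
  expR (- (l ^+ 2 / (4 * c))) * (cos th * (\int[mu]_y expR (- (c * (y - m) ^+ 2)))%R).
Proof.
move=> c0.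
have mgw l' : measurable_fun setT (fun y => cos (l' * (y - m) + th)).
  apply: measurableT_comp; first by apply: continuous_measurable_fun; exact: continuous_cos.
  by apply: measurable_funD => //; apply: measurable_funM => //; exact: measurable_funB.
have igw l' : mu.-integrable setT (EFin \o gw c m th l').
  by apply: integrable_expR_sqr_bounded => // y; rewrite ler_norml cos_geN1 cos_le1.
pose H l' := (\int[mu]_y gw c m th l' y)%R.
have d1 l' y : is_derive l' (1 : R) ((gw c m th)^~ y)
    (- ((y - m) * expR (- (c * (y - m) ^+ 2)) * sin (l' * (y - m) + th))).
  by apply: is_derive_eq; rewrite /= /GRing.scale/=; ring.
have d1E l' y : partial1of2 (gw c m th) l' y =
    - ((y - m) * expR (- (c * (y - m) ^+ 2)) * sin (l' * (y - m) + th)).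
  by rewrite partial1of2E; exact: derive_val.
pose G y := `|(y - m) * expR (- (c * (y - m) ^+ 2))|.
have dH l' : is_derive l' (1 : R) H (- (l' / (2 * c) * H l')).
  have I : `](l' - 1), (l' + 1)[%classic l' by rewrite /= in_itv/=; lra.
  have h3 x y : `](l' - 1), (l' + 1)[%classic x -> [set: R] y -> derivable ((gw c m th)^~ y) x 1.
    by move=> _ _; have [] := d1 x y.
  have h4 : mu.-integrable setT (EFin \o G).
    exact: (integrable_abse (integrable_mul_expR_sqr m c0)).
  have h5 x y : `](l' - 1), (l' + 1)[%classic x -> [set: R] y -> `|partial1of2 (gw c m th) x y| <= G y.
    move=> _ _; rewrite d1E normrN normrM ler_piMr//.
    by rewrite ler_norml sin_geN1 sin_le1.
  have G0 y : 0 <= G y by rewrite normr_ge0.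
  apply: DeriveDef.
    exact: (derivable_under_integral measurableT I (fun x _ => igw x) h3 G0 h4 h5).
  rewrite -derive1E (differentiation_under_integral measurableT I (fun x _ => igw x) h3 G0 h4 h5).
  rewrite -[in RHS]integral_gauss_sin//.
  under eq_Rintegral do rewrite d1E -mulN1r.
  rewrite RintegralZl ?mulN1r//.
  apply: (le_integrable measurableT _ _ (integrable_mul_expR_sqr m c0)).
    apply/measurable_EFinP; apply: measurable_funM.
      apply: measurable_funM; first exact: measurable_funB.
      apply: measurableT_comp => //; apply: measurableT_comp => //.
      by apply: measurable_funM => //; apply: measurable_funX; exact: measurable_funB.
    apply: measurableT_comp; first by apply: continuous_measurable_fun; exact: continuous_sin.
    by apply: measurable_funD => //; apply: measurable_funM => //; exact: measurable_funB.
  by move=> y _; rewrite /= lee_fin normrM ler_piMr// ler_norml sin_geN1 sin_le1.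
rewrite -[LHS]/(H l) (@gauss_ode c H) ?gt_eqF//.
congr (_ * _); rewrite /H /gw -RintegralZl//; last exact: integrable_expR_sqr.
by apply: eq_Rintegral => y _; rewrite mul0r add0r mulrC.
Qed.

(** The characteristic function of a normal law in real form. Centring the cosine at m puts l m into
    the phase, and the total mass 1 of the density supplies the remaining Gaussian integral. *)
Lemma integral_normal_cos s m th l : s != 0 ->
  (\int[mu]_y (normal_pdf m s y * cos (l * y + th)))%R =
  expR (- (s ^+ 2 * l ^+ 2 / 2)) * cos (l * m + th).
Proof.
move=> s0; rewrite /normal_pdf (negbTE s0); pose c := (s ^+ 2 *+ 2)^-1.
have c0 : 0 < c by rewrite invr_gt0 mulrn_wgt0// exprn_even_gt0.
have nE y : normal_fun m s y = expR (- (c * (y - m) ^+ 2)).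
  by rewrite /normal_fun mulNr mulrC.
have := @integral_normal_pdf R m s; rewrite /normal_pdf (negbTE s0) => I1.
have {}I1 : normal_peak s * (\int[mu]_y expR (- (c * (y - m) ^+ 2)))%R = 1.
  rewrite -RintegralZl//; last exact: integrable_expR_sqr.
  by rewrite /Rintegral; under eq_integral do rewrite -nE; rewrite I1.
transitivity (normal_peak s * (\int[mu]_y gw c m (l * m + th) l y))%R.
  rewrite -RintegralZl//.
    by apply: eq_Rintegral => y _; rewrite nE /gw mulrA; congr (_ * cos _); ring.
  apply: integrable_expR_sqr_bounded => // [|y]; last by rewrite ler_norml cos_geN1 cos_le1.
  apply: measurableT_comp; first by apply: continuous_measurable_fun; exact: continuous_cos.
  by apply: measurable_funD => //; apply: measurable_funM => //; exact: measurable_funB.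
rewrite integral_gauss_cos// mulrCA (mulrCA (normal_peak s)) I1 mulr1.
by congr (expR (- _) * _); rewrite /c -mulr_natr; field; rewrite s0.
Qed.

End GaussianFourier.

(** * Action of the heat semigroup on waves *)

Section HeatWave.
Context {R : realType}.
Notation mu := (@lebesgue_measure R).

Lemma integral_normal_wave (m s c a l th : R) : s != 0 -> `|a| <= c ->
  (\int[mu]_y (normal_pdf m s y * (c + a * cos (l * y + th)))%:E)%E =
  (c + a * (expR (- (s ^+ 2 * l ^+ 2 / 2)) * cos (l * m + th)))%:E.
Proof.
move=> s0 ac.
have icos : mu.-integrable setT (fun y => (normal_pdf m s y * cos (l * y + th))%:E).
  apply: (le_integrable measurableT _ _ (integrable_normal_pdf m s)).
    apply/measurable_EFinP; apply: measurable_funM; first exact: measurable_normal_pdf.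
    apply: measurableT_comp; first by apply: continuous_measurable_fun; exact: continuous_cos.
    by apply: measurable_funD => //; exact: measurable_funM.
  by move=> y _; rewrite /= lee_fin normrM ler_piMr// ler_norml cos_geN1 cos_le1.
have E y : normal_pdf m s y * (c + a * cos (l * y + th)) =
    c * normal_pdf m s y + a * (normal_pdf m s y * cos (l * y + th)) by ring.
under eq_integral do rewrite E.
have iE : mu.-integrable setT (fun y =>
    (c * normal_pdf m s y + a * (normal_pdf m s y * cos (l * y + th)))%:E).
  apply: integrable_addr => //; apply: integrable_mulr => //.
  exact: integrable_normal_pdf.
rewrite -[LHS]fineK; last exact: (integrable_fin_num measurableT iE).
congr (_%:E); rewrite -/(Rintegral _ _ _) RintegralD//=; last 2 first.
- by apply: integrable_mulr => //; exact: integrable_normal_pdf.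
- exact: integrable_mulr.
rewrite !RintegralZl// ?integral_normal_cos//; last exact: integrable_normal_pdf.
by rewrite /Rintegral integral_normal_pdf mulr1.
Qed.

Lemma heat_kernel_ge0 d t (x y : 'rV[R]_d) : 0 <= heat_kernel t x y.
Proof. by apply: prodr_ge0 => i _; exact: normal_pdf_ge0. Qed.

Lemma measurable_heat_kernel d t (x : 'rV[R]_d) : measurable_fun setT (heat_kernel t x).
Proof.
apply: measurable_prod => i _.
exact: measurableT_comp (measurable_normal_pdf _ _) (measurable_rV_coord i).
Qed.

Lemma measurable_heat_kernel_wave d t (x lam : 'rV[R]_d) (c a th : R) :
  measurable_fun setT (fun y => (heat_kernel t x y * (c + a * wave th lam y))%:E).
Proof.
apply/measurable_EFinP/measurable_funM; first exact: measurable_heat_kernel.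
apply: measurable_funD => //; apply: measurable_funM => //.
exact: continuous_measurable_rV (@continuous_wave _ _ th lam).
Qed.

(** Induction on the dimension. Integrating out one coordinate leaves an affine function of the wave
    in the others, with a damped amplitude and a shifted phase; hence [a] and [th] are generalized.
    The condition on [a] and [c] makes the integrand non-negative, as Tonelli's theorem requires. *)
Lemma heat_kernel_wave d t (x lam : 'rV[R]_d) (c a th : R) : 0 < t -> `|a| <= c ->
  (\int[lebesgue_rV d]_y (heat_kernel t x y * (c + a * wave th lam y))%:E)%E =
  (c + a * (expR (- (t * dotv lam lam / 2)) * wave th lam x))%:E.
Proof.
move=> t0; have st0 : Num.sqrt t != 0 by rewrite gt_eqF ?sqrtr_gt0.
elim: d => [|d IH] in x lam c a th *; move=> ac.
  rewrite /= integral_dirac//=; last exact: measurable_heat_kernel_wave.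
  rewrite diracE mem_set// mul1e /heat_kernel /wave /dotv.
  by rewrite !big_ord0 mulr0 mul0r oppr0 expR0 !mul1r add0r.
pose tl (v : 'rV[R]_d.+1) : 'rV[R]_d := \row_i v ord0 (lift ord0 i).
have dotvE (v : 'rV[R]_d) y : dotv lam (rV_cons (v, y)) = lam ord0 ord0 * y + dotv (tl lam) v.
  rewrite /dotv big_ord_recl mxE unlift_none; congr (_ + _).
  by apply: eq_bigr => i _; rewrite !mxE liftK.
have dotlx v : dotv lam v = lam ord0 ord0 * v ord0 ord0 + dotv (tl lam) (tl v).
  rewrite /dotv big_ord_recl; congr (_ + _).
  by apply: eq_bigr => i _; rewrite !mxE.
have hkE (v : 'rV[R]_d) y : heat_kernel t x (rV_cons (v, y)) =
    heat_kernel t (tl x) v * normal_pdf (x ord0 ord0) (Num.sqrt t) y.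
  rewrite /heat_kernel big_ord_recl mulrC mxE unlift_none; congr (_ * _).
  by apply: eq_bigr => i _; rewrite !mxE liftK.
rewrite lebesgue_rV_succE; last 2 first.
- exact: measurable_heat_kernel_wave.
- by move=> v; rewrite lee_fin mulr_ge0 ?heat_kernel_ge0// affine_ge0// wave_le1.
have c0 : 0 <= c by apply: le_trans ac.
under eq_integral => v _.
  under eq_integral => y _.
    rewrite hkE -mulrA EFinM /wave dotvE -addrA; over.
  rewrite ge0_integralZl//=; last 3 first.
  - apply/measurable_EFinP/measurable_funM; first exact: measurable_normal_pdf.
    apply: measurable_funD => //; apply: measurable_funM => //.
    apply: measurableT_comp; first by apply: continuous_measurable_fun; exact: continuous_cos.
    by apply: measurable_funD => //; exact: measurable_funM.
  - by move=> y _; rewrite lee_fin mulr_ge0 ?normal_pdf_ge0// affine_ge0// normr_cos_le1.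
  - by rewrite lee_fin heat_kernel_ge0.
  rewrite integral_normal_wave// sqr_sqrtr ?ltW//.
  rewrite addrCA mulrA -EFinM -[cos _]/(wave (lam ord0 ord0 * x ord0 ord0 + th) (tl lam) v).
  over.
rewrite IH; last first.
  rewrite normrM; apply: le_trans ac; rewrite ler_piMr//.
  by rewrite ger0_norm ?expR_ge0// -expR0 ler_expR oppr_le0 divr_ge0// mulr_ge0 ?sqr_ge0// ltW.
congr (_ + _)%:E; rewrite -mulrA; congr (_ * _); rewrite mulrA -expRD; congr (expR _ * _).
  by rewrite dotlx; ring.
by rewrite /wave dotlx; congr cos; ring.
Qed.

(** Constants and waves are eigenfunctions of P^beta_t, with eigenvalues e^(beta t) and e^(rho
    t). *)
Lemma Pbeta_wave d beta t (x lam : 'rV[R]_d) (c a th : R) : 0 <= t -> `|a| <= c ->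
  Pbeta beta t (fun y => c + a * wave th lam y) x =
  (expR (beta * t) * c + a * (expR (rho beta lam * t) * wave th lam x))%:E.
Proof.
move=> t0 ac; rewrite /Pbeta /heat_semigroup; have [->|tn0] := eqVneq t 0.
  by rewrite !mulr0 expR0 !mul1r mul1e.
rewrite heat_kernel_wave ?lt_neqAle ?(eq_sym 0) ?tn0//.
rewrite -EFinM mulrDr; congr (_ + _)%:E.
rewrite mulrCA; congr (_ * _); rewrite mulrA -expRD; congr (expR _ * _).
by rewrite /rho; field.
Qed.

End HeatWave.

(** * Second-order expansion of the exponential *)

Section ExpExpansion.
Context {R : realType}.
Implicit Types (z p q r v : R).

(** From e^z (1 - z) <= e^z e^(-z) = 1, and 1 / (1 - z) <= 1 + z + 2 z^2 when |z| <= 1/2. *)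
Lemma expR_sub_le z : `|z| <= 2^-1 -> 0 <= expR z - 1 - z <= 2 * z ^+ 2.
Proof.
rewrite ler_norml => /andP[z1 z2]; apply/andP; split.
  by rewrite -addrA -opprD subr_ge0 expR_ge1Dx.
have : expR z * (1 - z) <= 1.
  rewrite -[leRHS](expRxMexpNx_1 z) ler_pM2l ?expR_gt0//.
  exact: expR_ge1Dx.
have := expR_gt0 z; set e := expR z => e0 h.
have : e <= (1 + z + 2 * z ^+ 2) by nra.
by move=> ?; lra.
Qed.

(** The mean value theorem for the remainder [g], whose derivative is the remainder bounded in
    [expR_sub_le]. *)
Lemma expR_sub2_le z : `|z| <= 2^-1 -> `|expR z - 1 - z - z ^+ 2 / 2| <= 2 * `|z| ^+ 3.
Proof.
move=> z2; pose g (x : R) := expR x - 1 - x - x ^+ 2 / 2.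
have dg (x : R) : is_derive x (1 : R) g (expR x - 1 - x).
  by apply: is_derive_eq; rewrite /GRing.scale/=; field.
have cg : continuous g.
  by move=> x; apply/differentiable_continuous/derivable1_diffP; have [] := dg x.
have g0 : g 0 = 0 by rewrite /g expR0 expr0n/= mul0r !subr0 subrr.
have bd (x : R) : `|x| <= `|z| -> `|expR x - 1 - x| <= 2 * `|z| ^+ 2.
  move=> xz; have /andP[h1 h2] := expR_sub_le (le_trans xz z2).
  rewrite ger0_norm//; apply: le_trans h2 _; rewrite ler_pM2l//.
  by rewrite -(real_normK (num_real x)) ler_sqr ?nnegrE.
rewrite -[X in `|X|]/(g z).
have [z0|z0|->] := ltgtP z 0; last by rewrite g0 normr0 expr0n/= mulr0.
- have [y] := @MVT R g _ z 0 z0 (fun x _ => dg x) (continuous_subspaceT cg).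
  rewrite in_itv/= => /andP[zy y0]; rewrite g0 sub0r => /(congr1 Num.norm).
  rewrite normrN => ->; rewrite sub0r normrM normrN exprSr mulrA ler_wpM2r//.
  by apply: bd; rewrite !ltr0_norm// lerN2 ltW.
- have [y] := @MVT R g _ 0 z z0 (fun x _ => dg x) (continuous_subspaceT cg).
  rewrite in_itv/= => /andP[zy y0]; rewrite g0 !subr0 => ->.
  rewrite normrM exprSr mulrA ler_wpM2r//.
  by apply: bd; rewrite !gtr0_norm// ltW.
Qed.

(** With v = 1 / (n + 1) the exponent is v w, where w tends to -p. The terms of e^z up to z^2 / 2
    contribute exactly [main], and the cubic remainder divided by v^2 is O(v). Second moments are
    read off Laplace transforms in this way. *)
Lemma expR_expansion2 p q r :
  harmonic n ^- 2 * (expR (- p * harmonic n + q * harmonic n ^+ 2 + r * harmonic n ^+ 3)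
    - 1 + p * harmonic n) @[n --> \oo] --> q + p ^+ 2 / 2.
Proof.
pose v : nat -> R := harmonic.
have v0 n : 0 < v n by rewrite /v/harmonic/= invr_gt0.
have cv : v n @[n --> \oo] --> (0 : R) by exact: cvg_harmonic.
pose w n := - p + q * v n + r * v n ^+ 2.
have cpoly (a b c : R) : a + b * v n + c * v n ^+ 2 @[n --> \oo] --> a.
  have H : a + b * v n + c * v n ^+ 2 @[n --> \oo] --> a + b * 0 + c * 0 ^+ 2.
    apply: cvgD; [apply: cvgD; [exact: cvg_cst|by apply: cvgM; [exact: cvg_cst|]]|].
    by apply: cvgM; [exact: cvg_cst|rewrite expr2; apply: cvgM].
  by rewrite expr0n/= !mulr0 !addr0 in H.
have cw : w n @[n --> \oo] --> - p by exact: cpoly.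
have E n : - p * v n + q * v n ^+ 2 + r * v n ^+ 3 = v n * w n by rewrite /w; ring.
pose main n := (q + r * v n + 0 * v n ^+ 2) + w n * w n / 2.
have cmain : main n @[n --> \oo] --> q + p ^+ 2 / 2.
  rewrite -(sqrrN p) expr2; apply: cvgD; first exact: cpoly.
  by apply: cvgM; [apply: cvgM|exact: cvg_cst].
have cvw : v n * w n @[n --> \oo] --> (0 : R).
  by rewrite -[X in _ --> X](mul0r (- p)); exact: cvgM.
have cerr : 2 * (v n * (`|w n| * `|w n| * `|w n|)) @[n --> \oo] --> (0 : R).
  rewrite -[X in _ --> X](mulr0 2) -(mul0r (`|- p| * `|- p| * `|- p|)).
  apply: cvgM; first exact: cvg_cst.
  by apply: cvgM => //; apply: cvgM; [apply: cvgM|]; apply: cvg_norm.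
rewrite [X in X @ _ --> _](_ : _ = fun n => main n +
  v n ^- 2 * (expR (v n * w n) - 1 - v n * w n - (v n * w n) ^+ 2 / 2)); last first.
  apply/funext => n; rewrite -/(v n) E; set e := expR _.
  rewrite /main /w; move: (v0 n); move: (v n) e => a e a0; field.
  by rewrite gt_eqF.
rewrite -[X in _ --> X]addr0; apply: cvgD => //; apply: norm_cvg0.
apply: (@squeeze_cvgr _ _ _ _ (cst 0) (fun n => 2 * (v n * (`|w n| * `|w n| * `|w n|)))) => //;
  last exact: cvg_cst.
have h2 : 0 < 2^-1 :> R by rewrite invr_gt0.
have [N _ HN] := cvgr0_norm_le _ cvw _ h2.
exists N => // n /= Nn; rewrite normr_ge0/=.
rewrite normrM gtr0_norm ?invr_gt0 ?exprn_gt0//.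
rewrite ler_pdivrMl ?exprn_gt0//; apply: le_trans (expR_sub2_le (HN n Nn)) _.
by rewrite normrM gtr0_norm// le_eqVlt; apply/orP; left; apply/eqP; ring.
Qed.

Lemma expR_expansion1 p q :
  (harmonic n)^-1 * (expR (- p * harmonic n + q * harmonic n ^+ 2) - 1) @[n --> \oo] --> - p.
Proof.
have v0 n : 0 < harmonic n :> R by rewrite /harmonic/= invr_gt0.
rewrite [X in X @ _ --> _](_ : _ = fun n => harmonic n * (harmonic n ^- 2 *
  (expR (- p * harmonic n + q * harmonic n ^+ 2 + 0 * harmonic n ^+ 3)
    - 1 + p * harmonic n)) - p); last first.
  apply/funext => n; rewrite mul0r addr0; move: (v0 n); set e := expR _; move: e.
  by move: (harmonic n) => v e v1; field; rewrite gt_eqF.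
rewrite -[X in _ --> X]add0r; apply: cvgB; last exact: cvg_cst.
rewrite -[X in _ --> X](mul0r (q + p ^+ 2 / 2)); apply: cvgM.
  exact: cvg_harmonic.
exact: expR_expansion2.
Qed.

Lemma expRN_lipschitz (a b : R) : 0 <= a -> 0 <= b -> `|expR (- a) - expR (- b)| <= `|a - b|.
Proof.
wlog ab : a b / a <= b.
  move=> H a0 b0; have [ab|/ltW ba] := leP a b; first exact: H.
  by rewrite distrC (distrC a); exact: H.
move=> a0 b0; rewrite ger0_norm ?subr_ge0 ?ler_expR ?lerN2//.
rewrite ler0_norm ?subr_le0// opprB.
have -> : expR (- b) = expR (- a) * expR (- (b - a)) by rewrite -expRD; congr expR; ring.
have h1 : expR (- a) <= 1 by rewrite -expR0 ler_expR oppr_le0.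
have h2 := expR_ge1Dx (- (b - a)); have h3 := expR_gt0 (- a).
have h4 : expR (- (b - a)) <= 1 by rewrite -expR0 ler_expR oppr_le0 subr_ge0.
by nra.
Qed.

End ExpExpansion.

(** * Monotonicity of integrals of non-negative functions *)

Section IntegralMonotone.
Context {dT : measure_display} {T : measurableType dT} {R : realType}.
Variable mu : {measure set T -> \bar R}.

Import HBNNSimple.

(* Unlike [ge0_le_integral], no measurability is required. *)
Lemma ge0_le_integral_nomeas (D : set T) (f g : T -> \bar R) :
  (forall x, D x -> 0 <= f x)%E -> (forall x, D x -> f x <= g x)%E ->
  (\int[mu]_(x in D) f x <= \int[mu]_(x in D) g x)%E.
Proof.
move=> f0 fg; rewrite integral_mkcond [leRHS]integral_mkcond.
have f0' x : (0 <= (f \_ D) x)%E by apply: erestrict_ge0.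
have fg' x : ((f \_ D) x <= (g \_ D) x)%E by apply: lee_restrict.
rewrite !ge0_integralTE//; last by move=> x; exact: le_trans (f0' x) (fg' x).
apply: le_ereal_sup => _ [h hf <-]; exists h => // x.
exact: le_trans (hf x) (fg' x).
Qed.

End IntegralMonotone.

(** * Bounds on solutions of the log-Laplace equation *)

Section Moments.
Context {R : realType} {d : nat} (alpha beta : R).
Hypotheses (alpha0 : 0 < alpha) (beta0 : 0 < beta).
Implicit Types (lam x : 'rV[R]_d) (t c a th : R).
Notation leb := (@lebesgue_measure R).

Definition itg01 t (F : R -> R) : R := (\int[leb]_(s in `[0%R, t]) F s)%R.
(** The time integrals left when P^beta_(t-s) acts on the square of e^(beta s) c + a e^(rho s) wave:
    [b1] goes with c^2, [b2] with a^2 (the squared wave being replaced by 1) and [b3] with the cross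
    term 2 c a wave. *)
Definition b1 t := itg01 t (fun s => expR (beta * (t - s)) * expR (beta * s) ^+ 2).
Definition b2 lam t := itg01 t (fun s => expR (beta * (t - s)) * expR (rho beta lam * s) ^+ 2).
Definition b3 lam t := itg01 t (fun s => expR (rho beta lam * (t - s)) * (expR (beta * s) * expR (rho beta lam * s))).

Lemma integrable_continuous_itv (t : R) (F : R -> R) : continuous F ->
  leb.-integrable `[0%R, t] (fun s => (F s)%:E).
Proof.
move=> cF; apply: continuous_compact_integrable; first exact: segment_compact.
exact: continuous_subspaceT.
Qed.

Section Solution.
Variables (c a th : R) (lam : 'rV[R]_d) (u : R -> 'rV[R]_d -> R).
Hypotheses (ac : `|a| <= c)
  (Hu : log_laplace_solution alpha beta (fun y => c + a * wave th lam y) u).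

Let c0 : 0 <= c. Proof. by apply: le_trans ac. Qed.

(** The time integral in the equation is non-negative and can only push u below P^beta_t f. *)
Lemma solution_ub t x : 0 <= t ->
  u t x <= expR (beta * t) * c + a * (expR (rho beta lam * t) * wave th lam x).
Proof.
move=> t0; have [_ u0 /(_ t x t0)] := Hu; rewrite Pbeta_wave//.
set I := (\int[_]_(_ in _) _)%E => E.
have I0 : (0 <= I)%E.
  apply: integral_ge0 => s _; rewrite /Pbeta mule_ge0 ?lee_fin ?expR_ge0//.
  rewrite /heat_semigroup; case: ifPn => _.
    by rewrite lee_fin mulr_ge0 ?sqr_ge0// ltW.
  apply: integral_ge0 => y _.
  by rewrite lee_fin mulr_ge0 ?heat_kernel_ge0// mulr_ge0 ?sqr_ge0// ltW.
by rewrite -lee_fin -E leeDl.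
Qed.

Lemma Pbeta_le t (f g : 'rV[R]_d -> R) x : (forall y, 0 <= f y) -> (forall y, f y <= g y) ->
  (Pbeta beta t f x <= Pbeta beta t g x)%E.
Proof.
move=> f0 fg; rewrite /Pbeta lee_pmul2l ?lte_fin ?expR_gt0//.
rewrite /heat_semigroup; case: ifPn => _; first by rewrite lee_fin.
apply: ge0_le_integral_nomeas => y _; first by rewrite lee_fin mulr_ge0// heat_kernel_ge0.
by rewrite lee_fin ler_wpM2l// heat_kernel_ge0.
Qed.

(* Since |wave| <= 1, the square of the upper bound is at most an affine function of
   the wave, on which the semigroup acts explicitly. *)
Lemma solution_lb t x : 0 <= t ->
  expR (beta * t) * c + a * (expR (rho beta lam * t) * wave th lam x)
  - alpha * (c ^+ 2 * b1 t + a ^+ 2 * b2 lam t + 2 * c * a * (b3 lam t * wave th lam x))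
  <= u t x.
Proof.
move=> t0; have [_ u0 /(_ t x t0)] := Hu; rewrite Pbeta_wave//.
set I := (\int[_]_(_ in _) _)%E => E.
pose F1 s := expR (beta * (t - s)) * expR (beta * s) ^+ 2.
pose F2 s := expR (beta * (t - s)) * expR (rho beta lam * s) ^+ 2.
pose F3 s := expR (rho beta lam * (t - s)) * (expR (beta * s) * expR (rho beta lam * s)).
have i1 : leb.-integrable `[0%R, t] (fun s => (F1 s)%:E).
  apply: integrable_continuous_itv => s.
  by apply/differentiable_continuous/derivable1_diffP; rewrite /F1; apply: ex_derive.
have i2 : leb.-integrable `[0%R, t] (fun s => (F2 s)%:E).
  apply: integrable_continuous_itv => s.
  by apply/differentiable_continuous/derivable1_diffP; rewrite /F2; apply: ex_derive.
have i3 : leb.-integrable `[0%R, t] (fun s => (F3 s)%:E).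
  apply: integrable_continuous_itv => s.
  by apply/differentiable_continuous/derivable1_diffP; rewrite /F3; apply: ex_derive.
pose G s := alpha * c ^+ 2 * F1 s + (alpha * a ^+ 2 * F2 s + alpha * (2 * c * a * wave th lam x) * F3 s).
have iG : leb.-integrable `[0%R, t] (fun s => (G s)%:E).
  apply: integrable_addr => //; first exact: integrable_mulr.
  by apply: integrable_addr => //; exact: integrable_mulr.
have IG : (I <= \int[leb]_(s in `[0%R, t]) (G s)%:E)%E.
  apply: ge0_le_integral_nomeas => s.
    move=> _; rewrite /Pbeta mule_ge0 ?lee_fin ?expR_ge0//.
    rewrite /heat_semigroup; case: ifPn => _.
      by rewrite lee_fin mulr_ge0 ?sqr_ge0// ltW.
    apply: integral_ge0 => y _.
    by rewrite lee_fin mulr_ge0 ?heat_kernel_ge0// mulr_ge0 ?sqr_ge0// ltW.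
  rewrite /= in_itv/= => /andP[s0 st].
  pose cc := alpha * (c ^+ 2 * expR (beta * s) ^+ 2 + a ^+ 2 * expR (rho beta lam * s) ^+ 2).
  pose aa := alpha * (2 * c * a * (expR (beta * s) * expR (rho beta lam * s))).
  (* The inequality 2 |x y| <= x^2 + y^2 makes the dominating affine function admissible for
     [Pbeta_wave]. *)
  have aacc : `|aa| <= cc.
    rewrite /aa /cc normrM gtr0_norm// ler_wpM2l ?(ltW alpha0)//.
    rewrite ler_norml; set e := expR _; set f := expR _; apply/andP; split.
      by have := sqr_ge0 (c * e + a * f); nra.
    by have := sqr_ge0 (c * e - a * f); nra.
  apply: (@le_trans _ _ (Pbeta beta (t - s) (fun y => cc + aa * wave th lam y) x)).
    apply: Pbeta_le => y; first by rewrite mulr_ge0 ?sqr_ge0// ltW.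
    have us := solution_ub y s0; have us0 := u0 s y s0.
    rewrite /cc /aa -mulrA -mulrDr ler_wpM2l ?(ltW alpha0)//.
    have := wave_le1 th lam y; move: us us0; set w := wave _ _ _; set e := expR _; set f := expR _.
    move=> us us0 w1; apply: (@le_trans _ _ ((e * c + a * (f * w)) ^+ 2)).
      by rewrite ler_sqr ?nnegrE//; exact: le_trans us.
    have : (a * f) ^+ 2 * w ^+ 2 <= (a * f) ^+ 2.
      by rewrite ler_piMr ?sqr_ge0// -(real_normK (num_real w)) expr_le1.
    by nra.
  rewrite Pbeta_wave ?subr_ge0// lee_fin /G /F1 /F2 /F3 /cc /aa.
  by rewrite le_eqVlt; apply/orP; left; apply/eqP; ring.
have IGE : (\int[leb]_(s in `[0%R, t]) (G s)%:E)%E =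
  (alpha * (c ^+ 2 * b1 t + a ^+ 2 * b2 lam t + 2 * c * a * (b3 lam t * wave th lam x)))%:E.
  rewrite -[LHS]fineK ?(integrable_fin_num _ iG)//; congr EFin.
  rewrite -/(Rintegral _ _ _) RintegralD//; last 2 first.
  - exact: integrable_mulr.
  - by apply: integrable_addr => //; exact: integrable_mulr.
  rewrite RintegralD//; try exact: integrable_mulr.
  rewrite !RintegralZl//.
  transitivity (alpha * c ^+ 2 * b1 t + (alpha * a ^+ 2 * b2 lam t +
    alpha * (2 * c * a * wave th lam x) * b3 lam t)) => //.
  by move: (b1 t) (b2 lam t) (b3 lam t) => *; ring.
rewrite lerBlDr -lee_fin -E EFinD leeD2l//.
by rewrite -IGE.
Qed.

End Solution.

(** The exponent beta (t - s) + 2 rho s is at most K t. The choice K = 2 beta serves all frequencies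
    at once, K = beta + eps those outside D. *)
Lemma b2_le lam t K : 0 <= t -> beta <= K -> 2 * rho beta lam <= K ->
  0 <= b2 lam t <= t * expR (K * t).
Proof.
move=> t0 bK rK; rewrite /b2 /itg01.
pose F s := expR (beta * (t - s)) * expR (rho beta lam * s) ^+ 2.
rewrite -/(Rintegral _ _ F).
have iF : leb.-integrable `[0%R, t] (fun s => (F s)%:E).
  apply: integrable_continuous_itv => s.
  by apply/differentiable_continuous/derivable1_diffP; rewrite /F; apply: ex_derive.
apply/andP; split; first by apply: Rintegral_ge0 => s _; rewrite /F mulr_ge0 ?expR_ge0.
apply: (@le_trans _ _ (\int[leb]_(s in `[0%R, t]) expR (K * t))%R).
  apply: le_Rintegral => // [|s].
    by apply: integrable_continuous_itv; exact: cst_continuous.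
  rewrite /= in_itv/= => /andP[s0 st]; rewrite /F expr2 -!expRD ler_expR.
  have : beta * (t - s) <= K * (t - s) by rewrite ler_wpM2r ?subr_ge0.
  have : 2 * rho beta lam * s <= K * s by rewrite ler_wpM2r.
  by lra.
rewrite Rintegral_cst//= lebesgue_measure_itv/= lte_fin.
case: ifPn => _ /=; first by rewrite subr0 mulrC.
by rewrite mulr0 mulr_ge0 ?expR_ge0.
Qed.

Lemma rho0 : rho beta (0 : 'rV[R]_d) = beta.
Proof.
rewrite /rho /dotv big1 ?mulr0 ?subr0// => i _; by rewrite mxE mul0r.
Qed.

Lemma b1E t : b1 t = b2 0 t.
Proof. by rewrite /b1 /b2 rho0. Qed.

(** The second moment comes from a second difference of Laplace transforms in which the constant
    function has the negative weight; so a bound on u from above, sharp to order c^2, is needed for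
    constants. It results from inserting [solution_lb] into the time integral, with an error of
    order c^3. *)
Lemma constant_solution_ub c u t x : 0 < c -> 0 <= t ->
  log_laplace_solution alpha beta (fun y : 'rV[R]_d => c + 0 * wave 0 0 y) u ->
  2 * alpha * c * (t * expR (2 * beta * t)) <= 1 ->
  u t x <= expR (beta * t) * c - alpha * c ^+ 2 * b1 t
    + 2 * alpha ^+ 2 * c ^+ 3 * (t * expR (2 * beta * t)) * (t * expR (beta * t)).
Proof.
move=> c0 t0 Hu cK; have c0' : `|0 : R| <= c by rewrite normr0 ltW.
have [_ u0 /(_ t x t0)] := Hu; rewrite Pbeta_wave//.
set I := (\int[_]_(_ in _) _)%E => E.
set K := t * _ in cK *.
have K0 : 0 <= K by rewrite mulr_ge0 ?expR_ge0.
pose F1 s := expR (beta * (t - s)) * expR (beta * s) ^+ 2.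
have i1 : leb.-integrable `[0%R, t] (fun s => (F1 s)%:E).
  apply: integrable_continuous_itv => s.
  by apply/differentiable_continuous/derivable1_diffP; rewrite /F1; apply: ex_derive.
have i2 : leb.-integrable `[0%R, t] (fun s => (expR (beta * t))%:E).
  by apply: integrable_continuous_itv; exact: cst_continuous.
pose G s := alpha * c ^+ 2 * F1 s - 2 * alpha ^+ 2 * c ^+ 3 * K * expR (beta * t).
have iG : leb.-integrable `[0%R, t] (fun s => (G s)%:E).
  by apply: integrable_subr => //; exact: integrable_mulr.
(* A lower bound of alpha u(s)^2: with e = e^(beta s), the difference (e c)^2 - u^2 = (e c - u)(e c
   + u) is at most alpha c^2 K times 2 e c. The smallness of c and e >= 1 make it non-negative. *)
pose w s := alpha * (c ^+ 2 * expR (beta * s) ^+ 2 - 2 * alpha * c ^+ 3 * K * expR (beta * s)).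
have e1 (s : R) : 0 <= s -> 1 <= expR (beta * s).
  by move=> s0; rewrite -expR0 ler_expR mulr_ge0// ltW.
have w0 (s : R) : 0 <= s -> 0 <= w s.
  move=> s0; rewrite /w mulr_ge0 ?(ltW alpha0)//.
  have -> : c ^+ 2 * expR (beta * s) ^+ 2 - 2 * alpha * c ^+ 3 * K * expR (beta * s) =
    c ^+ 2 * expR (beta * s) * (expR (beta * s) - 2 * alpha * c * K) by ring.
  apply: mulr_ge0; first by rewrite mulr_ge0 ?expR_ge0 ?sqr_ge0.
  rewrite subr_ge0.
  exact: le_trans (e1 s s0).
have IG : (\int[leb]_(s in `[0%R, t]) (G s)%:E <= I)%E.
  have GE (s : R) : 0 <= s -> G s = expR (beta * (t - s)) * w s.
    move=> s0; rewrite /G /w /F1; have -> : expR (beta * t) = expR (beta * (t - s)) * expR (beta * s).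
      by rewrite -expRD; congr expR; ring.
    by move: (expR (beta * s)) (expR (beta * (t - s))) => e f; ring.
  apply: ge0_le_integral_nomeas => s.
    rewrite /= in_itv/= => /andP[s0 _]; rewrite lee_fin GE//.
    by rewrite mulr_ge0 ?expR_ge0 ?w0.
  rewrite /= in_itv/= => /andP[s0 st].
  apply: (@le_trans _ _ (Pbeta beta (t - s) (fun y => w s + 0 * wave 0 0 y) x)).
    by rewrite Pbeta_wave ?subr_ge0 ?normr0 ?w0// mul0r addr0 GE.
  apply: Pbeta_le => y; first by rewrite mul0r addr0 w0.
  rewrite mul0r addr0 /w ler_wpM2l ?(ltW alpha0)//.
  have us := solution_ub c0' Hu y s0; have us0 := u0 s y s0.
  have ul := solution_lb c0' Hu y s0.
  move: us ul; rewrite expr0n/= !(mul0r, mulr0, addr0) => us ul.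
  have b1K : b1 s <= K.
    have bb : beta <= 2 * beta by rewrite ler_peMl ?ler1n// ltW.
    have rb : 2 * rho beta (0 : 'rV[R]_d) <= 2 * beta by rewrite rho0.
    rewrite b1E; have /andP[_ h] := @b2_le 0 s (2 * beta) s0 bb rb.
    apply: le_trans h _; rewrite /K ler_pM ?expR_ge0// ler_expR.
    by rewrite ler_wpM2l// mulr_ge0// ltW.
  set e := expR (beta * s) in us ul *.
  have ul2 : e * c - u s y <= alpha * c ^+ 2 * K.
    have : alpha * (c ^+ 2 * b1 s) <= alpha * (c ^+ 2 * K).
      by rewrite ler_wpM2l ?(ltW alpha0)// ler_wpM2l ?sqr_ge0.
    by lra.
  have : (e * c - u s y) * (e * c + u s y) <= alpha * c ^+ 2 * K * (2 * (e * c)).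
    apply: ler_pM => //; rewrite ?subr_ge0//; last by lra.
    by rewrite addr_ge0// (le_trans us0 us).
  have -> : (e * c - u s y) * (e * c + u s y) = c ^+ 2 * e ^+ 2 - u s y ^+ 2 by ring.
  have -> : alpha * c ^+ 2 * K * (2 * (e * c)) = 2 * alpha * c ^+ 3 * K * e by ring.
  by lra.
have IGE : (\int[leb]_(s in `[0%R, t]) (G s)%:E)%E =
  (alpha * c ^+ 2 * b1 t - 2 * alpha ^+ 2 * c ^+ 3 * K * (t * expR (beta * t)))%:E.
  rewrite -[LHS]fineK ?(integrable_fin_num _ iG)//; congr EFin.
  rewrite -/(Rintegral _ _ _) RintegralB//; try exact: integrable_mulr.
  rewrite !RintegralZl// /b1 /itg01 -/F1; congr (_ - _ * _).
  rewrite Rintegral_cst//= lebesgue_measure_itv/= lte_fin mulrC.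
  case: ifPn => [_|]; first by rewrite /= subr0.
  by rewrite -leNgt => h; have -> : t = 0 by apply/le_anti; rewrite h t0.
have : (u t x)%:E + I = (expR (beta * t) * c)%:E by rewrite E mul0r addr0.
move=> {}E.
have : ((u t x)%:E + (alpha * c ^+ 2 * b1 t - 2 * alpha ^+ 2 * c ^+ 3 * K * (t * expR (beta * t)))%:E
   <= (expR (beta * t) * c)%:E)%E.
  by rewrite -E -IGE leeD2l.
by rewrite -EFinD lee_fin; lra.
Qed.

End Moments.

(** * Finite measures paired with waves *)

Section FiniteMeasures.
Context {R : realType} {d : nat}.
Implicit Types (nu : MF R d) (lam : 'rV[R]_d) (th c a : R).

Definition mass nu : R := fine (nu setT).
Definition wint th lam nu : R := (\int[nu]_x wave th lam x)%R.

Lemma MF_integrable nu (g : 'rV[R]_d -> R) M : measurable_fun setT g ->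
  (forall x, `|g x| <= M) -> nu.-integrable setT (fun x => (g x)%:E).
Proof.
move=> mg gM.
have ic : nu.-integrable setT (fun=> M%:E) by exact: finite_measure_integrable_cst.
apply: (le_integrable measurableT _ _ ic); first exact/measurable_EFinP.
move=> x _; rewrite /= lee_fin (le_trans (gM x))//; exact: ler_norm.
Qed.

Lemma measurable_wave1 th lam : measurable_fun setT (wave th lam).
Proof. exact: continuous_measurable_rV (@continuous_wave _ _ th lam). Qed.

Lemma wave_integrable nu th lam : nu.-integrable setT (fun x => (wave th lam x)%:E).
Proof. by apply: (@MF_integrable _ _ 1); [exact: measurable_wave1|exact: wave_le1]. Qed.

Lemma mass_ge0 nu : 0 <= mass nu.
Proof. exact: fine_ge0. Qed.

Lemma massE nu : nu setT = (mass nu)%:E.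
Proof. by rewrite /mass fineK// fin_num_measure. Qed.

Lemma wint_le th lam nu : `|wint th lam nu| <= mass nu.
Proof.
apply: le_trans (le_normr_Rintegral measurableT (wave_integrable _ _ _)) _.
have -> : mass nu = (\int[nu]_x (1 : R))%R by rewrite Rintegral_cst// mul1r.
apply: le_Rintegral => //.
- exact: (integrable_abse (wave_integrable nu th lam)).
- exact: finite_measure_integrable_cst.
- by move=> x _; exact: wave_le1.
Qed.

Lemma Rintegral_affine_wave nu c a th lam :
  (\int[nu]_x (c + a * wave th lam x))%R = c * mass nu + a * wint th lam nu.
Proof.
have iw := wave_integrable nu th lam.
have ic : nu.-integrable setT (fun=> c%:E) by exact: finite_measure_integrable_cst.
rewrite RintegralD//; last exact: integrable_mulr.
by rewrite Rintegral_cst// RintegralZl.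
Qed.

Lemma continuous_MF_pairing (g : 'rV[R]_d -> R) M : continuous g ->
  (forall x, `|g x| <= M) -> continuous (fun nu : MF R d => (\int[nu]_x g x)%R).
Proof.
move=> cg gM.
have bg : @bounded_continuous R d g by split => //; exists M.
pose g' : @bounded_continuous R d := exist _ g (mem_set bg).
move=> nu.
apply: (@continuous_comp _ _ _ (@MF_pairing R d) (fun h : {ptws @bounded_continuous R d -> R} => h g')).
  exact: initial_continuous.
exact: proj_continuous.
Qed.

Lemma continuous_measurable_MF (F : MF R d -> R) :
  continuous F -> measurable_fun setT F.
Proof.
move=> cF; apply: (@measurability _ _ _ _ setT F (@RGenOpens.G R)).
  exact: RGenOpens.measurableE.
move=> _ [_ [a [b ->] <-]]; rewrite setTI; apply: sub_sigma_algebra.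
by apply: open_comp => // *; exact: cF.
Qed.

Lemma continuous_wint th lam : continuous (wint th lam).
Proof. by apply: (@continuous_MF_pairing _ 1); [exact: continuous_wave|exact: wave_le1]. Qed.

Lemma measurable_wint th lam : measurable_fun setT (wint th lam).
Proof. apply: continuous_measurable_MF; exact: continuous_wint. Qed.

(** The mass is the wave pairing of zero frequency and phase, so it inherits every result on
    waves. *)
Lemma wint0 nu : wint 0 0 nu = mass nu.
Proof.
rewrite /wint (_ : wave 0 0 = cst 1); first by rewrite Rintegral_cst// mul1r.
apply/funext => x; rewrite /wave /dotv big1 ?addr0 ?cos0// => i _.
by rewrite mxE mul0r.
Qed.

Lemma continuous_mass : continuous mass.
Proof.
rewrite (_ : mass = wint 0 0); first exact: continuous_wint.
by apply/funext => nu; rewrite wint0.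
Qed.

Lemma measurable_mass : measurable_fun setT mass.
Proof. apply: continuous_measurable_MF; exact: continuous_mass. Qed.

End FiniteMeasures.

(** * Fatou's lemma with convergent bounds *)

Section FatouReal.
Context {dT : measure_display} {T : measurableType dT} {R : realType}.
Variable mu : {measure set T -> \bar R}.

Lemma fatou_cvg_le (g : nat -> T -> R) (h : T -> R) (B : nat -> R) (l : R) :
  (forall n, measurable_fun setT (g n)) -> (forall n x, 0 <= g n x) ->
  (forall x, g n x @[n --> \oo] --> h x) ->
  (\forall n \near \oo, (\int[mu]_x (g n x)%:E <= (B n)%:E)%E) ->
  B n @[n --> \oo] --> l ->
  (\int[mu]_x (h x)%:E <= l%:E)%E.
Proof.
move=> mg g0 gh gB Bl.
have -> : (\int[mu]_x (h x)%:E = \int[mu]_x limn_einf (fun n => (g n x)%:E))%E.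
  apply: eq_integral => x _; apply/esym.
  have gx : (g n x)%:E @[n --> \oo] --> (h x)%:E by apply: cvg_EFin; [exact: nearW|exact: gh].
  by rewrite (cvg_limn_einf_sup gx).1.
apply: le_trans (@fatou _ _ _ mu setT measurableT (fun n x => (g n x)%:E) _ _) _.
- by move=> n; exact/measurable_EFinP.
- by move=> n x _; rewrite lee_fin.
rewrite limn_einf_lim; apply: lime_le; first exact: is_cvg_einfs.
apply: nearW => n.
have Bl' : (B k)%:E @[k --> \oo] --> l%:E by apply: cvg_EFin; [exact: nearW|].
rewrite -(cvg_lim _ Bl')//; apply: lime_ge; first by apply/cvg_ex; exists l%:E.
near=> k; apply: (@le_trans _ _ (\int[mu]_x (g k x)%:E)%E); last by near: k.
apply: ereal_inf_lbound; exists k => //=.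
by near: k; exact: nbhs_infty_ge.
Unshelve. all: by end_near. Qed.

End FatouReal.

(** * First and second moments from the Laplace functional *)

Section Laplace.
Context {R : realType} {d : nat} (alpha beta : R).
Context {dO : measure_display} {Omega : measurableType dO}.
Variables (P : MF R d -> probability Omega R) (X : R -> Omega -> MF R d).
Hypotheses (alpha0 : 0 < alpha) (beta0 : 0 < beta).
Hypothesis sbm : super_brownian_motion alpha beta P X.
Implicit Types (nu : MF R d) (lam x : 'rV[R]_d) (t c a th : R).

Lemma measurable_solution (f : 'rV[R]_d -> R) u t : 0 <= t -> log_laplace_solution alpha beta f u ->
  measurable_fun setT (u t).
Proof.
move=> t0 [mu _ _].
apply: (@measurable_comp _ _ _ _ _ _ _ (fun z => u z.1 z.2) setT (fun y => (t, y)) _ _ mu) => //.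
- have := @measurable_fst _ _ R 'rV[R]_d measurableT _ (measurable_itv `[0%R, +oo[).
  rewrite setTI; congr measurable.
  by apply/seteqP; split => z; rewrite /= in_itv/= andbT.
- by move=> _ [y _ <-].
- exact: pair1_measurable.
Qed.

(** The two pointwise bounds on u, integrated against nu, enclose the Laplace transform; their
    exponents differ only by terms quadratic in (c, a). *)
Lemma laplace_bounds nu t c a th lam : 0 <= t -> `|a| <= c ->
  exists L : R, [/\
    (\int[P nu]_w (expR (- (c * mass (X t w) + a * wint th lam (X t w))))%:E = L%:E)%E,
    expR (- (c * (expR (beta * t) * mass nu) + a * (expR (rho beta lam * t) * wint th lam nu))) <= L
  & L <= expR (- (c * (expR (beta * t) * mass nu) + a * (expR (rho beta lam * t) * wint th lam nu))
       + alpha * (c ^+ 2 * b1 beta t * mass nu + a ^+ 2 * b2 beta lam t * mass nu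
                  + 2 * c * a * b3 beta lam t * wint th lam nu))].
Proof.
move=> t0 ac; pose f := fun y => c + a * wave th lam y.
have mf : measurable_fun setT f.
  by apply: measurable_funD => //; apply: measurable_funM => //; exact: measurable_wave1.
have f0 y : 0 <= f y by rewrite affine_ge0// wave_le1.
have fM : exists M, forall y, f y <= M.
  exists (c + `|a|) => y; rewrite lerD2l (le_trans (ler_norm _))// normrM ler_piMr//.
  exact: wave_le1.
have [u [Hu _ E]] := sbm_log_laplace sbm mf f0 fM.
have mu := measurable_solution t0 Hu.
have u0 y : 0 <= u t y by case: Hu => _ h _; exact: h.
have iu : nu.-integrable setT (fun y => (u t y)%:E).
  apply: (@MF_integrable _ _ _ _ (expR (beta * t) * c + `|a| * expR (rho beta lam * t))) => // y.
  rewrite ger0_norm//; apply: le_trans (solution_ub alpha0 ac Hu y t0) _.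
  rewrite lerD2l (le_trans (ler_norm _))// !normrM (ger0_norm (expR_ge0 _)) mulrA.
  by rewrite ler_piMr ?mulr_ge0 ?expR_ge0// wave_le1.
exists (expR (- (\int[nu]_x u t x)%R)); split.
- have := E nu t t0; rewrite unlock => <-; apply: eq_integral => w _.
  by rewrite Rintegral_affine_wave.
- rewrite ler_expR lerN2.
  have -> : c * (expR (beta * t) * mass nu) + a * (expR (rho beta lam * t) * wint th lam nu) =
     (\int[nu]_x (expR (beta * t) * c + (a * expR (rho beta lam * t)) * wave th lam x))%R.
    by rewrite Rintegral_affine_wave; ring.
  apply: le_Rintegral => // [|y _].
    apply: integrable_addr => //; first exact: finite_measure_integrable_cst.
    by apply: integrable_mulr => //; exact: wave_integrable.
  by apply: le_trans (solution_ub alpha0 ac Hu y t0) _; rewrite mulrA.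
- rewrite ler_expR lerNl opprD opprK.
  set A := expR (beta * t) * c - alpha * (c ^+ 2 * b1 beta t + a ^+ 2 * b2 beta lam t).
  set B := a * expR (rho beta lam * t) - alpha * (2 * c * a * b3 beta lam t).
  have -> : c * (expR (beta * t) * mass nu) + a * (expR (rho beta lam * t) * wint th lam nu) -
    alpha * (c ^+ 2 * b1 beta t * mass nu + a ^+ 2 * b2 beta lam t * mass nu
                  + 2 * c * a * b3 beta lam t * wint th lam nu) =
    (\int[nu]_x (A + B * wave th lam x))%R.
    rewrite Rintegral_affine_wave /A /B.
    by move: (b1 _ _) (b2 _ _ _) (b3 _ _ _) => *; ring.
  apply: le_Rintegral => // [|y _].
    apply: integrable_addr => //; first exact: finite_measure_integrable_cst.
    by apply: integrable_mulr => //; exact: wave_integrable.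
  apply: le_trans (solution_lb alpha0 ac Hu y t0); rewrite /A /B.
  by move: (b1 _ _) (b2 _ _ _) (b3 _ _ _) => *; rewrite le_eqVlt; apply/orP; left; apply/eqP; ring.
Qed.

(** The mass alone gets a lower bound with the exact quadratic term, from [constant_solution_ub];
    the cubic error disappears after division by c^2. *)
Lemma laplace_mass_lb nu t c : 0 <= t -> 0 < c ->
  2 * alpha * c * (t * expR (2 * beta * t)) <= 1 ->
  exists2 L : R, (\int[P nu]_w (expR (- (c * mass (X t w))))%:E = L%:E)%E &
   expR (- (c * (expR (beta * t) * mass nu)) + c ^+ 2 * (alpha * b1 beta t * mass nu)
    - c ^+ 3 * (2 * alpha ^+ 2 * (t * expR (2 * beta * t)) * (t * expR (beta * t)) * mass nu)) <= L.
Proof.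
move=> t0 c0 cK; pose f := fun y : 'rV[R]_d => c + 0 * wave 0 0 y.
have mf : measurable_fun setT f.
  by apply: measurable_funD => //; apply: measurable_funM => //; exact: measurable_wave1.
have f0 y : 0 <= f y by rewrite /f mul0r addr0 ltW.
have fM : exists M, forall y, f y <= M by exists c => y; rewrite /f mul0r addr0.
have [u [Hu _ E]] := sbm_log_laplace sbm mf f0 fM.
have mu := measurable_solution t0 Hu.
have u0 y : 0 <= u t y by case: Hu => _ h _; exact: h.
have ub y := @constant_solution_ub _ _ _ _ alpha0 beta0 _ _ _ y c0 t0 Hu cK.
set M := (X in forall y, _ <= X) in ub.
have iu : nu.-integrable setT (fun y => (u t y)%:E).
  by apply: (@MF_integrable _ _ _ _ M) => // y; rewrite ger0_norm.
exists (expR (- (\int[nu]_x u t x)%R)).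
  have := E nu t t0; rewrite unlock => <-; apply: eq_integral => w _.
  by rewrite Rintegral_affine_wave mul0r addr0.
rewrite ler_expR lerNr.
apply: (@le_trans _ _ (\int[nu]_x M)%R).
  by apply: le_Rintegral => //; exact: finite_measure_integrable_cst.
rewrite Rintegral_cst// -/(mass nu) /M.
by move: (b1 _ _) => *; rewrite le_eqVlt; apply/orP; left; apply/eqP; ring.
Qed.

(** Convexity: the expression equals e^(-m) (e^(y/2) - e^(-y/2))^2. *)
Lemma expR_second_difference_ge0 (m y : R) :
  0 <= expR (- (m + y)) + expR (- (m - y)) - 2 * expR (- m).
Proof.
have -> : expR (- (m + y)) = expR (- m) * (expR (- (y / 2)) * expR (- (y / 2))).
  by rewrite -!expRD; congr expR; field.
have -> : expR (- (m - y)) = expR (- m) * (expR (y / 2) * expR (y / 2)).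
  by rewrite -!expRD; congr expR; field.
have := expRxMexpNx_1 (y / 2); have := expR_gt0 (- m).
move: (expR (- m)) (expR (y / 2)) (expR (- (y / 2))) => e a b e0 ab.
have -> : e * (b * b) + e * (a * a) - 2 * e = e * ((a - b) ^+ 2 + 2 * (a * b - 1)) by ring.
by rewrite ab subrr mulr0 addr0 mulr_ge0 ?sqr_ge0// ltW.
Qed.

Lemma measurable_wint_X th lam t : 0 <= t ->
  measurable_fun setT (fun w => wint th lam (X t w)).
Proof. by move=> t0; exact: measurableT_comp (measurable_wint th lam) (sbm_measurable sbm t0). Qed.

Lemma measurable_mass_X t : 0 <= t -> measurable_fun setT (fun w => mass (X t w)).
Proof. by move=> t0; exact: measurableT_comp measurable_mass (sbm_measurable sbm t0). Qed.

Lemma integrable_expR_affine nu t c a th lam : 0 <= t -> `|a| <= c ->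
  (P nu).-integrable setT
    (fun w => (expR (- (c * mass (X t w) + a * wint th lam (X t w))))%:E).
Proof.
move=> t0 ac.
have i1 : (P nu).-integrable setT (fun=> (1 : R)%:E) by exact: finite_measure_integrable_cst.
apply: (le_integrable measurableT _ _ i1).
  apply/measurable_EFinP; apply: measurableT_comp => //; apply: measurableT_comp => //.
  apply: measurable_funD; apply: measurable_funM => //; first exact: measurable_mass_X.
  exact: measurable_wint_X.
move=> w _; rewrite /= lee_fin normr1 ger0_norm ?expR_ge0// -expR0 ler_expR oppr_le0.
have h : `|a * wint th lam (X t w)| <= c * mass (X t w).
  by rewrite normrM ler_pM// wint_le.
by move: h; rewrite ler_norml => /andP[h _]; lra.
Qed.

(* Fatou's lemma for n^2 (e^(-Y+ / n) + e^(-Y- / n) - 2 e^(-Y1 / n)) with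
   Y+- = <X_t, 1 +- wave> and Y1 = <X_t, 1>. *)
Lemma wint_second_moment nu t th lam : 0 <= t ->
  (\int[P nu]_w (wint th lam (X t w) ^+ 2)%:E <=
   ((expR (rho beta lam * t) * wint th lam nu) ^+ 2
     + 2 * alpha * b2 beta lam t * mass nu)%:E)%E.
Proof.
move=> t0.
pose v : nat -> R := harmonic.
have v0 n : 0 < v n by rewrite /v/harmonic/= invr_gt0.
pose m w := mass (X t w); pose y w := wint th lam (X t w).
pose g n w := v n ^- 2 * (expR (- (v n * m w + v n * y w)) + expR (- (v n * m w - v n * y w))
    - 2 * expR (- (v n * m w))).
have gE n w : g n w = v n ^- 2 * (expR (- (m w + y w) * v n + 0 * v n ^+ 2 + 0 * v n ^+ 3) - 1 + (m w + y w) * v n)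
   + v n ^- 2 * (expR (- (m w - y w) * v n + 0 * v n ^+ 2 + 0 * v n ^+ 3) - 1 + (m w - y w) * v n)
   - 2 * (v n ^- 2 * (expR (- (m w) * v n + 0 * v n ^+ 2 + 0 * v n ^+ 3) - 1 + m w * v n)).
  rewrite /g !mul0r !addr0.
  have -> : - (v n * m w + v n * y w) = - (m w + y w) * v n by ring.
  have -> : - (v n * m w - v n * y w) = - (m w - y w) * v n by ring.
  have -> : - (v n * m w) = - m w * v n by ring.
  by move: (expR _) (expR _) (expR _) (_ ^- 2) => *; ring.
pose mn := expR (beta * t) * mass nu; pose yn := expR (rho beta lam * t) * wint th lam nu.
pose q1 := alpha * b1 beta t * mass nu; pose q2 := alpha * b2 beta lam t * mass nu.
pose q3 := 2 * alpha * b3 beta lam t * wint th lam nu.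
pose r := 2 * alpha ^+ 2 * (t * expR (2 * beta * t)) * (t * expR (beta * t)) * mass nu.
(* The positive terms of [g n] are replaced by the upper bounds of [laplace_bounds], the negative
   one by the lower bound of [laplace_mass_lb]. In the limit [q1], [q3] and [mn] cancel, and yn^2 +
   2 q2 remains. *)
pose B n := v n ^- 2 * (expR (- (mn + yn) * v n + (q1 + q2 + q3) * v n ^+ 2 + 0 * v n ^+ 3) - 1 + (mn + yn) * v n)
   + v n ^- 2 * (expR (- (mn - yn) * v n + (q1 + q2 - q3) * v n ^+ 2 + 0 * v n ^+ 3) - 1 + (mn - yn) * v n)
   - 2 * (v n ^- 2 * (expR (- mn * v n + q1 * v n ^+ 2 + (- r) * v n ^+ 3) - 1 + mn * v n)).
have mm : measurable_fun setT m by exact: measurable_mass_X.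
have my : measurable_fun setT y by exact: measurable_wint_X.
apply: (@fatou_cvg_le _ _ _ (P nu) g _ B).
- move=> n; apply: measurable_funM => //; apply: measurable_funB.
    apply: measurable_funD; apply: measurableT_comp => //; apply: measurableT_comp => //.
      by apply: measurable_funD; exact: measurable_funM.
    by apply: measurable_funB; exact: measurable_funM.
  apply: measurable_funM => //; apply: measurableT_comp => //; apply: measurableT_comp => //.
  exact: measurable_funM.
- by move=> n w; rewrite /g mulr_ge0 ?invr_ge0 ?sqr_ge0// expR_second_difference_ge0.
- move=> w; under eq_fun do rewrite gE.
  have -> : wint th lam (X t w) ^+ 2 =
     (0 + (m w + y w) ^+ 2 / 2) + (0 + (m w - y w) ^+ 2 / 2) - 2 * (0 + m w ^+ 2 / 2).
    by rewrite -/(y w); field.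
  apply: cvgB; first by apply: cvgD; exact: expR_expansion2.
  by apply: cvgM; [exact: cvg_cst|exact: expR_expansion2].
- have K0 : 0 <= 2 * alpha * (t * expR (2 * beta * t)).
    by rewrite !mulr_ge0 ?expR_ge0// ltW.
  have cK : v n * (2 * alpha * (t * expR (2 * beta * t))) @[n --> \oo] --> (0 : R).
    rewrite -[X in _ --> X](mul0r (2 * alpha * (t * expR (2 * beta * t)))).
    by apply: cvgM; [exact: cvg_harmonic|exact: cvg_cst].
  have [N _ HN] := cvgr0_norm_le _ cK _ (@ltr01 R).
  exists N => // n /= Nn.
  have vv : `|v n| <= v n by rewrite gtr0_norm.
  have vv' : `|- v n| <= v n by rewrite normrN.
  have vK : 2 * alpha * v n * (t * expR (2 * beta * t)) <= 1.
    apply: le_trans (HN n Nn); rewrite ger0_norm; last by rewrite mulr_ge0// ltW.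
    by rewrite le_eqVlt; apply/orP; left; apply/eqP; ring.
  have [Lp [Ep _ Hp]] := laplace_bounds nu th lam t0 vv.
  have [Lm [Em _ Hm]] := laplace_bounds nu th lam t0 vv'.
  have [L1 E1 H1] := laplace_mass_lb nu t0 (v0 n) vK.
  have ip := integrable_expR_affine nu th lam t0 vv.
  have im := integrable_expR_affine nu th lam t0 vv'.
  have v00 : `|0 : R| <= v n by rewrite normr0 ltW.
  have i1 : (P nu).-integrable setT (fun w => (expR (- (v n * mass (X t w))))%:E).
    have := integrable_expR_affine nu 0 0 t0 v00.
    by under eq_fun do rewrite mul0r addr0.
  have -> : (\int[P nu]_w (g n w)%:E = (v n ^- 2 * (Lp + Lm - 2 * L1))%:E)%E.
    rewrite -[LHS]fineK; last first.
      apply: (integrable_fin_num measurableT); apply: integrable_mulr => //.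
      apply: integrable_subr => //; last by apply: integrable_mulr.
      apply: integrable_addr => //.
      by move: im; apply: eq_integrable => // w _; rewrite mulNr.
    congr EFin; rewrite -/(Rintegral _ _ _) /g.
    have im' : (P nu).-integrable setT (fun w => (expR (- (v n * m w - v n * y w)))%:E).
      by move: im; apply: eq_integrable => // w _; rewrite mulNr.
    rewrite RintegralZl//; last first.
      apply: integrable_subr => //; last by apply: integrable_mulr.
      exact: integrable_addr.
    rewrite RintegralB//; last 2 first.
    + exact: integrable_addr.
    + exact: integrable_mulr.
    rewrite RintegralD// RintegralZl//.
    have -> : (\int[P nu]_x expR (- (v n * m x + v n * y x)))%R = Lp by rewrite /Rintegral Ep.
    have -> : (\int[P nu]_x expR (- (v n * m x - v n * y x)))%R = Lm.
      by rewrite -[RHS]/(fine Lm%:E) -Em /Rintegral; congr fine; apply: eq_integral => w _; rewrite mulNr.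
    by have -> : (\int[P nu]_x expR (- (v n * m x)))%R = L1 by rewrite /Rintegral E1.
  rewrite lee_fin.
  have -> : B n = v n ^- 2 * (expR (- (mn + yn) * v n + (q1 + q2 + q3) * v n ^+ 2 + 0 * v n ^+ 3) +
     expR (- (mn - yn) * v n + (q1 + q2 - q3) * v n ^+ 2 + 0 * v n ^+ 3)
     - 2 * expR (- mn * v n + q1 * v n ^+ 2 + (- r) * v n ^+ 3)).
    by rewrite /B; move: (expR _) (expR _) (expR _) (_ ^- 2) => *; ring.
  rewrite ler_wpM2l ?invr_ge0 ?sqr_ge0//.
  apply: lerB; [apply: lerD|].
  + apply: le_trans Hp _; rewrite ler_expR le_eqVlt; apply/orP; left; apply/eqP.
    rewrite /mn /yn /q1 /q2 /q3; move: (b1 _ _) (b2 _ _ _) (b3 _ _ _) (expR _) (expR _) => *; ring.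
  + apply: le_trans Hm _; rewrite ler_expR le_eqVlt; apply/orP; left; apply/eqP.
    rewrite /mn /yn /q1 /q2 /q3; move: (b1 _ _) (b2 _ _ _) (b3 _ _ _) (expR _) (expR _) => *; ring.
  + rewrite ler_pM2l//; apply: le_trans H1; rewrite ler_expR le_eqVlt; apply/orP; left; apply/eqP.
    rewrite /mn /q1 /r; move: (b1 _ _) (expR _) (expR _) => *; ring.
- have -> : (expR (rho beta lam * t) * wint th lam nu) ^+ 2 + 2 * alpha * b2 beta lam t * mass nu =
    ((q1 + q2 + q3) + (mn + yn) ^+ 2 / 2) + ((q1 + q2 - q3) + (mn - yn) ^+ 2 / 2) - 2 * (q1 + mn ^+ 2 / 2).
    by rewrite -/yn /q2; move: (b2 _ _ _) => *; field.
  apply: cvgB; first by apply: cvgD; exact: expR_expansion2.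
  by apply: cvgM; [exact: cvg_cst|exact: expR_expansion2].
Qed.

Lemma wint_sqr_integrable nu t th lam : 0 <= t ->
  (P nu).-integrable setT (fun w => (wint th lam (X t w) ^+ 2)%:E).
Proof.
move=> t0; apply/integrableP; split.
  by apply/measurable_EFinP; apply: measurable_funX; exact: measurable_wint_X.
under eq_integral do rewrite /= ger0_norm ?sqr_ge0//.
exact: le_lt_trans (wint_second_moment nu th lam t0) (ltry _).
Qed.

Lemma wint_integrable nu t th lam : 0 <= t ->
  (P nu).-integrable setT (fun w => (wint th lam (X t w))%:E).
Proof.
move=> t0.
have i1 : (P nu).-integrable setT (fun=> (1 : R)%:E) by exact: finite_measure_integrable_cst.
apply: (le_integrable measurableT _ _ (integrable_addr measurableT i1 (wint_sqr_integrable nu th lam t0))).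
  by apply/measurable_EFinP; exact: measurable_wint_X.
move=> w _; rewrite /= lee_fin [leRHS]ger0_norm ?addr_ge0 ?sqr_ge0//.
rewrite -(real_normK (num_real (wint _ _ _))); move: (normr_ge0 (wint th lam (X t w))).
by move: `|_| => z z0; nra.
Qed.

(* Dominated convergence for n (e^(-Y- / n) - e^(-Y+ / n)) / 2. *)
Lemma wint_first_moment nu t th lam : 0 <= t ->
  (\int[P nu]_w wint th lam (X t w))%R = expR (rho beta lam * t) * wint th lam nu.
Proof.
move=> t0.
pose v : nat -> R := harmonic.
have v0 n : 0 < v n by rewrite /v/harmonic/= invr_gt0.
pose m w := mass (X t w); pose y w := wint th lam (X t w).
have mm : measurable_fun setT m by exact: measurable_mass_X.
have my : measurable_fun setT y by exact: measurable_wint_X.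
have iy : (P nu).-integrable setT (fun w => (y w)%:E) by exact: wint_integrable.
pose g n w := (v n)^-1 * (expR (- (m w - y w) * v n + 0 * v n ^+ 2) - 1) / 2
  - (v n)^-1 * (expR (- (m w + y w) * v n + 0 * v n ^+ 2) - 1) / 2.
have mg n : measurable_fun setT (g n).
  apply: measurable_funB; apply: measurable_funM => //; apply: measurable_funM => //;
    apply: measurable_funB => //; apply: measurableT_comp => //; apply: measurable_funD => //;
    apply: measurable_funM => //; apply: measurableT_comp => //.
  - exact: measurable_funB.
  - exact: measurable_funD.
have gy w : g n w @[n --> \oo] --> y w.
  have -> : y w = (- (m w - y w)) / 2 - (- (m w + y w)) / 2 by field.
  by apply: cvgB; (apply: cvgM; [exact: expR_expansion1|exact: cvg_cst]).
have my_le w : `|y w| <= m w by exact: wint_le.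
(* Domination by |y|: both m - y and m + y are non-negative, and there e^(-x) is 1-Lipschitz. *)
have gle w n : `|g n w| <= `|y w|.
  have -> : g n w = (v n)^-1 / 2 * (expR (- ((m w - y w) * v n)) - expR (- ((m w + y w) * v n))).
    by rewrite /g !mul0r !addr0 !mulNr; move: (expR _) (expR _) (_ ^-1) => *; ring.
  rewrite normrM ger0_norm; last by rewrite divr_ge0// invr_ge0 ltW.
  have := my_le w; rewrite ler_norml => /andP[h1 h2].
  have ab : `|expR (- ((m w - y w) * v n)) - expR (- ((m w + y w) * v n))| <= 2 * v n * `|y w|.
    have h3 : 0 <= (m w - y w) * v n by rewrite mulr_ge0 ?subr_ge0// ltW.
    have h4 : 0 <= (m w + y w) * v n by rewrite mulr_ge0 ?(ltW (v0 n))//; lra.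
    apply: le_trans (expRN_lipschitz h3 h4) _.
    have -> : (m w - y w) * v n - (m w + y w) * v n = (2 * v n) * (- y w) by ring.
    by rewrite normrM normrN ger0_norm// mulr_ge0// ltW.
  apply: (@le_trans _ _ ((v n)^-1 / 2 * (2 * v n * `|y w|))).
    by rewrite ler_wpM2l// divr_ge0// invr_ge0 ltW.
  rewrite le_eqVlt; apply/orP; left; apply/eqP; move: (v0 n) => vn0.
  by move: `|y w| => z; field; rewrite gt_eqF.
have [_ _ dc] := @dominated_convergence _ _ _ (P nu) setT measurableT (fun n w => (g n w)%:E)
   (fun w => (y w)%:E) (fun w => `|(y w)%:E|%E)
   (fun n => ltac:(by apply/measurable_EFinP; exact: mg)) ltac:(by apply/measurable_EFinP)
   ltac:(by apply/aeW => w _; apply: cvg_EFin; [exact: nearW|exact: gy])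
   (integrable_abse iy) ltac:(by apply/aeW => w n _; rewrite /= lee_fin).
pose mn := expR (beta * t) * mass nu; pose yn := expR (rho beta lam * t) * wint th lam nu.
pose q1 := alpha * b1 beta t * mass nu; pose q2 := alpha * b2 beta lam t * mass nu.
pose q3 := 2 * alpha * b3 beta lam t * wint th lam nu.
(* The upper and lower bounds differ in quadratic terms of the exponents; after division by v these
   vanish, and both sides tend to [yn]. *)
have intg n : exists2 r : R, (\int[P nu]_w (g n w)%:E)%E = r%:E &
   (v n)^-1 * (expR (- (mn - yn) * v n + 0 * v n ^+ 2) - 1) / 2
    - (v n)^-1 * (expR (- (mn + yn) * v n + (q1 + q2 + q3) * v n ^+ 2) - 1) / 2
   <= r <= (v n)^-1 * (expR (- (mn - yn) * v n + (q1 + q2 - q3) * v n ^+ 2) - 1) / 2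
    - (v n)^-1 * (expR (- (mn + yn) * v n + 0 * v n ^+ 2) - 1) / 2.
  have vv : `|v n| <= v n by rewrite gtr0_norm.
  have vv' : `|- v n| <= v n by rewrite normrN.
  have [Lp [Ep Hp Hp']] := laplace_bounds nu th lam t0 vv.
  have [Lm [Em Hm Hm']] := laplace_bounds nu th lam t0 vv'.
  have ip := integrable_expR_affine nu th lam t0 vv.
  have im := integrable_expR_affine nu th lam t0 vv'.
  exists ((v n)^-1 / 2 * (Lm - Lp)).
    have gE : (fun w => (g n w)%:E) = (fun w => ((v n)^-1 / 2 *
       (expR (- (v n * mass (X t w) + - v n * wint th lam (X t w))) -
        expR (- (v n * mass (X t w) + v n * wint th lam (X t w)))))%:E).
      apply/funext => w; congr EFin; rewrite /g !mul0r !addr0.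
      have -> : - (m w - y w) * v n = - (v n * mass (X t w) + - v n * wint th lam (X t w)) by rewrite /m /y; ring.
      have -> : - (m w + y w) * v n = - (v n * mass (X t w) + v n * wint th lam (X t w)) by rewrite /m /y; ring.
      by move: (expR _) (expR _) (_ ^-1) => *; ring.
    rewrite gE -[LHS]fineK; last first.
      by apply: (integrable_fin_num measurableT); apply: integrable_mulr => //; exact: integrable_subr.
    congr EFin; rewrite -/(Rintegral _ _ _) RintegralZl//; last exact: integrable_subr.
    by rewrite RintegralB// /Rintegral Em Ep.
  have c0 : 0 <= (v n)^-1 / 2 by rewrite divr_ge0// invr_ge0 ltW.
  have E e f : (v n)^-1 * (e - 1) / 2 - (v n)^-1 * (f - 1) / 2 = (v n)^-1 / 2 * (e - f) by ring.
  rewrite !E; apply/andP; split; rewrite ler_wpM2l//; apply: lerB.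
  - apply: le_trans Hm; rewrite ler_expR le_eqVlt; apply/orP; left; apply/eqP.
    by rewrite /mn /yn; move: (expR _) (expR _) => *; ring.
  - apply: le_trans Hp' _; rewrite ler_expR le_eqVlt; apply/orP; left; apply/eqP.
    by rewrite /mn /yn /q1 /q2 /q3; move: (b1 _ _) (b2 _ _ _) (b3 _ _ _) (expR _) (expR _) => *; ring.
  - apply: le_trans Hm' _; rewrite ler_expR le_eqVlt; apply/orP; left; apply/eqP.
    by rewrite /mn /yn /q1 /q2 /q3; move: (b1 _ _) (b2 _ _ _) (b3 _ _ _) (expR _) (expR _) => *; ring.
  - apply: le_trans Hp; rewrite ler_expR le_eqVlt; apply/orP; left; apply/eqP.
    by rewrite /mn /yn; move: (expR _) (expR _) => *; ring.
have lim2 (q q' : R) : (v n)^-1 * (expR (- (mn - yn) * v n + q * v n ^+ 2) - 1) / 2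
    - (v n)^-1 * (expR (- (mn + yn) * v n + q' * v n ^+ 2) - 1) / 2 @[n --> \oo] --> yn.
  rewrite [X in _ --> X](_ : yn = (- (mn - yn)) / 2 - (- (mn + yn)) / 2); last by field.
  by apply: cvgB; (apply: cvgM; [exact: expR_expansion1|exact: cvg_cst]).
have fdc : (\int[P nu]_w g n w)%R @[n --> \oo] --> (\int[P nu]_w y w)%R.
  by apply: fine_cvg; rewrite fineK//; exact: (integrable_fin_num measurableT iy).
apply: (cvg_unique _ fdc) => //.
apply: (squeeze_cvgr _ (lim2 0 (q1 + q2 + q3)) (lim2 (q1 + q2 - q3) 0)).
by apply: nearW => n; have [r E H] := intg n; rewrite /Rintegral E.
Qed.

(** The mean is known exactly, so its square cancels from the second-moment bound. *)
Lemma wint_variance nu t th lam : 0 <= t ->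
  (\int[P nu]_w ((wint th lam (X t w) - expR (rho beta lam * t) * wint th lam nu) ^+ 2)%:E <=
   (2 * alpha * b2 beta lam t * mass nu)%:E)%E.
Proof.
move=> t0; set m := expR _ * _; pose y w := wint th lam (X t w).
have iy : (P nu).-integrable setT (fun w => (y w)%:E) by exact: wint_integrable.
have iy2 : (P nu).-integrable setT (fun w => (y w ^+ 2)%:E) by exact: wint_sqr_integrable.
have ic : (P nu).-integrable setT (fun=> (m ^+ 2)%:E) by exact: finite_measure_integrable_cst.
have E w : (y w - m) ^+ 2 = y w ^+ 2 - 2 * m * y w + m ^+ 2 by ring.
under eq_integral do rewrite E.
have i2 : (P nu).-integrable setT (fun w => (2 * m * y w)%:E) by exact: integrable_mulr.
have i3 : (P nu).-integrable setT (fun w => (y w ^+ 2 - 2 * m * y w)%:E) by exact: integrable_subr.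
rewrite -[leLHS]fineK; last by apply: (integrable_fin_num measurableT); exact: integrable_addr.
rewrite lee_fin -/(Rintegral _ _ _) RintegralD// RintegralB// RintegralZl//.
rewrite (wint_first_moment nu th lam t0) -/m Rintegral_cst//= probability_setT mulr1.
have := wint_second_moment nu th lam t0.
rewrite -[leLHS](fineK (integrable_fin_num measurableT iy2)) lee_fin -/(Rintegral _ _ _) -/m.
by lra.
Qed.

End Laplace.

Lemma measurable_lt_cst dT (T : measurableType dT) (R : realType) (f : T -> R) (a : R) :
  measurable_fun setT f -> measurable [set x | f x < a].
Proof.
move=> mf; have := mf measurableT _ (measurable_itv `]-oo, a[).
by rewrite setTI.
Qed.

(** * From disintegration of events to disintegration of integrals *)

Section DisintegrateIntegral.
Context {dT dY : measure_display} {T : measurableType dT} {Y : measurableType dY} {R : realType}.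
Variables (l : {measure set T -> \bar R}) (A : set T) (mA : measurable A).
Variables (f : T -> Y) (mf : measurable_fun setT f) (k : T -> {measure set Y -> \bar R}).
Hypothesis mk : forall B, measurable B -> measurable_fun setT (k ^~ B).
Hypothesis lk : forall B, measurable B -> l (A `&` f @^-1` B) = (\int[l]_(x in A) k x B)%E.

Import HBNNSimple.

Let disintegrate_nnsfun (g : {nnsfun Y >-> R}) :
  (\int[l]_(x in A) (g (f x))%:E = \int[l]_(x in A) \int[k x]_y (g y)%:E)%E.
Proof.
have mB r : measurable (g @^-1` [set r]) by rewrite -[X in measurable X]setTI; exact: measurable_funP.
have mfB r : measurable (f @^-1` (g @^-1` [set r])) by rewrite -[X in measurable X]setTI; exact: mf.
under [RHS]eq_integral do rewrite integralT_nnsfun sintegralE.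
rewrite ge0_integral_fsum//; last 2 first.
- by move=> r; apply: measurable_funeM; apply: measurable_funTS; exact: mk.
- move=> r x _; have [r0|r0] := leP 0 r; first by rewrite mule_ge0.
  by rewrite preimage_nnfun0// measure0 mule0.
under [LHS]eq_integral do rewrite fimfunE -fsumEFin//.
rewrite ge0_integral_fsum//; last 2 first.
- move=> r; apply/measurable_EFinP; apply: measurable_funM => //.
  exact: (measurable_indic (mfB r)).
- by move=> r x _; rewrite EFinM nnfun_muleindic_ge0.
apply: eq_fsbigr => r _.
have [r0|r0] := leP 0 r; last first.
  rewrite !integral0_eq// => x _; first by rewrite preimage_nnfun0// measure0 mule0.
  by rewrite preimage_nnfun0// indic0 mulr0.
under eq_integral do rewrite EFinM.
rewrite ge0_integralZl_EFin//; last by apply/measurable_EFinP; apply: measurable_funTS; exact: (measurable_indic (mfB r)).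
rewrite ge0_integralZl_EFin//; last by apply: measurable_funTS; exact: mk.
congr (_ * _)%E; rewrite -lk// setIC.
exact: (integral_indic l mA (mfB r)).
Qed.

(** The identity [lk] for sets extends to simple functions by linearity and to non-negative
    functions by monotone convergence. It carries the Markov property from events to integrals. *)
Lemma integral_disintegrate (G : Y -> \bar R) : measurable_fun setT G ->
  (forall y, 0 <= G y)%E ->
  (\int[l]_(x in A) G (f x) = \int[l]_(x in A) \int[k x]_y G y)%E.
Proof.
move=> mG G0; pose g := nnsfun_approx measurableT mG.
have gG y : (g n y)%:E @[n --> \oo] --> G y by exact: cvg_nnsfun_approx.
have lhs : (\int[l]_(x in A) (g n (f x))%:E)%E @[n --> \oo] --> (\int[l]_(x in A) G (f x))%E.
  rewrite [X in _ --> X](_ : _ = \int[l]_(x in A) limn (fun n => (g n (f x))%:E))%E; last first.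
    by apply: eq_integral => x _; apply/esym/cvg_lim.
  apply: cvg_monotone_convergence => //.
  - by move=> n; apply/measurable_EFinP; apply: measurable_funTS; exact: measurableT_comp.
  - by move=> n x _; rewrite lee_fin.
  - by move=> x _ a b ab; rewrite lee_fin; exact/lefP/nd_nnsfun_approx.
have inner x : (\int[k x]_y (g n y)%:E)%E @[n --> \oo] --> (\int[k x]_y G y)%E.
  rewrite [X in _ --> X](_ : _ = \int[k x]_y limn (fun n => (g n y)%:E))%E; last first.
    by apply: eq_integral => y _; apply/esym/cvg_lim.
  apply: cvg_monotone_convergence => //.
  - by move=> n; exact/measurable_EFinP.
  - by move=> n y _; rewrite lee_fin.
  - by move=> y _ a b ab; rewrite lee_fin; exact/lefP/nd_nnsfun_approx.
have rhs : (\int[l]_(x in A) \int[k x]_y (g n y)%:E)%E @[n --> \oo] -->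
    (\int[l]_(x in A) \int[k x]_y G y)%E.
  rewrite [X in _ --> X](_ : _ = \int[l]_(x in A) limn (fun n => \int[k x]_y (g n y)%:E))%E; last first.
    by apply: eq_integral => x _; apply/esym/cvg_lim.
  apply: cvg_monotone_convergence => //.
  - move=> n; apply: measurable_funTS; apply: measurable_fun_integral_kernel => //.
      by move=> y; rewrite lee_fin.
    exact/measurable_EFinP.
  - by move=> n x _; apply: integral_ge0 => y _; rewrite lee_fin.
  - move=> x _ a b ab; apply: ge0_le_integral => //.
    + by move=> y _; rewrite lee_fin.
    + exact/measurable_EFinP.
    + exact/measurable_EFinP.
    + by move=> y _; rewrite lee_fin; exact/lefP/nd_nnsfun_approx.
suff rhs' : (\int[l]_(x in A) (g n (f x))%:E)%E @[n --> \oo] -->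
    (\int[l]_(x in A) \int[k x]_y G y)%E by exact: (cvg_unique _ lhs rhs').
rewrite (_ : (fun n => \int[l]_(x in A) (g n (f x))%:E)%E =
  (fun n => \int[l]_(x in A) \int[k x]_y (g n y)%:E)%E)//.
by apply/funext => n; exact: disintegrate_nnsfun.
Qed.

End DisintegrateIntegral.

(** * The Markov property and increments over a time step *)

Section Markov.
Context {R : realType} {d : nat} (alpha beta : R).
Context {dO : measure_display} {Omega : measurableType dO}.
Variables (P : MF R d -> probability Omega R) (X : R -> Omega -> MF R d).
Hypotheses (alpha0 : 0 < alpha) (beta0 : 0 < beta).
Hypothesis sbm : super_brownian_motion alpha beta P X.
Implicit Types (nu : MF R d) (lam x : 'rV[R]_d) (t s r c a th : R).

Lemma natural_filtration_measurable s A : natural_filtration X s A -> measurable A.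
Proof.
apply: smallest_sub; first exact: sigma_algebra_measurable.
move=> C [r] /=; rewrite in_itv/= => /andP[r0 _] [B mB <-].
exact: (sbm_measurable sbm).
Qed.

Lemma sub_natural_filtration r s B : 0 <= r -> r <= s -> measurable B ->
  natural_filtration X s (X r @^-1` B).
Proof.
move=> r0 rs mB; apply: sub_gen_smallest; exists r; first by rewrite /= in_itv/= r0.
by exists B => //; rewrite setTI.
Qed.

(** The kernel is w |-> law of X_t under [P (X s w)]; on an event of the past, the Markov property
    says that it disintegrates the law of X_(s+t). *)
Lemma markov_ge0 nu s t A (G : MF R d -> \bar R) : 0 <= s -> 0 <= t ->
  natural_filtration X s A -> measurable_fun setT G -> (forall m, 0 <= G m)%E ->
  (\int[P nu]_(w in A) G (X (s + t) w) =
   \int[P nu]_(w in A) \int[P (X s w)]_w' G (X t w'))%E.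
Proof.
move=> s0 t0 FA mG G0.
have mX := sbm_measurable sbm t0.
pose k w : {measure set (MF R d) -> \bar R} := giry_map mX (P (X s w)).
rewrite (@integral_disintegrate _ _ _ _ _ (P nu) A (natural_filtration_measurable FA)
  (X (s + t)) (sbm_measurable sbm (addr_ge0 s0 t0)) k)//.
- by apply: eq_integral => w _; rewrite ge0_integral_pushforward.
- move=> B mB; exact: measurableT_comp (sbm_law_measurable sbm t0 mB) (sbm_measurable sbm s0).
- by move=> B mB; exact: (sbm_markov sbm).
Qed.

Lemma measurable_markov s t (G : MF R d -> \bar R) : 0 <= s -> 0 <= t ->
  measurable_fun setT G -> (forall m, 0 <= G m)%E ->
  measurable_fun setT (fun w => \int[P (X s w)]_w' G (X t w'))%E.
Proof.
move=> s0 t0 mG G0; have mX := sbm_measurable sbm t0.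
pose k w : {measure set (MF R d) -> \bar R} := giry_map mX (P (X s w)).
rewrite [X in measurable_fun _ X](_ : _ = (fun w => \int[k w]_m G m)%E); last first.
  by apply/funext => w; rewrite ge0_integral_pushforward.
apply: measurable_fun_integral_kernel => // B mB.
exact: measurableT_comp (sbm_law_measurable sbm t0 mB) (sbm_measurable sbm s0).
Qed.

Lemma affine_first_moment nu r th lam a : 0 <= r -> 0 <= a <= 1 ->
  (\int[P nu]_w (mass (X r w) + a * wint th lam (X r w))%:E =
   (expR (beta * r) * mass nu + a * (expR (rho beta lam * r) * wint th lam nu))%:E)%E.
Proof.
move=> r0 a01.
have i1 : (P nu).-integrable setT (fun w => (mass (X r w))%:E).
  by have := wint_integrable alpha0 beta0 sbm nu 0 0 r0; under eq_fun do rewrite wint0.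
have i2 := wint_integrable alpha0 beta0 sbm nu th lam r0.
rewrite -[LHS]fineK; last first.
  by apply: (integrable_fin_num measurableT); apply: integrable_addr => //; exact: integrable_mulr.
congr EFin; rewrite -/(Rintegral _ _ _) RintegralD//; last exact: integrable_mulr.
rewrite RintegralZl// (wint_first_moment alpha0 beta0 sbm nu th lam r0); congr (_ + _).
have := wint_first_moment alpha0 beta0 sbm nu 0 0 r0; rewrite wint0 rho0 => <-.
by apply: eq_Rintegral => w _; rewrite wint0.
Qed.

(** The wave pairing has no sign, whereas [markov_ge0] asks for non-negative functions; adding the
    mass restores the sign. The difference of the cases a = 1 and a = 0 then isolates the wave in
    [markov_wint]. *)
Lemma markov_affine nu s r A th lam a : 0 <= s -> 0 <= r -> 0 <= a <= 1 ->
  natural_filtration X s A ->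
  (\int[P nu]_(w in A) (mass (X (s + r) w) + a * wint th lam (X (s + r) w)))%R =
  expR (beta * r) * (\int[P nu]_(w in A) mass (X s w))%R +
  a * (expR (rho beta lam * r) * (\int[P nu]_(w in A) wint th lam (X s w))%R).
Proof.
move=> s0 r0 /andP[a0 a1] FA; have mA := natural_filtration_measurable FA.
have i1 : (P nu).-integrable A (fun w => (mass (X s w))%:E).
  have := wint_integrable alpha0 beta0 sbm nu 0 0 s0.
  by under eq_fun do rewrite wint0; exact: integrableS.
have i2 : (P nu).-integrable A (fun w => (wint th lam (X s w))%:E).
  by have := wint_integrable alpha0 beta0 sbm nu th lam s0; exact: integrableS.
have ge0 m : (0 <= (mass m + a * wint th lam m)%:E)%E.
  rewrite lee_fin -[X in X + _]mul1r; have := @wint_le R d th lam m.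
  rewrite ler_norml => /andP[h1 h2]; have := mass_ge0 m.
  by nra.
have mG : measurable_fun setT (fun m : MF R d => (mass m + a * wint th lam m)%:E).
  apply/measurable_EFinP; apply: measurable_funD; first exact: measurable_mass.
  by apply: measurable_funM => //; exact: measurable_wint.
rewrite {1}/Rintegral (markov_ge0 nu s0 r0 FA mG ge0).
under eq_integral do rewrite affine_first_moment ?a0//.
rewrite -/(Rintegral _ _ _) RintegralD//; last 2 first.
- exact: integrable_mulr.
- by apply: integrable_mulr => //; exact: integrable_mulr.
rewrite !RintegralZl//; exact: integrable_mulr.
Qed.

Lemma markov_wint nu s r A th lam : 0 <= s -> 0 <= r -> natural_filtration X s A ->
  (\int[P nu]_(w in A) wint th lam (X (s + r) w))%R =
  expR (rho beta lam * r) * (\int[P nu]_(w in A) wint th lam (X s w))%R.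
Proof.
move=> s0 r0 FA; have mA := natural_filtration_measurable FA.
have sr0 : 0 <= s + r by rewrite addr_ge0.
have := markov_affine nu th lam s0 r0 (a := 0) ltac:(by rewrite lexx ler01) FA.
have := markov_affine nu th lam s0 r0 (a := 1) ltac:(by rewrite lexx ler01) FA.
have i1 : (P nu).-integrable A (fun w => (mass (X (s + r) w))%:E).
  have := wint_integrable alpha0 beta0 sbm nu 0 0 sr0.
  by under eq_fun do rewrite wint0; exact: integrableS.
have i2 : (P nu).-integrable A (fun w => (wint th lam (X (s + r) w))%:E).
  by have := wint_integrable alpha0 beta0 sbm nu th lam sr0; exact: integrableS.
rewrite RintegralD//; last exact: integrable_mulr.
rewrite RintegralD//; last exact: integrable_mulr.
rewrite !RintegralZl// !mul1r !mul0r !addr0 => h1 h2.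
by rewrite h2 in h1; exact: addrI h1.
Qed.

(* The weight c is free in |Y| <= (c + Y^2 / c) / 2. *)
Lemma wint_abs_moment nu r th lam (c : R) : 0 < c -> 0 <= r ->
  (\int[P nu]_w `|wint th lam (X r w) - expR (rho beta lam * r) * wint th lam nu|%:E <=
   (c / 2 + (2 * c)^-1 * (2 * alpha * b2 beta lam r * mass nu))%:E)%E.
Proof.
move=> c0 r0; set m := expR _ * _.
have my := measurable_wint_X sbm th lam r0.
have c20 : 0 <= (2 * c)^-1 by rewrite invr_ge0 mulr_ge0// ltW.
apply: (@le_trans _ _ (\int[P nu]_w ((c / 2)%:E + (2 * c)^-1%:E * ((wint th lam (X r w) - m) ^+ 2)%:E))%E).
  apply: ge0_le_integral => //.
  - by apply/measurable_EFinP; apply: measurableT_comp => //; exact: measurable_funB.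
  - apply: emeasurable_funD => //; apply: measurable_funeM; apply/measurable_EFinP.
    by apply: measurable_funX; exact: measurable_funB.
  - move=> w _; rewrite -EFinM -EFinD lee_fin; move: (_ - m) => z.
    rewrite -(real_normK (num_real z)); move: `|z| (normr_ge0 z) => y y0.
    rewrite -subr_ge0; have -> : c / 2 + (2 * c)^-1 * y ^+ 2 - y = (2 * c)^-1 * (y - c) ^+ 2.
      by field; rewrite gt_eqF.
    by rewrite mulr_ge0 ?sqr_ge0.
rewrite ge0_integralD//; last 3 first.
- by move=> w _; rewrite lee_fin divr_ge0// ltW.
- by move=> w _; rewrite -EFinM lee_fin mulr_ge0 ?sqr_ge0.
- apply: measurable_funeM; apply/measurable_EFinP.
  by apply: measurable_funX; exact: measurable_funB.
rewrite integral_cst//= probability_setT mule1 EFinD leeD2l//.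
rewrite ge0_integralZl_EFin//; last 2 first.
- by move=> w _; rewrite lee_fin sqr_ge0.
- apply/measurable_EFinP; apply: measurable_funX; exact: measurable_funB.
by rewrite EFinM lee_wpmul2l// (wint_variance alpha0 beta0 sbm).
Qed.

(** The integrand depends on X_s and X_(s+r) together, while the Markov property handles functions
    of X_(s+r) on an event of the past. So Omega is cut into countably many events on which <X_s,
    wave> is close to a rational, and this rational replaces it. Given X_s, the variance is bounded
    by a multiple of the mass of X_s, whose mean is e^(beta s) times the mass of nu; the weight c =
    e^(beta s / 2) balances the two terms of [wint_abs_moment]. *)
Lemma wint_increment nu s r th lam : 0 <= s -> 0 <= r ->
  (\int[P nu]_w `|wint th lam (X (s + r) w) - expR (rho beta lam * r) * wint th lam (X s w)|%:E <=
   (expR (beta * s / 2) * (2^-1 + alpha * b2 beta lam r * mass nu))%:E)%E.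
Proof.
move=> s0 r0; pose e := expR (rho beta lam * r); pose c := expR (beta * s / 2).
have c0 : 0 < c by exact: expR_gt0.
have e0 : 0 < e by exact: expR_gt0.
have b20 : 0 <= b2 beta lam r.
  have [bK rK] : beta <= Num.max beta (2 * rho beta lam) /\ 2 * rho beta lam <= Num.max beta (2 * rho beta lam).
    by rewrite !le_max !lexx orbT.
  by have /andP[] := b2_le r0 bK rK.
have sr0 : 0 <= s + r by rewrite addr_ge0.
have mysr := measurable_wint_X sbm th lam sr0.
have mys := measurable_wint_X sbm th lam s0.
(* The rational is substituted before the Markov property and removed after it; each exchange costs
   e eta = eta' / 2. *)
apply/lee_addgt0Pr => eta' eta'0; pose eta := eta' / (2 * e).
have eta0 : 0 < eta by rewrite divr_gt0// mulr_gt0.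
(* Enumerates the rationals; an index that encodes none gives 0. *)
pose q (i : nat) : R := ratr (odflt 0 (unpickle i : option rat)).
pose B i := [set m : MF R d | `|wint th lam m - q i| < eta].
have mB i : measurable (B i).
  apply: measurable_lt_cst.
  by apply: measurableT_comp => //; apply: measurable_funB => //; exact: measurable_wint.
pose A i := X s @^-1` (seqDU B i).
have mDB i : measurable (seqDU B i).
  by apply: measurableD => //; apply: bigsetU_measurable.
have mA i : measurable (A i) by rewrite -[A i]setTI; exact: (sbm_measurable sbm).
have FA i : natural_filtration X s (A i) by exact: sub_natural_filtration.
have AT : setT = \bigcup_i A i.
  rewrite -preimage_bigcup -seqDU_bigcup_eq; apply/seteqP; split => // w _.
  have /rat_in_itvoo[p] : wint th lam (X s w) - eta < wint th lam (X s w) + eta.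
    by rewrite ltrBlDr -addrA ltrDl addr_gt0.
  rewrite in_itv/= => pw; exists (pickle p) => //=.
  by rewrite /B/= /q pickleK/= ltr_distlC.
have tA : trivIset setT A.
  apply/trivIsetP => i j _ _ ij; rewrite /A -preimage_setI.
  by have /trivIsetP/(_ i j Logic.I Logic.I ij) -> := @trivIset_seqDU _ B; rewrite preimage_set0.
have DB i m : seqDU B i m -> `|wint th lam m - q i| < eta by move=> [].
pose Z w := `|wint th lam (X (s + r) w) - e * wint th lam (X s w)|%:E.
have mZ : measurable_fun setT Z.
  apply/measurable_EFinP; apply: measurableT_comp => //; apply: measurable_funB => //.
  exact: measurable_funM.
have Z0 w : (0 <= Z w)%E by rewrite lee_fin.
pose U w : R := c / 2 + (2 * c)^-1 * (2 * alpha * b2 beta lam r * mass (X s w)) + eta'.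
have U0 w : 0 <= U w.
  rewrite !addr_ge0//; [by rewrite divr_ge0// ltW| |exact: ltW].
  rewrite mulr_ge0 ?invr_ge0 ?mulr_ge0 ?mass_ge0//; exact: ltW.
have mU : measurable_fun setT (fun w => (U w)%:E).
  apply/measurable_EFinP; apply: measurable_funD => //; apply: measurable_funD => //.
  apply: measurable_funM => //; apply: measurable_funM => //.
  exact: (measurable_mass_X sbm).
have step i : (\int[P nu]_(w in A i) Z w <= \int[P nu]_(w in A i) (U w)%:E)%E.
  pose G m := (`|wint th lam m - e * q i| + e * eta)%:E.
  have mG : measurable_fun setT G.
    apply/measurable_EFinP; apply: measurable_funD => //; apply: measurableT_comp => //.
    by apply: measurable_funB => //; exact: measurable_wint.
  have G0 m : (0 <= G m)%E by rewrite lee_fin addr_ge0// mulr_ge0// ltW.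
  have near_q w : A i w -> e * `|q i - wint th lam (X s w)| <= e * eta.
    by move=> /DB h; rewrite ler_pM2l// distrC ltW.
  apply: (@le_trans _ _ (\int[P nu]_(w in A i) G (X (s + r) w))%E).
    apply: ge0_le_integral => //.
    - exact: measurable_funTS.
    - apply: measurable_funTS; apply: (measurableT_comp mG).
      exact: (sbm_measurable sbm).
    - move=> w Aw; rewrite lee_fin.
      have -> : wint th lam (X (s + r) w) - e * wint th lam (X s w) =
        (wint th lam (X (s + r) w) - e * q i) + e * (q i - wint th lam (X s w)) by ring.
      apply: le_trans (ler_normD _ _) _; rewrite lerD2l normrM gtr0_norm//.
      exact: near_q.
  rewrite (markov_ge0 nu s0 r0 (FA i) mG G0).
  apply: ge0_le_integral => //.
  - by move=> w _; exact: integral_ge0.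
  - apply: measurable_funTS.
    exact: measurable_markov.
  - exact: measurable_funTS.
  - move=> w Aw.
    apply: (@le_trans _ _ (\int[P (X s w)]_w' (`|wint th lam (X r w') - e * wint th lam (X s w)|%:E
        + eta'%:E))%E).
      have myr := measurable_wint_X sbm th lam r0.
      apply: ge0_le_integral => //.
      + exact: measurableT_comp mG (sbm_measurable sbm r0).
      + apply: emeasurable_funD => //; apply/measurable_EFinP; apply: measurableT_comp => //.
        exact: measurable_funB.
      + move=> w' _; rewrite -EFinD lee_fin.
        have -> : wint th lam (X r w') - e * q i =
          (wint th lam (X r w') - e * wint th lam (X s w)) - e * (q i - wint th lam (X s w)) by ring.
        rewrite (_ : eta' = e * eta + e * eta); last by rewrite /eta; field; rewrite gt_eqF.
        rewrite addrA lerD2r; apply: le_trans (ler_normB _ _) _.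
        rewrite lerD2l normrM gtr0_norm//; exact: near_q.
    rewrite ge0_integralD//; last 2 first.
    + apply/measurable_EFinP; apply: measurableT_comp => //; apply: measurable_funB => //.
      exact: (measurable_wint_X sbm).
    + by move=> *; rewrite lee_fin ltW.
    rewrite integral_cst//= probability_setT mule1 /U EFinD leeD2r//.
    exact: wint_abs_moment.
rewrite AT ge0_integral_bigcup//; last first.
  by apply: measurable_funTS.
apply: (@le_trans _ _ (\sum_(0 <= i <oo) \int[P nu]_(w in A i) (U w)%:E)%E).
  by apply: lee_nneseries => [*|*]; [exact: integral_ge0|exact: step].
rewrite -ge0_integral_bigcup//; last 2 first.
- exact: measurable_funTS.
- by move=> w _; rewrite lee_fin.
rewrite -AT.
have i1 : (P nu).-integrable setT (fun w => (mass (X s w))%:E).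
  by have := wint_integrable alpha0 beta0 sbm nu 0 0 s0; under eq_fun do rewrite wint0.
have ic k : (P nu).-integrable setT (fun=> k%:E) by exact: finite_measure_integrable_cst.
have iM : (P nu).-integrable setT (fun w => ((2 * c)^-1 * (2 * alpha * b2 beta lam r * mass (X s w)))%:E).
  by apply: integrable_mulr => //; exact: integrable_mulr.
have iV := integrable_addr measurableT (ic (c / 2)) iM.
rewrite -[leLHS]fineK; last first.
  exact: (integrable_fin_num measurableT (integrable_addr measurableT iV (ic eta'))).
rewrite -EFinD lee_fin -/(Rintegral _ _ _).
rewrite RintegralD; [|exact: measurableT|exact: iV|exact: ic].
rewrite RintegralD; [|exact: measurableT|exact: ic|exact: iM].
rewrite !Rintegral_cst//= probability_setT !mulr1.
have iM0 := integrable_mulr measurableT (2 * alpha * b2 beta lam r) i1.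
rewrite RintegralZl; [|exact: measurableT|exact: iM0].
rewrite RintegralZl; [|exact: measurableT|exact: i1].
rewrite lerD2r.
have := wint_first_moment alpha0 beta0 sbm nu 0 0 s0; rewrite wint0 rho0.
under eq_Rintegral do rewrite wint0; move=> ->.
have -> : expR (beta * s) = c * c by rewrite -expRD; congr expR; field.
rewrite le_eqVlt; apply/orP; left; apply/eqP.
rewrite -/c; move: (c0); move: (b2 beta lam r) (mass nu) (c) => b m c' c'0.
by field; rewrite gt_eqF.
Qed.

End Markov.

(** * Joint measurability in the measure and the frequency *)

Section JointMeasurability.
Context {R : realType} {d : nat}.
Implicit Types (lam : 'rV[R]_d) (th : R).

Definition round_rV (k : nat) lam : 'rV[R]_d :=
  \row_i ((Num.floor (k.+1%:R * lam ord0 i))%:~R / k.+1%:R).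

Lemma round_rV_cvg lam i : round_rV k lam ord0 i @[k --> \oo] --> lam ord0 i.
Proof.
apply: (@squeeze_cvgr _ _ _ _ (fun k => lam ord0 i - k.+1%:R^-1) (fun=> lam ord0 i)); last first.
- exact: cvg_cst.
- rewrite -[X in _ --> X]subr0; apply: cvgB; [exact: cvg_cst|exact: cvg_harmonic].
apply: nearW => k; rewrite mxE; apply/andP; split.
  rewrite ler_pdivlMr// mulrBl mulVf ?pnatr_eq0// lerBlDr mulrC.
  by apply/ltW; rewrite -[X in _ + X]/(1%:~R) -intrD; exact: floorD1_gt.
by rewrite ler_pdivrMr// mulrC; exact: floor_le.
Qed.

Lemma wint_round_cvg th lam (nu : MF R d) :
  wint th (round_rV k lam) nu @[k --> \oo] --> wint th lam nu.
Proof.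
have [//|||||_ _ H] := @dominated_convergence _ _ _ nu setT measurableT
  (fun k x => (wave th (round_rV k lam) x)%:E) (fun x => (wave th lam x)%:E) (fun=> 1%:E).
- by move=> k; apply/measurable_EFinP; exact: measurable_wave1.
- by apply/measurable_EFinP; exact: measurable_wave1.
- apply/aeW => x _; apply: cvg_EFin; first exact: nearW.
  rewrite /comp/= /wave.
  apply: (@continuous_cvg _ _ _ _ _ _ cos); first exact: continuous_cos.
  apply: cvgD; last exact: cvg_cst.
  rewrite /dotv; elim: (index_enum _) => [|i r IH].
    rewrite [X in X @ _ --> _](_ : _ = fun=> 0); first by rewrite big_nil; exact: cvg_cst.
    by apply/funext => k; rewrite big_nil.
  rewrite [X in X @ _ --> _](_ : _ = (fun k => round_rV k lam ord0 i * x ord0 i +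
      \sum_(j <- r) round_rV k lam ord0 j * x ord0 j)); last first.
    by apply/funext => k; rewrite big_cons.
  rewrite big_cons; apply: cvgD => //; apply: cvgM; last exact: cvg_cst.
  exact: round_rV_cvg.
- exact: finite_measure_integrable_cst.
- by apply/aeW => x k _; rewrite /= lee_fin wave_le1.
apply: fine_cvg; rewrite fineK//; exact: (integrable_fin_num measurableT (wave_integrable _ _ _)).
Qed.

(** The pairing is measurable in the measure for each frequency and is the limit of its values at
    frequencies rounded down to a grid of mesh 1 / (k + 1). The grid is countable, so the preimages
    of a rounded pairing are countable unions of rectangles. *)
Lemma measurable_wint_joint th :
  measurable_fun setT (fun z : MF R d * 'rV[R]_d => wint th z.2 z.1).
Proof.
apply/measurable_EFinP; apply: (emeasurable_fun_cvg (fun k z => (wint th (round_rV k z.2) z.1)%:E)).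
  move=> k; apply/measurable_EFinP => _ B mB; rewrite setTI.
  pose pt (z : 'rV[int]_d) : 'rV[R]_d := \row_i ((z ord0 i)%:~R / k.+1%:R).
  pose F (z : 'rV[int]_d) := (wint th (pt z) @^-1` B) `*` [set lam : 'rV[R]_d | forall i, Num.floor (k.+1%:R * lam ord0 i) = z ord0 i].
  have -> : (fun z => wint th (round_rV k z.2) z.1) @^-1` B = \bigcup_z F z.
    apply/seteqP; split => [[nu lam] /= Bz|[nu lam] [z _ [/= Bz zE]]].
      exists (\row_i Num.floor (k.+1%:R * lam ord0 i)) => //; split => /= [|i]; last by rewrite mxE.
      by rewrite /= (_ : pt _ = round_rV k lam)//; apply/rowP => i; rewrite !mxE.
    by rewrite (_ : round_rV k lam = pt z)//; apply/rowP => i; rewrite !mxE zE.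
  have mF z : measurable (F z).
    apply: measurableX.
      by rewrite -[X in measurable X]setTI; exact: measurable_wint.
    rewrite (_ : [set lam : 'rV[R]_d | _] = \bigcap_(i in [set: 'I_d]) [set lam : 'rV[R]_d | Num.floor (k.+1%:R * lam ord0 i) = z ord0 i]).
      apply: fin_bigcap_measurable => // i _.
      have -> : [set lam : 'rV[R]_d | Num.floor (k.+1%:R * lam ord0 i) = z ord0 i] =
         (fun lam => k.+1%:R * lam ord0 i) @^-1` `[(z ord0 i)%:~R, (z ord0 i + 1)%:~R[.
        apply/seteqP; split => lam /=; rewrite in_itv/=.
          by move=> <-; rewrite floor_le floorD1_gt.
        by move=> ?; apply: floor_def.
      rewrite -[X in measurable X]setTI; apply: measurable_funM => //.
      exact: measurable_rV_coord.
    by apply/seteqP; split => [lam /= h i _|lam h i]; [exact: h|exact: (h i)].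
  have -> : \bigcup_z F z = \bigcup_n (if unpickle n is Some z then F z else set0).
    apply/seteqP; split => [p [z _ Fp]|p [n _]].
      by exists (pickle z) => //; rewrite pickleK.
    by case: (unpickle n) => // z Fp; exists z.
  by apply: bigcupT_measurable => n; case: (unpickle n).
by move=> z _; apply: cvg_EFin; [exact: nearW|exact: wint_round_cvg].
Qed.

Lemma measurable_wint_lam th (nu : MF R d) : measurable_fun setT (fun lam => wint th lam nu).
Proof.
exact: measurableT_comp (measurable_wint_joint th) (pair1_measurable nu).
Qed.

End JointMeasurability.

(** * The weak maximal inequality in discrete time *)

Section Doob.
Context {dT : measure_display} {T : measurableType dT} {R : realType}.
Variables (mu : {measure set T -> \bar R}) (N : nat -> T -> \bar R) (NT : T -> \bar R).
Variable a : R.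
Hypotheses (a0 : 0 <= a) (mN : forall i, measurable_fun setT (N i))
  (N0 : forall i w, (0 <= N i w)%E) (mNT : measurable_fun setT NT) (NT0 : forall w, (0 <= NT w)%E).

Definition exceed (i : nat) : set T := [set w | (a%:E < N i w)%E].

Lemma measurable_exceed i : measurable (exceed i).
Proof.
rewrite /exceed -[[set _ | _]]setTI; apply: emeasurable_fun_o_infty => //.
Qed.

(** [seqDU exceed i] is the event that i is the first index at which the level a is exceeded. These
    events are disjoint, and the submartingale inequality, with terminal value [NT], is used on them
    only. *)
Lemma doob_weak n :
  (forall i, (i < n)%N -> (\int[mu]_(w in seqDU exceed i) N i w <= \int[mu]_(w in seqDU exceed i) NT w)%E) ->
  (a%:E * mu (\bigcup_(i < n) exceed i) <= \int[mu]_w NT w)%E.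
Proof.
move=> H; pose D i := if (i < n)%N then seqDU exceed i else set0.
have mseq i : measurable (seqDU exceed i).
  apply: measurableD; first exact: measurable_exceed.
  by apply: bigsetU_measurable => *; exact: measurable_exceed.
have mD i : measurable (D i) by rewrite /D; case: ifP.
have tD : trivIset setT D.
  apply/trivIsetP => i j _ _ ij; rewrite /D; case: ifP => _; last by rewrite set0I.
  case: ifP => _; last by rewrite setI0.
  by have /trivIsetP := @trivIset_seqDU _ exceed; exact.
have E : \bigcup_(i < n) exceed i = \bigcup_i D i.
  apply/seteqP; split => [w [i /= ni Ei]|w [i _]]; last first.
    by rewrite /D; case: ifP => // ni [Ei _]; exists i.
  have [j _ Dj] : (\bigcup_j seqDU exceed j) w by rewrite -seqDU_bigcup_eq; exists i.
  exists j => //; rewrite /D ifT//; apply: leq_ltn_trans ni; rewrite leqNgt.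
  apply/negP => ij; have [_ nE] := Dj; apply: nE.
  by rewrite -bigcup_mkord; exists i.
rewrite E -integral_cst; last exact: bigcup_measurable.
rewrite ge0_integral_bigcup//.
apply: (@le_trans _ _ (\sum_(0 <= i <oo) \int[mu]_(w in D i) NT w)%E).
  apply: lee_nneseries => [i _ _|i _].
    by apply: integral_ge0 => *; rewrite lee_fin.
  rewrite /D; case: ifP => [ni|_]; last by rewrite !integral_set0.
  apply: le_trans (H i ni); apply: ge0_le_integral => //.
  - exact: measurable_funTS.
  - by move=> w [/ltW].
rewrite -ge0_integral_bigcup//; last exact: measurable_funTS.
apply: ge0_subset_integral => //; exact: bigcup_measurable.
Qed.

End Doob.

Lemma tonelli_restrict d1 d2 (T1 : measurableType d1) (T2 : measurableType d2) (R : realType)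
  (m1 : {sigma_finite_measure set T1 -> \bar R}) (m2 : {sigma_finite_measure set T2 -> \bar R})
  (f : T1 * T2 -> \bar R) (A : set T1) : measurable A -> measurable_fun setT f ->
  (forall z, 0 <= f z)%E ->
  (\int[m1]_(x in A) \int[m2]_y f (x, y) = \int[m2]_y \int[m1]_(x in A) f (x, y))%E.
Proof.
move=> mA mf f0.
pose g (z : T1 * T2) := (f z * (\1_A z.1)%:E)%E.
have mg : measurable_fun setT g.
  apply: emeasurable_funM => //; apply/measurable_EFinP.
  exact: measurableT_comp (measurable_indic mA) measurable_fst.
have gE y x : g (x, y) = ((fun x => f (x, y)) \_ A) x.
  rewrite /g patchE indicE /=; case: ifP => _; first by rewrite mule1.
  by rewrite mule0.
rewrite integral_mkcond.
have -> : (\int[m2]_y \int[m1]_(x in A) f (x, y) = \int[m2]_y \int[m1]_x g (x, y))%E.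
  apply: eq_integral => y _; rewrite integral_mkcond.
  by apply: eq_integral => x _; rewrite gE.
rewrite -(fubini_tonelli g)//; last by move=> z; rewrite mule_ge0// lee_fin.
apply: eq_integral => x _; rewrite patchE; case: ifPn => xA.
  by apply: eq_integral => y _; rewrite gE patchE xA.
rewrite integral0_eq// => y _; rewrite gE patchE (negbTE xA)//.
Qed.

Lemma fatou_le_cst dT (T : measurableType dT) (R : realType) (mu : {measure set T -> \bar R})
  (g : nat -> T -> R) (h : T -> R) (a : \bar R) :
  (forall n, measurable_fun setT (g n)) -> (forall n x, 0 <= g n x) ->
  (forall x, g n x @[n --> \oo] --> h x) ->
  (forall n, \int[mu]_x (g n x)%:E <= a)%E -> (\int[mu]_x (h x)%:E <= a)%E.
Proof.
move=> mg g0 gh ga.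
have -> : (\int[mu]_x (h x)%:E = \int[mu]_x limn_einf (fun n => (g n x)%:E))%E.
  apply: eq_integral => x _; apply/esym.
  have gx : (g n x)%:E @[n --> \oo] --> (h x)%:E by apply: cvg_EFin; [exact: nearW|exact: gh].
  by rewrite (cvg_limn_einf_sup gx).1.
apply: le_trans (@fatou _ _ _ mu setT measurableT (fun n x => (g n x)%:E) _ _) _.
- by move=> n; exact/measurable_EFinP.
- by move=> n x _; rewrite lee_fin.
rewrite limn_einf_lim; apply: lime_le; first exact: is_cvg_einfs.
apply: nearW => n; apply: le_trans (ga n).
by apply: ereal_inf_lbound; exists n => /=.
Qed.

Lemma eq_integralZl dT (T : measurableType dT) (R : realType) (mu : {measure set T -> \bar R})
  (C : set T) (f g : T -> R) (k : R) : measurable C ->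
  mu.-integrable C (fun x => (f x)%:E) -> mu.-integrable C (fun x => (g x)%:E) ->
  (\int[mu]_(x in C) f x)%R = (\int[mu]_(x in C) g x)%R ->
  (\int[mu]_(x in C) (k * f x)%:E = \int[mu]_(x in C) (k * g x)%:E)%E.
Proof.
move=> mC fi gi fg.
rewrite -[LHS]fineK ?(integrable_fin_num mC (integrable_mulr mC k fi))//.
rewrite -[RHS]fineK ?(integrable_fin_num mC (integrable_mulr mC k gi))//.
by rewrite -!/(Rintegral _ _ _) !RintegralZl// fg.
Qed.

(** * The martingale and Doob's inequality integrated over frequencies *)

Section Martingale.
Context {R : realType} {d : nat} (alpha beta : R).
Context {dO : measure_display} {Omega : measurableType dO}.
Variables (P : MF R d -> probability Omega R) (X : R -> Omega -> MF R d).
Hypotheses (alpha0 : 0 < alpha) (beta0 : 0 < beta).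
Hypothesis sbm : super_brownian_motion alpha beta P X.
Implicit Types (nu : MF R d) (lam x : 'rV[R]_d) (t s r c a th : R).

Definition Mt th lam t w : R := expR (- (rho beta lam * t)) * wint th lam (X t w).

Lemma measurable_Mt th lam t : 0 <= t -> measurable_fun setT (Mt th lam t).
Proof. by move=> t0; apply: measurable_funM => //; exact: (measurable_wint_X sbm). Qed.

Lemma measurable_rho : measurable_fun setT (@rho R d beta).
Proof.
apply: measurable_funB => //; apply: measurable_funM => //.
exact: (measurableT_comp measurable_dotv (measurable_fun_pair (@measurable_id _ _ _) (@measurable_id _ _ _))).
Qed.

Lemma measurable_Mt_lam th t w : measurable_fun setT (fun lam => Mt th lam t w).
Proof.
apply: measurable_funM; last exact: measurable_wint_lam.
apply: measurableT_comp => //; apply: measurableT_comp => //; apply: measurable_funM => //.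
exact: measurable_rho.
Qed.

Lemma Mt_integrable nu th lam t A : 0 <= t -> measurable A ->
  (P nu).-integrable A (fun w => (Mt th lam t w)%:E).
Proof.
move=> t0 mA; apply: integrable_mulr => //.
by have := wint_integrable alpha0 beta0 sbm nu th lam t0; exact: integrableS.
Qed.

Lemma Mt_martingale nu th lam s t A : 0 <= s -> s <= t -> natural_filtration X s A ->
  (\int[P nu]_(w in A) Mt th lam t w)%R = (\int[P nu]_(w in A) Mt th lam s w)%R.
Proof.
move=> s0 st FA; have mA := natural_filtration_measurable sbm FA.
have t0 := le_trans s0 st.
have iw u : 0 <= u -> (P nu).-integrable A (fun w => (wint th lam (X u w))%:E).
  by move=> u0; have := wint_integrable alpha0 beta0 sbm nu th lam u0; exact: integrableS.
have E u : 0 <= u -> (\int[P nu]_(w in A) Mt th lam u w)%R =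
    expR (- (rho beta lam * u)) * (\int[P nu]_(w in A) wint th lam (X u w))%R.
  by move=> u0; exact: (RintegralZl _ mA (iw u u0)).
rewrite (E t t0) (E s s0).
have ts0 : 0 <= t - s by rewrite subr_ge0.
have := markov_wint alpha0 beta0 sbm nu th lam s0 ts0 FA.
rewrite (_ : s + (t - s) = t) => [->|]; last by ring.
by rewrite mulrA -expRD; congr (expR _ * _); ring.
Qed.

(** Omega with the sigma-algebra of the past up to s, so that membership in the natural filtration
    becomes ordinary measurability. *)
Let Fs s := g_sigma_algebraType
  (\bigcup_(r in `[0%R, s]) preimage_set_system setT (X r) measurable).

Lemma measurable_X_filtration r s : 0 <= r -> r <= s ->
  measurable_fun setT (X r : Fs s -> MF R d).
Proof.
by move=> r0 rs _ B mB; rewrite setTI; exact: sub_natural_filtration.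
Qed.

(** The sign of M_s - M_(s0) is known at time s. On each of the two parts of A that it defines, the
    martingale property preserves the signed integral, and the absolute value at time t dominates
    it. *)
Lemma Mt_submartingale nu th lam s0 s t A : 0 <= s0 -> s0 <= s -> s <= t ->
  natural_filtration X s A ->
  (\int[P nu]_(w in A) `|Mt th lam s w - Mt th lam s0 w|%:E <=
   \int[P nu]_(w in A) `|Mt th lam t w - Mt th lam s0 w|%:E)%E.
Proof.
move=> s00 s0s st FA.
have s_0 := le_trans s00 s0s; have t_0 := le_trans s_0 st.
have mA := natural_filtration_measurable sbm FA.
pose B := [set w | Mt th lam s0 w <= Mt th lam s w].
have FB : natural_filtration X s B.
  have m1 u : 0 <= u -> u <= s -> measurable_fun setT (Mt th lam u : Fs s -> R).
    move=> u0 us; apply: measurable_funM => //.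
    exact: measurableT_comp (measurable_wint th lam) (measurable_X_filtration u0 us).
  have := @measurable_fun_le _ (Fs s) R setT _ _ measurableT (m1 s0 s00 s0s) (m1 s s_0 (lexx s)).
  by rewrite setTI.
have mB := natural_filtration_measurable sbm FB.
have FAB : natural_filtration X s (A `&` B) by exact: (@measurableI _ (Fs s)).
have FAB' : natural_filtration X s (A `\` B) by exact: (@measurableD _ (Fs s)).
have mAB := natural_filtration_measurable sbm FAB.
have mAB' := natural_filtration_measurable sbm FAB'.
have AE : A = (A `&` B) `|` (A `\` B) by rewrite setUIDK.
have dis : [disjoint A `&` B & A `\` B].
  by apply/disj_setPS => w [[_ Bw] [_ nBw]]; exact: nBw Bw.
have mD u : 0 <= u -> measurable_fun setT (fun w => `|Mt th lam u w - Mt th lam s0 w|%:E).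
  move=> u0; apply/measurable_EFinP; apply: measurableT_comp => //.
  by apply: measurable_funB; exact: measurable_Mt.
have iD u C : 0 <= u -> measurable C -> (P nu).-integrable C (fun w => (Mt th lam u w - Mt th lam s0 w)%:E).
  by move=> u0 mC; apply: integrable_subr => //; exact: Mt_integrable.
have key C (sg : R) : natural_filtration X s C -> `|sg| = 1 ->
   (forall w, C w -> `|Mt th lam s w - Mt th lam s0 w| = sg * (Mt th lam s w - Mt th lam s0 w)) ->
  (\int[P nu]_(w in C) `|Mt th lam s w - Mt th lam s0 w|%:E <=
   \int[P nu]_(w in C) `|Mt th lam t w - Mt th lam s0 w|%:E)%E.
  move=> FC sg1 CE; have mC := natural_filtration_measurable sbm FC.
  rewrite (eq_integral (fun w => (sg * (Mt th lam s w - Mt th lam s0 w))%:E)); last first.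
    by move=> w /set_mem Cw; rewrite CE.
  have -> : (\int[P nu]_(w in C) (sg * (Mt th lam s w - Mt th lam s0 w))%:E =
    \int[P nu]_(w in C) (sg * (Mt th lam t w - Mt th lam s0 w))%:E)%E.
    apply: (@eq_integralZl _ _ _ (P nu) C (fun w => Mt th lam s w - Mt th lam s0 w)
      (fun w => Mt th lam t w - Mt th lam s0 w) sg mC (iD s C s_0 mC) (iD t C t_0 mC)).
    have i0 := Mt_integrable nu th lam s00 mC.
    rewrite (RintegralB mC (Mt_integrable nu th lam s_0 mC) i0).
    rewrite (RintegralB mC (Mt_integrable nu th lam t_0 mC) i0).
    by rewrite (Mt_martingale nu th lam s_0 st FC).
  apply: le_integral => //.
  - by apply: integrable_mulr => //; exact: iD.
  - by apply: (integrable_abse (iD t C t_0 mC)).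
  - move=> w _; rewrite lee_fin; apply: le_trans (ler_norm _) _.
    by rewrite normrM sg1 mul1r.
have split u : 0 <= u -> (\int[P nu]_(w in A) `|Mt th lam u w - Mt th lam s0 w|%:E =
    \int[P nu]_(w in A `&` B) `|Mt th lam u w - Mt th lam s0 w|%:E +
    \int[P nu]_(w in A `\` B) `|Mt th lam u w - Mt th lam s0 w|%:E)%E.
  move=> u0; rewrite {1}AE ge0_integral_setU//.
  by apply: measurable_funTS; exact: mD.
rewrite (split s s_0) (split t t_0); apply: leeD.
- apply: (key _ 1) => // [|w [_ Bw]]; first by rewrite normr1.
  by rewrite mul1r ger0_norm// subr_ge0.
- apply: (key _ (-1)) => // [|w [_ nBw]]; first by rewrite normrN1.
  rewrite mulN1r ler0_norm// subr_le0 leNgt; apply/negP => h.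
  by apply: nBw; exact: ltW.
Qed.

Lemma measurable_Mt_joint dT (T : measurableType dT) (Y : T -> MF R d) th t :
  measurable_fun setT Y ->
  measurable_fun setT (fun z : T * 'rV[R]_d =>
    expR (- (rho beta z.2 * t)) * wint th z.2 (Y z.1)).
Proof.
move=> mY; apply: measurable_funM.
  apply: measurableT_comp => //; apply: measurableT_comp => //; apply: measurable_funM => //.
  exact: measurableT_comp measurable_rho measurable_snd.
apply: (@measurableT_comp _ _ _ _ _ _ (fun z : MF R d * 'rV[R]_d => wint th z.2 z.1) _
  (fun z : T * 'rV[R]_d => (Y z.1, z.2))); first exact: measurable_wint_joint.
apply/measurable_fun_pair; last exact: measurable_snd.
exact: measurableT_comp mY measurable_fst.
Qed.

Lemma wint_right_continuous th lam w t : 0 <= t ->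
  wint th lam (X s w) @[s --> t^'+] --> wint th lam (X t w).
Proof.
move=> t0; apply: (@cvg_comp _ _ _ (fun s => X s w) (wint th lam) _ (nbhs (X t w))).
  exact: (sbm_right_continuous sbm).
exact: continuous_wint.
Qed.

Lemma Mt_right_continuous th lam w t (u : nat -> R) : 0 <= t ->
  (forall n, t < u n) -> u n @[n --> \oo] --> t ->
  Mt th lam (u n) w @[n --> \oo] --> Mt th lam t w.
Proof.
move=> t0 ut cu; apply: cvgM.
  apply: (@continuous_cvg _ _ _ _ _ _ expR); first exact: continuous_expR.
  by apply: cvgN; apply: cvgM => //; exact: cvg_cst.
have /cvg_at_rightP := @wint_right_continuous th lam w t t0.
by apply; split.
Qed.

Section IntegratedDoob.
Variables (kappa : {sigma_finite_measure set 'rV[R]_d -> \bar R}) (G : 'rV[R]_d -> R).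
Hypotheses (G0 : forall lam, 0 <= G lam) (mG : measurable_fun setT G).
Variables (nu : MF R d) (th s0 h : R).
Hypotheses (s00 : 0 <= s0) (h0 : 0 < h).

(** Integrating over the frequencies at this stage gives a single submartingale in t, hence one
    maximal inequality for all frequencies together. *)
Definition dist_Mt t w : \bar R :=
  (\int[kappa]_lam (G lam * `|Mt th lam t w - Mt th lam s0 w|)%:E)%E.

Lemma dist_Mt_ge0 t w : (0 <= dist_Mt t w)%E.
Proof. by apply: integral_ge0 => lam _; rewrite lee_fin mulr_ge0. Qed.

Lemma measurable_dist_joint dT (T : measurableType dT) (Y Z : T -> MF R d) t :
  measurable_fun setT Y -> measurable_fun setT Z ->
  measurable_fun setT (fun z : T * 'rV[R]_d =>
    (G z.2 * `|expR (- (rho beta z.2 * t)) * wint th z.2 (Y z.1)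
      - expR (- (rho beta z.2 * s0)) * wint th z.2 (Z z.1)|)%:E).
Proof.
move=> mY mZ; apply/measurable_EFinP; apply: measurable_funM.
  exact: measurableT_comp mG measurable_snd.
apply: measurableT_comp => //; apply: measurable_funB; exact: measurable_Mt_joint.
Qed.

Lemma measurable_dist_Mt t : 0 <= t -> measurable_fun setT (dist_Mt t).
Proof.
move=> t0; apply: (measurable_fun_fubini_tonelli_F _
  (measurable_dist_joint t (sbm_measurable sbm t0) (sbm_measurable sbm s00))).
by move=> z; rewrite lee_fin mulr_ge0.
Qed.

Lemma measurable_dist_Mt_filtration t s : s0 <= t -> t <= s ->
  measurable_fun setT (dist_Mt t : Fs s -> \bar R).
Proof.
move=> s0t ts; have t0 := le_trans s00 s0t.
apply: (measurable_fun_fubini_tonelli_F _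
  (measurable_dist_joint t (measurable_X_filtration t0 ts)
    (measurable_X_filtration s00 (le_trans s0t ts)))).
by move=> z; rewrite lee_fin mulr_ge0.
Qed.

Lemma dist_Mt_tonelli A u : measurable A -> 0 <= u ->
  (\int[P nu]_(w in A) dist_Mt u w =
   \int[kappa]_lam ((G lam)%:E * \int[P nu]_(w in A) `|Mt th lam u w - Mt th lam s0 w|%:E))%E.
Proof.
move=> mA u0; rewrite /dist_Mt (@tonelli_restrict _ _ _ _ _ (P nu) kappa
  (fun z => (G z.2 * `|Mt th z.2 u z.1 - Mt th z.2 s0 z.1|)%:E))//.
- apply: eq_integral => lam _ /=; under eq_integral do rewrite EFinM.
  rewrite ge0_integralZl_EFin//.
  apply: measurable_funTS; apply/measurable_EFinP; apply: measurableT_comp => //.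
  by apply: measurable_funB; exact: measurable_Mt.
- exact: measurable_dist_joint (sbm_measurable sbm u0) (sbm_measurable sbm s00).
- by move=> z; rewrite lee_fin mulr_ge0.
Qed.

Lemma dist_Mt_submartingale s t A : s0 <= s -> s <= t -> natural_filtration X s A ->
  (\int[P nu]_(w in A) dist_Mt s w <= \int[P nu]_(w in A) dist_Mt t w)%E.
Proof.
move=> s0s st FA; have s_0 := le_trans s00 s0s; have t_0 := le_trans s_0 st.
have mA := natural_filtration_measurable sbm FA.
rewrite [leLHS](dist_Mt_tonelli mA s_0) [leRHS](dist_Mt_tonelli mA t_0).
apply: ge0_le_integral_nomeas => lam _.
  by rewrite mule_ge0 ?lee_fin// integral_ge0.
by apply: lee_wpmul2l; [rewrite lee_fin|exact: (Mt_submartingale _ _ _ s00 s0s st FA)].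
Qed.

(** Right continuity at each frequency passes to the integral as an inequality, by Fatou's lemma.
    That is enough: a bound at later times tending to t is inherited by t. *)
Lemma dist_Mt_right_lsc t (u : nat -> R) w (a : \bar R) : 0 <= t ->
  (forall n, t < u n) -> u n @[n --> \oo] --> t -> (forall n, dist_Mt (u n) w <= a)%E ->
  (dist_Mt t w <= a)%E.
Proof.
move=> t0 ut cu ua.
apply: (@fatou_le_cst _ _ _ kappa (fun n lam => G lam * `|Mt th lam (u n) w - Mt th lam s0 w|)).
- move=> n; have u0 : 0 <= u n by exact: le_trans t0 (ltW (ut n)).
  apply: measurable_funM => //; apply: measurableT_comp => //; apply: measurable_funB.
    exact: measurable_Mt_lam.
  exact: measurable_Mt_lam.
- by move=> n lam; rewrite mulr_ge0.
- move=> lam; apply: cvgM; first exact: cvg_cst.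
  apply: cvg_norm; apply: cvgB; last exact: cvg_cst.
  exact: Mt_right_continuous.
- by move=> n; exact: ua.
Qed.

(** Dyadic points of [s0, s0 + h]; the cap on j keeps every index inside the interval. *)
Definition grid k j : R := s0 + h * (minn j (2 ^ k))%:R / (2 ^ k)%:R.

Lemma grid_ge k j : s0 <= grid k j.
Proof. by rewrite lerDl divr_ge0// mulr_ge0// ltW. Qed.

Lemma grid_le k j : grid k j <= s0 + h.
Proof.
rewrite /grid lerD2l ler_pdivrMr ?ltr0n ?expn_gt0// ler_pM2l// ler_nat.
exact: geq_minr.
Qed.

Lemma grid_nondecreasing k i j : (i <= j)%N -> grid k i <= grid k j.
Proof.
move=> ij; rewrite /grid lerD2l ler_pM2r ?invr_gt0 ?ltr0n ?expn_gt0// ler_pM2l// ler_nat.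
by rewrite leq_min geq_minr andbT; apply: leq_trans (geq_minl _ _) ij.
Qed.

Lemma grid_refine k j : grid k j = grid k.+1 (2 * j).
Proof.
rewrite /grid expnS -minnMr natrM natrM; field.
by rewrite pnatr_eq0 expn_eq0.
Qed.

Definition doob_bad (a : R) k := \bigcup_(j < (2 ^ k).+1) [set w | (a%:E < dist_Mt (grid k j) w)%E].

Lemma doob_bad_measurable a k : measurable (doob_bad a k).
Proof.
apply: bigcup_measurable => j _; rewrite -[[set _ | _]]setTI.
apply: emeasurable_fun_o_infty => //; apply: measurable_dist_Mt.
exact: le_trans (grid_ge k j).
Qed.

Lemma doob_bad_le a k : 0 <= a ->
  (a%:E * P nu (doob_bad a k) <= \int[P nu]_w dist_Mt (s0 + h) w)%E.
Proof.
move=> a0; have g0 j : 0 <= grid k j by exact: le_trans (grid_ge k j).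
apply: (@doob_weak _ _ _ (P nu) (fun j => dist_Mt (grid k j)) (dist_Mt (s0 + h)) a a0).
- by move=> j; exact: measurable_dist_Mt.
- by apply: measurable_dist_Mt; rewrite addr_ge0// ltW.
- by move=> *; exact: dist_Mt_ge0.
move=> j _; apply: dist_Mt_submartingale; [exact: grid_ge|exact: grid_le|].
have mE i : (i <= j)%N -> natural_filtration X (grid k j) (exceed (fun j => dist_Mt (grid k j)) a i).
  move=> ij; have := measurable_dist_Mt_filtration (grid_ge k i) (grid_nondecreasing k ij).
  move=> /(emeasurable_fun_o_infty measurableT)/(_ a%:E).
  by rewrite setTI.
apply: (@measurableD _ (Fs (grid k j))); first exact: mE.
apply: (@bigsetU_measurable _ (Fs (grid k j))) => i _.
by apply: mE; exact/ltnW.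
Qed.

(* Doob's weak maximal inequality over the whole interval [s0, s0 + h]: the dyadic
   maxima increase, and right continuity with Fatou's lemma covers the other times. *)
Lemma doob_continuous a : 0 <= a -> exists B : set Omega, [/\ measurable B,
  (a%:E * P nu B <= \int[P nu]_w dist_Mt (s0 + h) w)%E &
  forall w, ~ B w -> forall t, s0 <= t <= s0 + h -> (dist_Mt t w <= a%:E)%E].
Proof.
move=> a0; exists (\bigcup_k doob_bad a k); split.
- by apply: bigcup_measurable => k _; exact: doob_bad_measurable.
- have cv : P nu (doob_bad a k) @[k --> \oo] --> P nu (\bigcup_k doob_bad a k).
    apply: nondecreasing_cvg_mu.
    + by move=> k; exact: doob_bad_measurable.
    + by apply: bigcup_measurable => k _; exact: doob_bad_measurable.
    + apply/nondecreasing_seqP => k; apply/subsetPset => w [j /= jk aw].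
      exists (2 * j)%N; last by rewrite /= -grid_refine.
      by rewrite /= ltnS expnS leq_mul2l/= -ltnS.
  have cv' : (a%:E * P nu (doob_bad a k))%E @[k --> \oo] --> (a%:E * P nu (\bigcup_k doob_bad a k))%E.
    by apply: cvgeZl => //; rewrite fin_numE.
  rewrite -(cvg_lim _ cv')//; apply: lime_le; first by apply/cvg_ex; eexists; exact: cv'.
  by apply: nearW => k; exact: doob_bad_le.
- move=> w nB t /andP[st tsh].
  have good k j : (j <= 2 ^ k)%N -> (dist_Mt (grid k j) w <= a%:E)%E.
    move=> jk; rewrite leNgt; apply/negP => h1; apply: nB; exists k => //.
    by exists j.
  (* The right endpoint has no later point in the interval to approach it from, but it is itself the
     grid point of level 0 and index 1. *)
  have [->|tne] := eqVneq t (s0 + h).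
    have := good 0%N 1%N (leqnn _).
    by rewrite /grid expn0 minnn mulr1 divr1.
  have tlt : t < s0 + h by rewrite lt_neqAle tne.
  pose y := (t - s0) / h.
  have y0 : 0 <= y by rewrite divr_ge0 ?subr_ge0// ltW.
  have y1 : y < 1 by rewrite ltr_pdivrMr// mul1r ltrBlDl.
  (* Index of the first dyadic point strictly after t, the strictness being what right continuity
     asks for; y < 1 keeps the index at most 2^k. *)
  pose jj k := (Num.truncn ((2 ^ k)%:R * y)).+1.
  have k0 k : 0 < (2 ^ k)%:R :> R by rewrite ltr0n expn_gt0.
  have ky0 k : 0 <= (2 ^ k)%:R * y by rewrite mulr_ge0// ltW.
  have jle k : (jj k <= 2 ^ k)%N.
    rewrite /jj -(ltr_nat R); apply: le_lt_trans (_ : (2 ^ k)%:R * y < _).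
      by rewrite truncn_le.
    by rewrite -[ltRHS]mulr1 ltr_pM2l.
  have gE k : grid k (jj k) = s0 + h * (jj k)%:R / (2 ^ k)%:R.
    by rewrite /grid (minn_idPl (jle k)).
  have tE : t = s0 + h * y by rewrite /y; field; rewrite gt_eqF.
  apply: (@dist_Mt_right_lsc t (fun k => grid k (jj k))).
  + exact: le_trans st.
  + move=> k; rewrite gE {1}tE ltrD2l -mulrA ltr_pM2l// ltr_pdivlMr// mulrC.
    exact: truncnS_gt.
  + apply: (@squeeze_cvgr _ _ _ _ (fun=> t) (fun k => t + h * ((2 ^ k)%:R)^-1)); last 2 first.
    * exact: cvg_cst.
    * rewrite -[X in _ --> X]addr0; apply: cvgD; first exact: cvg_cst.
      rewrite -[X in _ --> X](mulr0 h); apply: cvgM; first exact: cvg_cst.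
      under eq_fun do rewrite natrX -exprVn.
      by apply: cvg_expr; rewrite ger0_norm ?invr_ge0// invf_lt1// ltr1n.
    apply: nearW => k; rewrite gE tE; apply/andP; split.
      by rewrite lerD2l -mulrA ler_pM2l// ler_pdivlMr// mulrC ltW//; exact: truncnS_gt.
    rewrite -addrA lerD2l -mulrA -mulrDr ler_pM2l// ler_pdivrMr// mulrDl mulVf ?gt_eqF//.
    rewrite -natr1 lerD2r mulrC.
    by rewrite truncn_le// mulrC.
  + by move=> k; exact: good.
Qed.

End IntegratedDoob.

End Martingale.

(** * Borel-Cantelli for exponential bounds *)

Section BorelCantelli.
Context {dT : measure_display} {T : measurableType dT} {R : realType} (P : probability T R).

Lemma ae_eventually_not (B : nat -> set T) (A r : R) : (forall n, measurable (B n)) ->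
  0 <= r < 1 -> (forall n, P (B n) <= (A * r ^+ n)%:E)%E ->
  {ae P, forall w, exists N, forall n, (N <= n)%N -> ~ B n w}.
Proof.
move=> mB /andP[r0 r1] PB.
have A0 : 0 <= A.
  by have := le_trans (measure_ge0 P (B 0%N)) (PB 0%N); rewrite expr0 mulr1 lee_fin.
have PL : P (lim_sup_set B) = 0%E.
  apply: lim_sup_set_cvg0 => //.
  apply: (@le_lt_trans _ _ (A / (1 - r))%:E); last by rewrite ltry.
  apply: lime_le; first exact: is_cvg_nneseries.
  apply: nearW => n; apply: (@le_trans _ _ (\sum_(0 <= i < n) (A * r ^+ i)%:E)%E).
    by apply: lee_sum => i _; exact: PB.
  rewrite sumEFin lee_fin -mulr_sumr ler_wpM2l//.
  have r1' : 0 < 1 - r by rewrite subr_gt0.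
  rewrite -(ler_pM2r r1') mulVf ?gt_eqF// mulrC.
  have -> : (1 - r) * (\sum_(0 <= i < n) r ^+ i) = 1 - r ^+ n.
    elim: n => [|n IH]; first by rewrite big_geq// mulr0 expr0 subrr.
    by rewrite big_nat_recr//= mulrDr IH exprSr; ring.
  by rewrite gerBl exprn_ge0.
exists (lim_sup_set B); split => //; first by apply: bigcap_measurable => // n _; apply: bigcup_measurable => j _.
move=> w /= nw n _ /=; apply: contrapT => nB; apply: nw.
exists n => m /= nm Bm; apply: nB; by exists m.
Qed.

(** The probabilities are O(e^((u - v) n)), hence summable: an almost sure bound costs an
    arbitrarily small increase of the rate, from u to v. *)
Lemma ae_eventually_markov (B : nat -> set T) (A u v : R) : (forall n, measurable (B n)) ->
  u < v -> (forall n, (expR (v * n%:R))%:E * P (B n) <= (A * expR (u * n%:R))%:E)%E ->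
  {ae P, forall w, exists N, forall n, (N <= n)%N -> ~ B n w}.
Proof.
move=> mB uv H; apply: (@ae_eventually_not B A (expR (u - v))) => //.
  by rewrite expR_ge0 expR_lt1 subr_lt0.
move=> n; have := H n.
rewrite -(fineK (fin_num_measure P _ (mB n))) -EFinM !lee_fin => h.
rewrite -(ler_pM2l (expR_gt0 (v * n%:R))); apply: le_trans h _.
rewrite -expRM_natl mulrCA -expRD le_eqVlt; apply/orP; left; apply/eqP.
by congr (_ * expR _); ring.
Qed.

Lemma ae_eventually_le (Y : nat -> T -> \bar R) (A u v : R) :
  (forall n, measurable_fun setT (Y n)) -> (forall n w, 0 <= Y n w)%E -> u < v ->
  (forall n, \int[P]_w Y n w <= (A * expR (u * n%:R))%:E)%E ->
  {ae P, forall w, exists N, forall n, (N <= n)%N -> (Y n w <= (expR (v * n%:R))%:E)%E}.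
Proof.
move=> mY Y0 uv H.
have mB n : measurable (exceed (fun=> Y n) (expR (v * n%:R)) 0).
  exact: measurable_exceed.
apply: filterS (ae_eventually_markov mB uv _) => [w [N HN]|n].
  by exists N => n /HN /negP; rewrite -leNgt.
apply: le_trans (H n).
rewrite -integral_cst//; apply: (@le_trans _ _ (\int[P]_(w in exceed (fun=> Y n) (expR (v * n%:R)) 0) Y n w)%E).
  apply: ge0_le_integral => //; first by move=> w _; rewrite lee_fin expR_ge0.
    exact: measurable_funTS.
  by move=> w /ltW.
exact: ge0_subset_integral.
Qed.

End BorelCantelli.

(** * Suprema over blocks of length h *)

Section BlockEstimates.
Context {R : realType} {d : nat} (alpha beta : R).
Context {dO : measure_display} {Omega : measurableType dO}.
Variables (P : MF R d -> probability Omega R) (X : R -> Omega -> MF R d).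
Hypotheses (alpha0 : 0 < alpha) (beta0 : 0 < beta).
Hypothesis sbm : super_brownian_motion alpha beta P X.
Variables (nu : MF R d) (th h : R).
Hypothesis h0 : 0 < h.
Implicit Types (lam x : 'rV[R]_d) (t s r c a : R).

(** The factor of [wint_increment] with [b2] replaced by its bound for K = 2 beta, so that it no
    longer depends on the frequency. *)
Definition increment_const := 2^-1 + alpha * (h * expR (2 * beta * h)) * mass nu.

Lemma increment_const_ge0 : 0 <= increment_const.
Proof.
rewrite addr_ge0 ?invr_ge0// !mulr_ge0 ?expR_ge0 ?mass_ge0//; exact: ltW.
Qed.

Lemma rho_le lam : rho beta lam <= beta.
Proof. by rewrite gerBl mulr_ge0 ?invr_ge0// dotv_ge0. Qed.

Lemma Mt_increment s lam : 0 <= s ->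
  (\int[P nu]_w `|Mt beta X th lam (s + h) w - Mt beta X th lam s w|%:E <=
   (expR (- (rho beta lam * (s + h))) * (expR (beta * s / 2) * increment_const))%:E)%E.
Proof.
move=> s_0; have sh0 : 0 <= s + h by rewrite addr_ge0// ltW.
have mI : measurable_fun setT (fun w => `|wint th lam (X (s + h) w) -
      expR (rho beta lam * h) * wint th lam (X s w)|%:E).
  apply/measurable_EFinP; apply: measurableT_comp => //; apply: measurable_funB.
    exact: (measurable_wint_X sbm).
  by apply: measurable_funM => //; exact: (measurable_wint_X sbm).
have -> : (\int[P nu]_w `|Mt beta X th lam (s + h) w - Mt beta X th lam s w|%:E =
  (expR (- (rho beta lam * (s + h))))%:E * \int[P nu]_w
    `|wint th lam (X (s + h) w) - expR (rho beta lam * h) * wint th lam (X s w)|%:E)%E.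
  rewrite -ge0_integralZl_EFin ?expR_ge0//.
  apply: eq_integral => w _; rewrite -EFinM; congr EFin.
  rewrite -[X in X * `|_|](ger0_norm (expR_ge0 (- (rho beta lam * (s + h))))) -normrM.
  congr (`|_|); rewrite /Mt mulrBr mulrA -expRD; congr (_ - expR _ * _); ring.
rewrite EFinM lee_wpmul2l ?lee_fin ?expR_ge0//.
apply: le_trans (wint_increment alpha0 beta0 sbm nu th lam s_0 (ltW h0)) _.
rewrite lee_fin ler_wpM2l ?expR_ge0// lerD2l ler_wpM2r ?mass_ge0// ler_wpM2l ?(ltW alpha0)//.
have bb : beta <= 2 * beta by rewrite ler_peMl ?ler1n// ltW.
have rb : 2 * rho beta lam <= 2 * beta by rewrite ler_pM2l// rho_le.
by have /andP[] := b2_le (ltW h0) bb rb.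
Qed.

Lemma Mt_expectation_blocks (kappa : {sigma_finite_measure set 'rV[R]_d -> \bar R})
  (G : 'rV[R]_d -> R) s : (forall lam, 0 <= G lam) -> measurable_fun setT G -> 0 <= s ->
  (\int[P nu]_w dist_Mt beta X kappa G th s (s + h) w <=
   \int[kappa]_lam (expR (beta * s / 2) * increment_const * (G lam * expR (- (rho beta lam * (s + h)))))%:E)%E.
Proof.
move=> G0 mG s_0; have sh0 : 0 <= s + h by rewrite addr_ge0// ltW.
rewrite (dist_Mt_tonelli sbm kappa G0 mG nu th s_0 measurableT sh0).
apply: ge0_le_integral_nomeas => lam _.
  by rewrite mule_ge0 ?lee_fin// integral_ge0.
apply: le_trans (lee_wpmul2l _ (Mt_increment lam s_0)) _; first by rewrite lee_fin.
by rewrite -EFinM lee_fin le_eqVlt; apply/orP; left; apply/eqP; ring.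
Qed.

(** Doob's inequality bounds the supremum over the n-th block by the mean at its right end. The
    measure is left general for two uses: a Dirac mass follows a single frequency, Lebesgue measure
    treats all of them. The weight may vary with n in order to carry e^(rho n h). *)
Lemma ae_blocks (kappa : {sigma_finite_measure set 'rV[R]_d -> \bar R})
  (G : nat -> 'rV[R]_d -> R) (A u v : R) :
  (forall n lam, 0 <= G n lam) -> (forall n, measurable_fun setT (G n)) -> u < v ->
  (forall n, \int[kappa]_lam (expR (beta * (n%:R * h) / 2) * increment_const *
     (G n lam * expR (- (rho beta lam * (n%:R * h + h)))))%:E <= (A * expR (u * n%:R))%:E)%E ->
  {ae P nu, forall w, exists N, forall n, (N <= n)%N -> forall t, n%:R * h <= t <= n%:R * h + h ->
    (dist_Mt beta X kappa (G n) th (n%:R * h) t w <= (expR (v * n%:R))%:E)%E}.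
Proof.
move=> G0 mG uv H.
have nh0 n : 0 <= n%:R * h by rewrite mulr_ge0// ltW.
have /choice[B HB] : forall n, exists B : set Omega, [/\ measurable B,
  ((expR (v * n%:R))%:E * P nu B <= (A * expR (u * n%:R))%:E)%E &
  forall w, ~ B w -> forall t, n%:R * h <= t <= n%:R * h + h ->
    (dist_Mt beta X kappa (G n) th (n%:R * h) t w <= (expR (v * n%:R))%:E)%E].
  move=> n; have [B [mB PB HB]] := doob_continuous alpha0 beta0 sbm kappa (G0 n) (mG n) nu th
    (nh0 n) h0 (expR_ge0 (v * n%:R)).
  exists B; split => //; apply: le_trans PB _; apply: le_trans _ (H n).
  exact: Mt_expectation_blocks.
have mB n : measurable (B n) by have [] := HB n.
have PB n : ((expR (v * n%:R))%:E * P nu (B n) <= (A * expR (u * n%:R))%:E)%E by have [] := HB n.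
apply: filterS (ae_eventually_markov mB uv PB) => w [N HN].
by exists N => n /HN nB; have [_ _] := HB n; apply.
Qed.

End BlockEstimates.

(** * Geometric telescoping and a countable Cauchy criterion *)

Section Limits.
Context {R : realType}.

Lemma telescope_geometric (D : nat -> nat -> \bar R) (r : R) N : 0 <= r < 1 ->
  (forall n, D n n = 0%E) -> (forall n m, (D n m.+1 <= D n m + D m m.+1)%E) ->
  (forall n, (N <= n)%N -> (D n n.+1 <= (r ^+ n)%:E)%E) ->
  forall n m, (N <= n)%N -> (n <= m)%N -> (D n m <= (r ^+ n / (1 - r))%:E)%E.
Proof.
move=> /andP[r0 r1] D0 DT DN n m Nn.
have r1' : 0 < 1 - r by rewrite subr_gt0.
(* The partial geometric sum is the bound that passes through the induction. *)
suff H : (n <= m)%N -> (D n m <= ((r ^+ n - r ^+ m) / (1 - r))%:E)%E.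
  move=> nm; apply: le_trans (H nm) _.
  by rewrite lee_fin ler_pM2r ?invr_gt0// gerBl exprn_ge0.
elim: m => [|m IH].
  by rewrite leqn0 => /eqP ->; rewrite D0 subrr mul0r.
rewrite leq_eqVlt => /predU1P[->|]; first by rewrite D0 subrr mul0r.
rewrite ltnS => nm; apply: le_trans (DT n m) _.
apply: le_trans (leeD (IH nm) (DN m (leq_trans Nn nm))) _.
rewrite -EFinD lee_fin le_eqVlt; apply/orP; left; apply/eqP.
by rewrite exprS; field; rewrite gt_eqF.
Qed.

(** Telescoping over the block starts gives r^n / (1 - r); the last, incomplete block adds r^m <=
    r^n <= r^n / (1 - r), whence the factor 2. *)
Lemma block_cauchy (M : R -> R) (h r : R) N : 0 < h -> 0 <= r < 1 ->
  (forall n, (N <= n)%N -> forall t, n%:R * h <= t <= n%:R * h + h -> `|M t - M (n%:R * h)| <= r ^+ n) ->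
  forall n, (N <= n)%N -> forall t, n%:R * h <= t -> `|M t - M (n%:R * h)| <= r ^+ n * (2 / (1 - r)).
Proof.
move=> h0 r01 HM n Nn t nt; have /andP[r0 r1] := r01.
have r1' : 0 < 1 - r by rewrite subr_gt0.
have ht0 : 0 <= t / h by rewrite divr_ge0 ?(ltW h0)//; apply: le_trans nt; rewrite mulr_ge0// ltW.
pose m := Num.truncn (t / h).
have mt : m%:R * h <= t by rewrite -ler_pdivlMr// truncn_le.
have tm : t <= m%:R * h + h.
  by apply: ltW; rewrite -[X in _ + X]mul1r -mulrDl natr1 -ltr_pdivrMr//; exact: truncnS_gt.
have nm : (n <= m)%N by rewrite /m truncn_ge_nat// ler_pdivlMr.
have := @telescope_geometric (fun n m => `|M (m%:R * h) - M (n%:R * h)|%:E) r N r01 _ _ _ n m Nn nm.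
rewrite !lee_fin => H.
have {}H : `|M (m%:R * h) - M (n%:R * h)| <= r ^+ n / (1 - r).
  apply: H => [k|k l|k Nk].
  - by rewrite subrr normr0.
  - by rewrite -EFinD lee_fin [leRHS]addrC; apply: ler_distD.
  - by rewrite lee_fin; apply: HM => //; rewrite -natr1 mulrDl mul1r lerDl ltW//= lexx.
apply: le_trans (ler_distD (M (m%:R * h)) _ _) _.
have := HM m (leq_trans Nn nm) t; rewrite mt tm => /(_ isT) H2.
apply: le_trans (lerD H2 H) _.
rewrite [2 / _]mulrDl mul1r mulrDr lerD2r.
apply: (@le_trans _ _ (r ^+ n)); first by apply: ler_wiXn2l => //; exact: ltW.
by rewrite ler_peMr ?exprn_ge0// invf_ge1// gerBl.
Qed.

(** The Cauchy criterion with countable quantifiers on k and N, from which the convergence set will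
    be seen to be measurable. *)
Lemma cvg_pinftyP (M : R -> R) : cvg (M t @[t --> +oo]) <->
  (forall k : nat, exists N : nat, forall t, N%:R <= t -> `|M t - M N%:R| <= k.+1%:R^-1).
Proof.
split=> [/cvg_ex[l Ml] k|H].
  have k0 : 0 < k.+1%:R^-1 / 2 :> R by rewrite divr_gt0// invr_gt0.
  move/cvgrPdist_le : Ml => /(_ _ k0)[T [_ HT]].
  exists (Num.truncn T).+1 => t Nt.
  have TN : T < (Num.truncn T).+1%:R by exact: truncnS_gt.
  rewrite (splitr k.+1%:R^-1); apply: le_trans (ler_distD l _ _) _.
  by apply: lerD; [rewrite distrC; apply: HT; exact: lt_le_trans TN Nt|exact: HT].
apply/cauchy_cvgP/cauchy_exP => e e0.
have [k _ /(_ k (leqnn k))] := near_infty_natSinv_lt (PosNum e0).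
rewrite /= => ke; have [N HN] := H k.
exists (M N%:R); exists N%:R; split; first exact: num_real.
move=> t Nt; rewrite /= /ball/= distrC; apply: le_lt_trans ke; apply: HN; exact: ltW.
Qed.

End Limits.

(** * Almost sure convergence at almost every frequency *)

Section Convergence.
Context {R : realType} {d : nat} (alpha beta : R).
Context {dO : measure_display} {Omega : measurableType dO}.
Variables (P : MF R d -> probability Omega R) (X : R -> Omega -> MF R d).
Hypotheses (alpha0 : 0 < alpha) (beta0 : 0 < beta).
Hypothesis sbm : super_brownian_motion alpha beta P X.
Variables (nu : MF R d) (th h : R).
Hypothesis h0 : 0 < h.
Implicit Types (lam x : 'rV[R]_d) (t s r c a : R).

Let M := Mt beta X th.

Definition converges : set (Omega * 'rV[R]_d) := [set z | cvg (M z.2 t z.1 @[t --> +oo])].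

Let near_set k N i j : set (Omega * 'rV[R]_d) :=
  [set z | `|M z.2 (N%:R + i%:R / j.+1%:R) z.1 - M z.2 N%:R z.1| <= k.+1%:R^-1].

(* By right continuity, countably many times suffice. *)
Lemma convergesE : converges =
  \bigcap_k \bigcup_N \bigcap_i \bigcap_j near_set k N i j.
Proof.
apply/seteqP; split => [[w lam] /= /cvg_pinftyP H k _|[w lam] H].
  have [N HN] := H k; exists N => // i _ j _; apply: HN.
  by rewrite lerDl divr_ge0.
apply/cvg_pinftyP => k; have [N _ HN] := H k I; exists N => t Nt /=.
have N0 : 0 <= N%:R :> R by [].
have t0 : 0 <= t by exact: le_trans Nt.
have tN0 : 0 <= t - N%:R by rewrite subr_ge0.
pose i (j : nat) := (Num.truncn ((t - N%:R) * j.+1%:R)).+1.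
have C : `|M lam (N%:R + (i j)%:R / j.+1%:R) w - M lam N%:R w| @[j --> \oo] --> `|M lam t w - M lam N%:R w|.
  apply: cvg_norm; apply: cvgB; last exact: cvg_cst.
  apply: (Mt_right_continuous sbm t0) => [j|].
    by rewrite -ltrBlDl ltr_pdivlMr//; exact: truncnS_gt.
  apply: (@squeeze_cvgr _ _ _ _ (fun=> t) (fun j => t + j.+1%:R^-1)); last 2 first.
  - exact: cvg_cst.
  - rewrite -[X in _ --> X]addr0; apply: cvgD; [exact: cvg_cst|exact: cvg_harmonic].
  apply: nearW => j; apply/andP; split.
    by rewrite -lerBlDl ler_pdivlMr//; apply: ltW; exact: truncnS_gt.
  rewrite -lerBrDl ler_pdivrMr// addrAC mulrDl mulVf ?pnatr_eq0// /i -natr1 lerD2r.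
  by rewrite truncn_le// mulr_ge0.
rewrite -(cvg_lim _ C)//; apply: limr_le; first by apply/cvg_ex; eexists; exact: C.
by apply: nearW => j; exact: (HN (i j) I j I).
Qed.

Lemma measurable_M_joint t : 0 <= t ->
  measurable_fun setT (fun z : Omega * 'rV[R]_d => M z.2 t z.1).
Proof. move=> t0; exact: measurable_Mt_joint (sbm_measurable sbm t0). Qed.

Lemma measurable_converges : measurable converges.
Proof.
rewrite convergesE; apply: bigcap_measurable => // k _.
apply: bigcup_measurable => N _; apply: bigcap_measurable => // i _.
apply: bigcap_measurable => // j _.
rewrite -[near_set _ _ _ _]setTI; apply: measurable_fun_le => //.
apply: measurableT_comp => //; by apply: measurable_funB; apply: measurable_M_joint => //; rewrite addr_ge0// divr_ge0.
Qed.

(** [ae_blocks] with a Dirac mass at lam and weight 1. The rate u = (beta / 2 - rho) h is negative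
    exactly because 2 rho > beta; half of it is spent on Borel-Cantelli, and the other half makes
    the path Cauchy. *)
Lemma ae_converges lam : beta < 2 * rho beta lam ->
  {ae P nu, forall w, converges (w, lam)}.
Proof.
move=> hl.
pose u := (beta / 2 - rho beta lam) * h.
have u0 : u < 0 by rewrite /u pmulr_llt0// subr_lt0 ltr_pdivrMr// mulrC.
pose v := u / 2.
have v0 : v < 0 by rewrite /v pmulr_llt0 // invr_gt0.
have uv : u < v by rewrite /v ltr_pdivlMr// mulrDr mulr1 gtrDl.
have := @ae_blocks R d alpha beta dO Omega P X alpha0 beta0 sbm nu th h h0 (\d_lam) (fun=> fun=> 1)
  (increment_const alpha beta nu h * expR (- (rho beta lam * h))) u v.
move=> /(_ _ _ uv) H.
have {}H := H (fun=> fun=> ler01) (fun=> measurable_cst _).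
apply: filterS (H _) => [w [N HN]|n]; last first.
  rewrite integral_dirac//; last first.
    apply/measurable_EFinP; do 2 apply: measurable_funM => //.
    apply: measurableT_comp => //; apply: measurableT_comp => //; apply: measurable_funM => //.
    exact: measurable_rho.
  rewrite diracT mul1e lee_fin mul1r.
  rewrite -!mulrA mulrCA ler_wpM2l ?increment_const_ge0//.
  rewrite -!expRD le_eqVlt; apply/orP; left; apply/eqP; congr expR; rewrite /u; ring.
rewrite /converges/=; apply/cvg_pinftyP => k.
have r01 : 0 <= expR v < 1 by rewrite expR_ge0 expR_lt1.
have BC := @block_cauchy R (fun t => M lam t w) h (expR v) N h0 r01.
have {}BC : forall n, (N <= n)%N -> forall t, n%:R * h <= t ->
    `|M lam t w - M lam (n%:R * h) w| <= expR v ^+ n * (2 / (1 - expR v)).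
  apply: BC => n Nn t nt; have := HN n Nn t nt.
  rewrite /dist_Mt integral_dirac//; last first.
    apply/measurable_EFinP; apply: measurable_funM => //; apply: measurableT_comp => //.
    by apply: measurable_funB; exact: measurable_Mt_lam.
  by rewrite diracT mul1e lee_fin mul1r -expRM_natl [n%:R * v]mulrC.
have C : expR v ^+ n * (2 / (1 - expR v)) @[n --> \oo] --> 0.
  rewrite -(mul0r (2 / (1 - expR v))); apply: cvgM; last exact: cvg_cst.
  by apply: cvg_expr; rewrite ger0_norm ?expR_ge0// expR_lt1.
have k0 : 0 < k.+1%:R^-1 / 2 :> R by rewrite divr_gt0// invr_gt0.
move/cvgrPdist_le : C => /(_ _ k0)[n1 _ Hn1].
pose n := maxn N n1.
have Nn : (N <= n)%N by rewrite leq_maxl.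
have := Hn1 n (leq_maxr _ _); rewrite /= sub0r normrN => small.
have {}small := le_trans (ler_norm _) small.
exists (Num.truncn (n%:R * h)).+1 => t Nt.
have nN : n%:R * h <= (Num.truncn (n%:R * h)).+1%:R by apply: ltW; exact: truncnS_gt.
rewrite (splitr k.+1%:R^-1); apply: le_trans (ler_distD (M lam (n%:R * h) w) _ _) _.
apply: lerD; first exact: le_trans (BC n Nn t (le_trans nN Nt)) small.
by rewrite distrC; exact: le_trans (BC n Nn _ nN) small.
Qed.

(** The null event of [ae_converges] depends on lam. The set [bad] is jointly measurable and null
    for the product measure, so Tonelli's theorem exchanges the two almost-everywhere
    quantifiers. *)
Lemma ae_ae_converges : {ae P nu, forall w, {ae lebesgue_rV d,
  forall lam, beta < 2 * rho beta lam -> converges (w, lam)}}.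
Proof.
pose bad := ~` converges `&` ~` [set z | 2 * rho beta z.2 <= beta].
have mrho : measurable_fun setT (fun z : Omega * 'rV[R]_d => 2 * rho beta z.2).
  by apply: measurable_funM => //; exact: measurableT_comp (measurable_rho _) measurable_snd.
have mbad : measurable bad.
  apply: measurableI; first by apply: measurableC; exact: measurable_converges.
  by apply: measurableC; rewrite -[[set _ | _]]setTI; exact: measurable_fun_le.
have F := fubini_tonelli (m1 := P nu) (m2 := @leb_rV R d) (fun z => (\1_bad z)%:E).
have {}F := F _ _.
have mI : measurable_fun setT (fun z => (\1_bad z)%:E : \bar R).
  by apply/measurable_EFinP; exact: measurable_indic.
have I0 : forall z, (0 <= (\1_bad z)%:E :> \bar R)%E by move=> z; rewrite lee_fin.
have {}F := F mI I0.
have Z : (\int[@leb_rV R d]_lam \int[P nu]_w (\1_bad (w, lam))%:E = 0)%E.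
  apply: integral0_eq => lam _.
  have [hl|hl] := ltP beta (2 * rho beta lam); last first.
    apply: integral0_eq => w _; rewrite indicE memNset// => -[_ /=]; exact.
  have mb : measurable_fun setT (fun w => (\1_bad (w, lam))%:E : \bar R).
    exact: measurableT_comp mI (pair2_measurable lam).
  rewrite -(integral0 (P nu) setT); apply: ae_eq_integral => //.
  apply: filterS (ae_converges hl) => w cw _ /=.
  by rewrite indicE memNset// => -[nc _]; exact: nc.
have mJ : measurable_fun setT (fun w => \int[@leb_rV R d]_lam (\1_bad (w, lam))%:E)%E.
  exact: (measurable_fun_fubini_tonelli_F (m2 := @leb_rV R d) _ mI I0).
have J0 w : (0 <= \int[@leb_rV R d]_lam (\1_bad (w, lam))%:E)%E by exact: integral_ge0.
have /(ae_eq_integral_abs (P nu) measurableT mJ) : (\int[P nu]_w `|\int[@leb_rV R d]_lam (\1_bad (w, lam))%:E| = 0)%E.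
  by under eq_integral do rewrite gee0_abs//; rewrite F.
apply: filterS => w /(_ I) /= Jw.
have mw : measurable_fun setT (fun lam => (\1_bad (w, lam))%:E : \bar R).
  exact: measurableT_comp mI (pair1_measurable w).
have /(ae_eq_integral_abs (@leb_rV R d) measurableT mw) : (\int[@leb_rV R d]_lam `|(\1_bad (w, lam))%:E| = 0)%E.
  by under eq_integral do rewrite gee0_abs//.
apply: filterS => lam /(_ I) /= => [[]] h1 hl; apply: contrapT => nc.
move: h1; rewrite indicE mem_set; first by move=> /eqP; rewrite oner_eq0.
by split => //=; apply/negP; rewrite -ltNge.
Qed.

End Convergence.

(** * Almost sure bounds on oscillation, low and high frequencies *)

Section SpectralBounds.
Context {R : realType} {d : nat} (alpha beta : R).
Context {dO : measure_display} {Omega : measurableType dO}.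
Variables (P : MF R d -> probability Omega R) (X : R -> Omega -> MF R d).
Hypotheses (alpha0 : 0 < alpha) (beta0 : 0 < beta).
Hypothesis sbm : super_brownian_motion alpha beta P X.
Variables (nu : MF R d) (th h : R).
Hypothesis h0 : 0 < h.
Variables (F : 'rV[R]_d -> R) (I : R).
Hypotheses (F0 : forall lam, 0 <= F lam) (mF : measurable_fun setT F)
  (IF : (\int[lebesgue_rV d]_lam (expR (- (rho beta lam * h)) * F lam)%:E <= I%:E)%E).
Variable eps : R.
Hypothesis eps_range : 0 < eps < beta / 2.
Implicit Types (lam x : 'rV[R]_d) (t s r c a : R).

Let leb := @leb_rV R d.

(** The set D. As 2 rho - beta = beta - |lambda|^2, it is the ball |lambda|^2 <= beta - eps. *)
Definition low : set 'rV[R]_d := [set lam | eps <= 2 * rho beta lam - beta].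

(** A rate above those of all three errors: beta / 2 for the oscillation, (beta + eps) / 2 outside
    D, and beta - eps / 4 for the tail on D multiplied by e^(beta t). The first two lie below it
    because eps < beta / 2. *)
Definition growth := beta - eps / 8.

Lemma measurable_low : measurable low.
Proof.
rewrite -[low]setTI; apply: measurable_fun_le => //; apply: measurable_funB => //.
by apply: measurable_funM => //; exact: measurable_rho.
Qed.

(** Since rho <= beta, the weight e^(-rho h) is at least e^(-beta h), so F itself is integrable. *)
Lemma F_mass_le : (\int[leb]_lam (F lam)%:E <= (expR (beta * h) * I)%:E)%E.
Proof.
rewrite EFinM; apply: (@le_trans _ _ ((expR (beta * h))%:E *
  \int[leb]_lam (expR (- (rho beta lam * h)) * F lam)%:E)%E); last first.
  by rewrite lee_wpmul2l// lee_fin expR_ge0.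
rewrite -ge0_integralZl_EFin ?expR_ge0//.
- apply: ge0_le_integral_nomeas => lam _; first by rewrite lee_fin.
  rewrite -EFinM lee_fin mulrA -expRD.
  by rewrite ler_peMl// -expR0 ler_expR -mulrBl mulr_ge0 ?(ltW h0)// subr_ge0 rho_le.
- by move=> lam _; rewrite lee_fin mulr_ge0 ?expR_ge0.
- apply/measurable_EFinP; apply: measurable_funM => //.
  do 2 apply: measurableT_comp => //; apply: measurable_funM => //; exact: measurable_rho.
Qed.

(** The increment over a block carries e^(-rho (n h + h)). The weight [q] has to compensate the part
    at n h; the factor e^(-rho h) that is left over is integrated by [IF]. *)
Lemma ae_blocks_F (q : nat -> 'rV[R]_d -> R) (c u v : R) : 0 <= c -> u < v ->
  (forall n, measurable_fun setT (q n)) -> (forall n lam, 0 <= q n lam) ->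
  (forall n lam, expR (beta * (n%:R * h) / 2) * (q n lam * expR (- (rho beta lam * (n%:R * h + h))))
     <= c * expR (u * n%:R) * expR (- (rho beta lam * h))) ->
  {ae P nu, forall w, exists N, forall n, (N <= n)%N -> forall t, n%:R * h <= t <= n%:R * h + h ->
    (dist_Mt beta X leb (fun lam => F lam * q n lam)%R th (n%:R * h) t w <= (expR (v * n%:R))%:E)%E}.
Proof.
move=> c0 uv mq q0 H; have C0 := increment_const_ge0 beta alpha0 nu h0.
refine (@ae_blocks _ _ _ _ _ _ P X alpha0 beta0 sbm nu th h h0 (@leb_rV R d)
  (fun n lam => F lam * q n lam) (increment_const alpha beta nu h * c * I) u v _ _ uv _).
- by move=> n lam; rewrite mulr_ge0.
- by move=> n; exact: measurable_funM.
move=> n; rewrite (_ : (_ * _ * I * _)%R = (increment_const alpha beta nu h * c * expR (u * n%:R)) * I); last by ring.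
rewrite EFinM; apply: le_trans (lee_wpmul2l _ IF); last by rewrite lee_fin !mulr_ge0 ?expR_ge0.
rewrite -ge0_integralZl_EFin ?mulr_ge0 ?expR_ge0//.
- apply: ge0_le_integral_nomeas => lam _.
    by rewrite lee_fin !mulr_ge0 ?expR_ge0.
  rewrite -EFinM lee_fin.
  have := ler_wpM2l (mulr_ge0 C0 (F0 lam)) (H n lam).
  set a := expR _; set b := expR _; set e := expR _; set g := expR _ => K.
  apply: le_trans (le_trans _ K) _; rewrite le_eqVlt; apply/orP; left; apply/eqP; ring.
- by move=> lam _; rewrite lee_fin mulr_ge0 ?expR_ge0.
- apply/measurable_EFinP; apply: measurable_funM => //.
  do 2 apply: measurableT_comp => //; apply: measurable_funM => //; exact: measurable_rho.
Qed.

(** The weight e^(rho n h) cancels the part of the increment that depends on both n and lam, which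
    leaves e^(beta n h / 2) at every frequency. *)
Lemma ae_oscillation : {ae P nu, forall w, exists N, forall n, (N <= n)%N ->
  forall t, n%:R * h <= t <= n%:R * h + h ->
  (dist_Mt beta X leb (fun lam => F lam * expR (rho beta lam * (n%:R * h)))%R th (n%:R * h) t w
    <= (expR (growth * h * n%:R))%:E)%E}.
Proof.
apply: (@ae_blocks_F _ 1 (beta / 2 * h)) => //.
- rewrite ltr_pM2r// /growth; move: eps_range => /andP[]; lra.
- move=> n; apply: measurableT_comp => //; apply: measurable_funM => //; exact: measurable_rho.
- move=> n lam; rewrite mul1r -!expRD le_eqVlt; apply/orP; left; apply/eqP; congr expR; ring.
Qed.

(** On D one has beta / 2 - rho <= -eps / 2; half of this rate is given up to Borel-Cantelli. *)
Lemma ae_low_increments : {ae P nu, forall w, exists N, forall n, (N <= n)%N ->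
  forall t, n%:R * h <= t <= n%:R * h + h ->
  (dist_Mt beta X leb (fun lam => F lam * \1_low lam)%R th (n%:R * h) t w
    <= (expR (- (eps / 4 * h) * n%:R))%:E)%E}.
Proof.
apply: (@ae_blocks_F _ 1 (- (eps / 2 * h))) => //.
- rewrite ltrN2 ltr_pM2r//; move: eps_range => /andP[]; lra.
- by move=> n; exact: measurable_indic measurable_low.
- move=> n lam; rewrite mul1r indicE; have [hl|hl] := pselect (low lam); last first.
    by rewrite memNset// mul0r mulr0 mulr_ge0 ?expR_ge0.
  rewrite mem_set//; move: hl; rewrite /low/= => hl; rewrite mul1r -!expRD ler_expR.
  rewrite [leLHS](_ : _ = (beta / 2 - rho beta lam) * (n%:R * h) - rho beta lam * h); last by ring.
  rewrite lerD2r (_ : - (eps / 2 * h) * n%:R = - (eps / 2) * (n%:R * h)); last by ring.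
  by apply: ler_wpM2r; [rewrite mulr_ge0// ltW|lra].
Qed.

(** Outside D, 2 rho <= 2 g, so the mean is O(e^(g r)) and [b2] is at most r e^(2 g r). The weight
    e^(g r) in [wint_abs_moment] balances the terms, and the linear factor r is absorbed by 1 + k r
    <= e^(k r). *)
Lemma wint_moment_high r lam g k : 0 <= r -> 0 < k -> ~ low lam -> g = (beta + eps) / 2 ->
  (\int[P nu]_w `|wint th lam (X r w)|%:E <=
    ((mass nu + 2^-1 + alpha * mass nu) * (1 + k^-1) * expR ((g + k) * r))%:E)%E.
Proof.
move=> r0 k0 nl gE; have m0 := mass_ge0 nu.
have [e0 eb] : 0 < eps /\ eps < beta / 2 by move/andP: eps_range.
have hl : 2 * rho beta lam <= beta + eps.
  by rewrite leNgt; apply/negP => hl; apply: nl; rewrite /low/=; lra.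
have H := wint_abs_moment alpha0 beta0 sbm nu th lam (expR_gt0 (g * r)) r0.
have mI : measurable_fun setT (fun w => `|wint th lam (X r w) - expR (rho beta lam * r) * wint th lam nu|%:E).
  apply/measurable_EFinP; apply: measurableT_comp => //; apply: measurable_funB => //.
  exact: (measurable_wint_X sbm).
apply: (@le_trans _ _ (\int[P nu]_w (`|wint th lam (X r w) - expR (rho beta lam * r) * wint th lam nu|%:E +
   (expR (g * r) * mass nu)%:E))%E).
  apply: ge0_le_integral_nomeas => w _; first by rewrite lee_fin.
  rewrite -EFinD lee_fin.
  apply: le_trans (_ : _ <= `|wint th lam (X r w) - expR (rho beta lam * r) * wint th lam nu| +
     `|expR (rho beta lam * r) * wint th lam nu|) _.
    by rewrite -{1}(subrK (expR (rho beta lam * r) * wint th lam nu) (wint th lam (X r w))) ler_normD.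
  rewrite lerD2l normrM ger0_norm ?expR_ge0//; apply: ler_pM; rewrite ?expR_ge0//.
    by rewrite ler_expR ler_wpM2r// gE; lra.
  exact: wint_le.
rewrite ge0_integralD//; last by move=> w _; rewrite lee_fin mulr_ge0// expR_ge0.
rewrite [X in (_ + X <= _)%E](_ : _ = (expR (g * r) * mass nu)%:E); last first.
  by rewrite integral_cst//= probability_setT mule1.
apply: le_trans (leeD2r _ H) _; rewrite -EFinD lee_fin.
have be : beta <= beta + eps by rewrite lerDl ltW.
have /andP[_ hb] := b2_le r0 be hl.
have {hb} : b2 beta lam r <= r * (expR (g * r) * expR (g * r)).
  apply: le_trans hb _; rewrite -expRD le_eqVlt; apply/orP; left; apply/eqP; congr (_ * expR _).
  by rewrite gE; field.
move=> hb.
apply: (@le_trans _ _ (expR (g * r) * (mass nu + 2^-1 + alpha * mass nu * r))).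
  have hb' := ler_wpM2l (mulr_ge0 (ltW alpha0) m0) hb.
  have E := expR_gt0 (g * r); move: E hb'; move: (expR _) (b2 _ _ _) => y b E hb'.
  rewrite (_ : _ + _ * mass nu = y / 2 + y * mass nu + y^-1 * (alpha * mass nu * b)); last by field; rewrite gt_eqF.
  rewrite [leRHS](_ : _ = y / 2 + y * mass nu + y^-1 * (alpha * mass nu * (r * (y * y)))); last by field; rewrite gt_eqF.
  by rewrite lerD2l ler_wpM2l// invr_ge0 ltW.
rewrite (_ : (g + k) * r = g * r + k * r); last by ring.
rewrite expRD [leRHS]mulrCA ler_wpM2l ?expR_ge0// [leRHS]mulrC.
have kr := expR_ge1Dx (k * r).
have kr0 : 0 <= k * r by rewrite mulr_ge0// ltW.
apply: (@le_trans _ _ ((1 + k * r) * ((mass nu + 2^-1 + alpha * mass nu) * (1 + k^-1)))); last first.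
  rewrite ler_wpM2r// mulr_ge0// ?addr_ge0 ?invr_ge0 ?mulr_ge0// ?(ltW k0)// ltW//.
have am : 0 <= alpha * mass nu by rewrite mulr_ge0// ltW.
have -> : (1 + k * r) * ((mass nu + 2^-1 + alpha * mass nu) * (1 + k^-1)) =
  (mass nu + 2^-1 + alpha * mass nu * r) + (alpha * mass nu * (1 + k^-1 + k * r) + (mass nu + 2^-1) * (k^-1 + k * r + r)).
  by field; rewrite gt_eqF.
have k0' : 0 <= k^-1 by rewrite invr_ge0 ltW.
by rewrite lerDl; apply: addr_ge0; apply: mulr_ge0 => //; rewrite !addr_ge0// invr_ge0.
Qed.

Lemma ae_high : {ae P nu, forall w, exists N, forall n, (N <= n)%N ->
  (\int[leb]_lam (F lam * \1_(~` low) lam * `|wint th lam (X (n%:R * h) w)|)%:E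
    <= (expR (growth * h * n%:R))%:E)%E}.
Proof.
have [e0 eb] : 0 < eps /\ eps < beta / 2 by move/andP: eps_range.
(* Half of the gap between [g] and [growth] absorbs the linear factor in time; the other half is
   left for Borel-Cantelli. *)
pose g := (beta + eps) / 2; pose k := (growth - g) / 2.
have k0 : 0 < k by rewrite /k /growth /g; lra.
pose K := (mass nu + 2^-1 + alpha * mass nu) * (1 + k^-1).
have K0 : 0 <= K.
  have m0 := mass_ge0 nu; have am : 0 <= alpha * mass nu by rewrite mulr_ge0// ltW.
  by rewrite /K mulr_ge0// !addr_ge0// ?invr_ge0// ltW.
have nh0 n : 0 <= n%:R * h by rewrite mulr_ge0// ltW.
have mJ n : measurable_fun setT (fun z : Omega * 'rV[R]_d => (F z.2 * \1_(~` low) z.2 * `|wint th z.2 (X (n%:R * h) z.1)|)%:E).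
  apply/measurable_EFinP; apply: measurable_funM.
    apply: measurable_funM; first exact: measurableT_comp mF measurable_snd.
    exact: measurableT_comp (measurable_indic (measurableC measurable_low)) measurable_snd.
  apply: measurableT_comp => //.
  apply: (@measurableT_comp _ _ _ _ _ _ (fun z : MF R d * 'rV[R]_d => wint th z.2 z.1) _
    (fun z : Omega * 'rV[R]_d => (X (n%:R * h) z.1, z.2))); first exact: measurable_wint_joint.
  apply/measurable_fun_pair; last exact: measurable_snd.
  exact: measurableT_comp (sbm_measurable sbm (nh0 n)) measurable_fst.
have J0 n z : (0 <= (F z.2 * \1_(~` low) z.2 * `|wint th z.2 (X (n%:R * h) z.1)|)%:E)%E.
  by rewrite lee_fin !mulr_ge0.
apply: (@ae_eventually_le _ _ _ (P nu) (fun n w => \int[leb]_lam (F lam * \1_(~` low) lam * `|wint th lam (X (n%:R * h) w)|)%:E)%E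
   (K * (expR (beta * h) * I)) ((g + k) * h) (growth * h)).
- by move=> n; exact: (measurable_fun_fubini_tonelli_F (m2 := leb) _ (mJ n) (J0 n)).
- by move=> n w; apply: integral_ge0 => lam _; exact: (J0 n (w, lam)).
- by rewrite ltr_pM2r// /k; move: k0; rewrite /k; lra.
move=> n; rewrite (@tonelli_restrict _ _ _ _ _ (P nu) leb
    (fun z => (F z.2 * \1_(~` low) z.2 * `|wint th z.2 (X (n%:R * h) z.1)|)%:E))//=.
apply: (@le_trans _ _ (\int[leb]_lam ((K * expR ((g + k) * h * n%:R))%:E * (F lam)%:E))%E).
  apply: ge0_le_integral_nomeas => lam _; first by apply: integral_ge0 => w _; exact: (J0 n (w, lam)).
  under eq_integral do rewrite EFinM.
  rewrite ge0_integralZl_EFin ?mulr_ge0//; last first.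
    by apply/measurable_EFinP; apply: measurableT_comp => //; exact: (measurable_wint_X sbm).
  rewrite indicE; have [nl|nl] := pselect ((~` low) lam); last first.
    by rewrite memNset// mulr0 mul0e mule_ge0// lee_fin// mulr_ge0// expR_ge0.
  rewrite mem_set// mulr1 muleC lee_wpmul2r ?lee_fin//.
  apply: le_trans (wint_moment_high (nh0 n) k0 nl erefl) _.
  by rewrite lee_fin -/K -/g le_eqVlt; apply/orP; left; apply/eqP; congr (_ * expR _); ring.
rewrite ge0_integralZl_EFin//.
- rewrite [leRHS](_ : _ = ((K * expR ((g + k) * h * n%:R))%:E * (expR (beta * h) * I)%:E)%E).
    by apply: lee_wpmul2l; [rewrite lee_fin mulr_ge0 ?expR_ge0//|exact: F_mass_le].
  by rewrite -EFinM; congr EFin; ring.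
- by move=> lam _; rewrite lee_fin.
- exact/measurable_EFinP.
- by rewrite mulr_ge0 ?expR_ge0.
Qed.

End SpectralBounds.

Lemma fatou_le_cst_ae dT (T : measurableType dT) (R : realType) (mu : {measure set T -> \bar R})
  (g : nat -> T -> R) (k : T -> R) (a : \bar R) :
  (forall n, measurable_fun setT (g n)) -> (forall n x, 0 <= g n x) -> measurable_fun setT k ->
  {ae mu, forall x, g n x @[n --> \oo] --> k x} ->
  (forall n, \int[mu]_x (g n x)%:E <= a)%E -> (\int[mu]_x (k x)%:E <= a)%E.
Proof.
move=> mg g0 mk [B [mB B0 HB]] ga.
have mB' := measurable_indic (measurableC mB).
have -> : (\int[mu]_x (k x)%:E = \int[mu]_x (k x * \1_(~` B) x)%:E)%E.
  apply: ae_eq_integral => //.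
  - exact/measurable_EFinP.
  - by apply/measurable_EFinP; exact: measurable_funM.
  - exists B; split => // x /= H; apply: contrapT => nB; apply: H => _.
    by rewrite indicE mem_set// mulr1.
apply: (@fatou_le_cst _ _ _ mu (fun n x => g n x * \1_(~` B) x)) => [n|n x|x|n].
- exact: measurable_funM.
- by rewrite mulr_ge0.
- have [Bx|nB] := pselect (B x).
    rewrite indicE memNset; last by move=> /(_ Bx).
    rewrite mulr0 [X in X @ _ --> _](_ : _ = fun=> 0); first exact: cvg_cst.
    by apply/funext => n; rewrite mulr0.
  apply: cvgM; last exact: cvg_cst.
  by apply: contrapT => nc; apply: nB; apply: HB.
- apply: le_trans (ga n); apply: ge0_le_integral_nomeas => x _.
    by rewrite lee_fin mulr_ge0.
  rewrite lee_fin ler_piMr// indicE; by case: (_ \in _).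
Qed.

(** * Deterministic estimates along a fixed path *)

Section Pathwise.
Context {R : realType} {d : nat} (beta : R).
Context {dO : measure_display} {Omega : measurableType dO}.
Variables (X : R -> Omega -> MF R d) (w : Omega).
Variables (th h : R) (F W : 'rV[R]_d -> R) (I : R) (eps : R) (N : nat).
Hypotheses (beta0 : 0 < beta) (h0 : 0 < h).
Hypotheses (F0 : forall lam, 0 <= F lam) (mF : measurable_fun setT F)
  (IF : (\int[lebesgue_rV d]_lam (F lam)%:E <= I%:E)%E).
Hypothesis eps_range : 0 < eps < beta / 2.
Implicit Types (lam x : 'rV[R]_d) (t s r c a : R).

Let m t lam := Mt beta X th lam t w.
Let leb := @leb_rV R d.
Let low := @low R d beta eps.
Let gr := growth beta eps.
Let r := expR (- (eps / 4 * h)).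

Hypotheses (mW : measurable_fun setT W)
  (cW : {ae lebesgue_rV d, forall lam, low lam -> m t lam @[t --> +oo] --> W lam}).
Hypothesis osc : forall n, (N <= n)%N -> forall t, n%:R * h <= t <= n%:R * h + h ->
  (dist_Mt beta X leb (fun lam => F lam * expR (rho beta lam * (n%:R * h)))%R th (n%:R * h) t w
    <= (expR (gr * h * n%:R))%:E)%E.
Hypothesis incr : forall n, (N <= n)%N -> forall t, n%:R * h <= t <= n%:R * h + h ->
  (dist_Mt beta X leb (fun lam => F lam * \1_low lam)%R th (n%:R * h) t w
    <= (expR (- (eps / 4 * h) * n%:R))%:E)%E.
Hypothesis high : forall n, (N <= n)%N ->
  (\int[leb]_lam (F lam * \1_(~` low) lam * `|wint th lam (X (n%:R * h) w)|)%:E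
    <= (expR (gr * h * n%:R))%:E)%E.

Let mlow : measurable low. Proof. exact: measurable_low. Qed.

Let mm t : measurable_fun setT (m t). Proof. exact: measurable_Mt_lam. Qed.

Lemma r_range : 0 <= r < 1.
Proof.
by rewrite /r expR_ge0 expR_lt1 oppr_lt0 mulr_gt0// divr_gt0//; case/andP: eps_range.
Qed.

(** The block increments telescope in the weighted L^1 norm on D, and Fatou's lemma along the block
    starts transfers the bound to the limit W. *)
Lemma low_tail n : (N <= n)%N ->
  (\int[leb]_lam (F lam * \1_low lam * `|W lam - m (n%:R * h) lam|)%:E <= (r ^+ n / (1 - r))%:E)%E.
Proof.
move=> Nn; pose D n k : \bar R := dist_Mt beta X leb (fun lam => F lam * \1_low lam)%R th (n%:R * h) (k%:R * h) w.
have T : forall n k, (N <= n)%N -> (n <= k)%N -> (D n k <= (r ^+ n / (1 - r))%:E)%E.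
  apply: (@telescope_geometric R D r N r_range) => [k|k l|k Nk].
  - by apply: integral0_eq => lam _; rewrite subrr normr0 mulr0.
  - rewrite /D /dist_Mt -ge0_integralD//.
    + apply: ge0_le_integral_nomeas => lam _; first by rewrite lee_fin !mulr_ge0.
      by rewrite -EFinD lee_fin -mulrDr ler_wpM2l ?mulr_ge0// [leRHS]addrC ler_distD.
    + by move=> lam _; rewrite lee_fin !mulr_ge0.
    + apply/measurable_EFinP; apply: measurable_funM; first by apply: measurable_funM => //; exact: measurable_indic.
      by apply: measurableT_comp => //; apply: measurable_funB; exact: mm.
    + by move=> lam _; rewrite lee_fin !mulr_ge0.
    + apply/measurable_EFinP; apply: measurable_funM; first by apply: measurable_funM => //; exact: measurable_indic.
      by apply: measurableT_comp => //; apply: measurable_funB; exact: mm.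
  - rewrite /D; have := incr Nk (t := k.+1%:R * h).
    rewrite -natr1 mulrDl mul1r lexx lerDl (ltW h0) => /(_ isT) H; apply: le_trans H _.
    by rewrite lee_fin /r -expRM_natl [k%:R * _]mulrC.
apply: (@fatou_le_cst_ae _ _ _ leb (fun k lam => F lam * \1_low lam * `|m ((n + k)%:R * h) lam - m (n%:R * h) lam|)).
- move=> k; apply: measurable_funM; first by apply: measurable_funM => //; exact: measurable_indic.
  by apply: measurableT_comp => //; apply: measurable_funB; exact: mm.
- by move=> k lam; rewrite !mulr_ge0.
- apply: measurable_funM; first by apply: measurable_funM => //; exact: measurable_indic.
  by apply: measurableT_comp => //; apply: measurable_funB => //; exact: mm.
- apply: filterS cW => lam cl.
  have [ll|nl] := pselect (low lam); last first.
    rewrite indicE memNset// mulr0 mul0r.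
    rewrite [X in X @ _ --> _](_ : _ = fun=> 0); first exact: cvg_cst.
    by apply/funext => k; rewrite mul0r.
  apply: cvgM; first exact: cvg_cst.
  apply: cvg_norm; apply: cvgB; last exact: cvg_cst.
  apply: (@cvg_comp _ _ _ (fun k => (n + k)%:R * h) (fun t => m t lam) _ (pinfty_nbhs R)); last exact: cl.
  apply/cvgryPge => A; exists (Num.truncn (A / h)).+1 => //= k.
  move=> kA; rewrite -ler_pdivrMr//; apply: le_trans (ltW (truncnS_gt _)) _.
  by rewrite ler_nat; apply: leq_trans kA (leq_addl _ _).
- by move=> k; apply: T => //; exact: leq_addr.
Qed.

(** Dominates the integrand of the error once |g| <= F: the distance of M_t to its limit on D, and
    M_t alone outside D, where the spectral integral has no term. *)
Definition remainder t lam :=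
  F lam * (\1_low lam * `|expR (rho beta lam * t) * (m t lam - W lam)| +
           \1_(~` low) lam * `|expR (rho beta lam * t) * m t lam|).

(** M_t is compared with M_(n h), and then with W on D or with nothing outside D. Outside D, rho may
    be very negative; so rho <= beta is applied only to t - n h, which lies in [0, h], and e^(rho n
    h) is kept. *)
Lemma remainder_le n t lam : n%:R * h <= t <= n%:R * h + h ->
  remainder t lam <= expR (beta * h) * (F lam * expR (rho beta lam * (n%:R * h)) * `|m t lam - m (n%:R * h) lam|)
    + expR (beta * t) * (F lam * \1_low lam * `|W lam - m (n%:R * h) lam|)
    + expR (beta * h) * (F lam * \1_(~` low) lam * `|wint th lam (X (n%:R * h) w)|).
Proof.
move=> /andP[nt tn]; have nh0 : 0 <= n%:R * h by rewrite mulr_ge0// ltW.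
have t0 := le_trans nh0 nt.
have rb := rho_le beta lam.
have e1 : expR (rho beta lam * t) <= expR (beta * t) by rewrite ler_expR ler_wpM2r.
have e2 : expR (rho beta lam * t) <= expR (beta * h) * expR (rho beta lam * (n%:R * h)).
  rewrite -expRD ler_expR.
  rewrite (_ : rho beta lam * t = rho beta lam * (t - n%:R * h) + rho beta lam * (n%:R * h)); last by ring.
  rewrite lerD2r; apply: (@le_trans _ _ (beta * (t - n%:R * h))).
    by rewrite ler_wpM2r// subr_ge0.
  by rewrite ler_wpM2l ?(ltW beta0)// lerBlDl.
have wE : `|wint th lam (X (n%:R * h) w)| = expR (rho beta lam * (n%:R * h)) * `|m (n%:R * h) lam|.
  rewrite /m /Mt normrM ger0_norm ?expR_ge0// [RHS]mulrA -expRD.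
  by rewrite [X in expR X](_ : _ = 0) ?expR0 ?mul1r//; ring.
rewrite wE /remainder; move: (expR_ge0 (rho beta lam * t)) e1 e2.
move: (expR (rho beta lam * t)) (expR (beta * t)) (expR (beta * h)) (expR (rho beta lam * (n%:R * h))) => a b c e a0 e1 e2.
have F0' := F0 lam.
have nE y : `|a * y| = a * `|y| by rewrite normrM (ger0_norm a0).
rewrite !nE.
have [ll|nl] := pselect (low lam).
  rewrite !indicE mem_set// memNset; last by [].
  rewrite !mul1r !mul0r !addr0 !mulr1 mulr0 !mul0r mulr0 addr0.
  have H : a * `|m t lam - W lam| <= c * e * `|m t lam - m (n%:R * h) lam| + b * `|W lam - m (n%:R * h) lam|.
    apply: (@le_trans _ _ (a * `|m t lam - m (n%:R * h) lam| + a * `|W lam - m (n%:R * h) lam|)).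
      by rewrite -mulrDr ler_wpM2l// [X in _ <= _ + X]distrC ler_distD.
    by apply: lerD; apply: ler_wpM2r.
  have := ler_wpM2l F0' H; rewrite mulrDr => H'; apply: le_trans H' _.
  by rewrite le_eqVlt; apply/orP; left; apply/eqP; ring.
rewrite !indicE memNset// mem_set//.
rewrite !mul1r !mul0r !add0r !mulr0 !mul0r !mulr1 mulr0 addr0.
have H : a * `|m t lam| <= c * e * `|m t lam - m (n%:R * h) lam| + c * e * `|m (n%:R * h) lam|.
  apply: (@le_trans _ _ (a * `|m t lam - m (n%:R * h) lam| + a * `|m (n%:R * h) lam|)).
    rewrite -mulrDr ler_wpM2l//.
    by rewrite -{1}(subrK (m (n%:R * h) lam) (m t lam)) ler_normD.
  by apply: lerD; apply: ler_wpM2r.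
have := ler_wpM2l F0' H; rewrite mulrDr => H'; apply: le_trans H' _.
by rewrite le_eqVlt; apply/orP; left; apply/eqP; ring.
Qed.

(** The two e^(beta h) belong to the oscillation and to the high frequencies. The last term belongs
    to the tail on D, where n h >= t - h gives r^n <= e^(eps h / 4) e^(-eps t / 4). *)
Definition remainder_const := 2 * expR (beta * h) + expR (eps / 4 * h) / (1 - r).

Lemma remainder_int t : N%:R * h <= t ->
  (\int[leb]_lam (remainder t lam)%:E <= (remainder_const * expR (gr * t))%:E)%E.
Proof.
move=> Nt; have t0 : 0 <= t by apply: le_trans Nt; rewrite mulr_ge0// ltW.
have [e0 eb] : 0 < eps /\ eps < beta / 2 by move/andP: eps_range.
pose n := Num.truncn (t / h).
have nt : n%:R * h <= t by rewrite -ler_pdivlMr// truncn_le// divr_ge0// ltW.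
have tn : t <= n%:R * h + h.
  apply: ltW; rewrite -[X in _ + X]mul1r -mulrDl natr1 -ltr_pdivrMr//; exact: truncnS_gt.
have Nn : (N <= n)%N by rewrite /n truncn_ge_nat ?divr_ge0 ?(ltW h0)// ler_pdivlMr.
have ntn : n%:R * h <= t <= n%:R * h + h by rewrite nt.
have gr0 : 0 <= gr by rewrite /gr /growth; lra.
have ml := measurable_indic mlow; have mh := measurable_indic (measurableC mlow).
pose A lam := (F lam * expR (rho beta lam * (n%:R * h)) * `|m t lam - m (n%:R * h) lam|).
pose B lam := (F lam * \1_low lam * `|W lam - m (n%:R * h) lam|).
pose C lam := (F lam * \1_(~` low) lam * `|wint th lam (X (n%:R * h) w)|).
have A0 lam : 0 <= A lam by rewrite /A !mulr_ge0 ?expR_ge0.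
have B0 lam : 0 <= B lam by rewrite /B !mulr_ge0.
have C0 lam : 0 <= C lam by rewrite /C !mulr_ge0.
have mA : measurable_fun setT A.
  apply: measurable_funM.
    apply: measurable_funM => //; apply: measurableT_comp => //; apply: measurable_funM => //; exact: measurable_rho.
  by apply: measurableT_comp => //; apply: measurable_funB; exact: mm.
have mB : measurable_fun setT B.
  apply: measurable_funM; first exact: measurable_funM.
  by apply: measurableT_comp => //; apply: measurable_funB => //; exact: mm.
have mC : measurable_fun setT C.
  apply: measurable_funM; first exact: measurable_funM.
  apply: measurableT_comp => //; exact: measurable_wint_lam.
apply: (@le_trans _ _ (\int[leb]_lam ((expR (beta * h))%:E * (A lam)%:E +
   (expR (beta * t))%:E * (B lam)%:E + (expR (beta * h))%:E * (C lam)%:E))%E).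
  apply: ge0_le_integral_nomeas => lam _.
    by rewrite lee_fin /remainder mulr_ge0// addr_ge0// mulr_ge0.
  by rewrite -!EFinM -!EFinD lee_fin remainder_le.
rewrite ge0_integralD//; last 4 first.
- by move=> lam _; rewrite -!EFinM -EFinD lee_fin addr_ge0// mulr_ge0// expR_ge0.
- apply: emeasurable_funD; apply: emeasurable_funM => //; exact/measurable_EFinP.
- by move=> lam _; rewrite -EFinM lee_fin mulr_ge0// expR_ge0.
- apply: emeasurable_funM => //; exact/measurable_EFinP.
rewrite ge0_integralD//; last 4 first.
- by move=> lam _; rewrite -EFinM lee_fin mulr_ge0// expR_ge0.
- apply: emeasurable_funM => //; exact/measurable_EFinP.
- by move=> lam _; rewrite -EFinM lee_fin mulr_ge0// expR_ge0.
- apply: emeasurable_funM => //; exact/measurable_EFinP.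
have Z c (f : 'rV[R]_d -> R) b : 0 <= c -> (forall lam, 0 <= f lam) -> measurable_fun setT f ->
   (\int[leb]_lam (f lam)%:E <= b%:E)%E -> (\int[leb]_lam (c%:E * (f lam)%:E) <= (c * b)%:E)%E.
  move=> c0 f0 mf fb; rewrite ge0_integralZl_EFin//.
  - by rewrite EFinM lee_wpmul2l// lee_fin.
  - by move=> lam _; rewrite lee_fin.
  - exact/measurable_EFinP.
have ZA := Z (expR (beta * h)) A _ (expR_ge0 _) A0 mA (osc Nn ntn).
have ZB := Z (expR (beta * t)) B _ (expR_ge0 _) B0 mB (low_tail Nn).
have ZC := Z (expR (beta * h)) C _ (expR_ge0 _) C0 mC (high Nn).
apply: le_trans (leeD (leeD ZA ZB) ZC) _.
rewrite -!EFinD lee_fin /remainder_const.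
have g1 : expR (gr * h * n%:R) <= expR (gr * t).
  by rewrite ler_expR -mulrA ler_wpM2l// mulrC.
have g2 : expR (beta * t) * r ^+ n <= expR (eps / 4 * h) * expR (gr * t).
  rewrite /r -expRM_natl -!expRD ler_expR /gr /growth.
  have : eps / 4 * t <= eps / 4 * (n%:R * h + h) by rewrite ler_wpM2l// divr_ge0// ltW.
  have : 0 <= eps / 8 * t by rewrite mulr_ge0// divr_ge0// ltW.
  move: (n%:R : R) => y; nra.
have r1 : 0 <= (1 - r)^-1 by rewrite invr_ge0 subr_ge0 ltW//; case/andP: r_range.
have g1' := ler_wpM2l (expR_ge0 (beta * h)) g1.
have g2' := ler_wpM2r r1 g2.
apply: le_trans (lerD (lerD g1' (_ : _ <= expR (eps / 4 * h) * expR (gr * t) * (1 - r)^-1)) g1') _.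
  by rewrite mulrA.
by rewrite le_eqVlt; apply/orP; left; apply/eqP; ring.
Qed.

Variables (g : 'rV[R]_d -> R).
Hypotheses (mg : measurable_fun setT g) (gF : forall lam, `|g lam| <= F lam).

Let F_integrable : leb.-integrable setT (fun lam => (F lam)%:E).
Proof.
apply/integrableP; split; first exact/measurable_EFinP.
under eq_integral do rewrite gee0_abs ?lee_fin//.
by apply: le_lt_trans IF _; rewrite ltry.
Qed.

Lemma weighted_wint_integrable (mu : MF R d) :
  leb.-integrable setT (fun lam => (g lam * wint th lam mu)%:E).
Proof.
apply: (le_integrable measurableT _ _ (integrable_mulr measurableT (mass mu) F_integrable)).
  apply/measurable_EFinP; apply: measurable_funM => //; exact: measurable_wint_lam.
move=> lam _; rewrite lee_fin !normrM mulrC (ger0_norm (F0 lam)) (ger0_norm (mass_ge0 mu)).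
by apply: ler_pM => //; exact: wint_le.
Qed.

Let spectral_term t lam := \1_low lam * (W lam * expR (t * rho beta lam) * g lam).

(** W has no pointwise bound. But W - M_(N h) is integrable against F on D by [low_tail], and |M_(N
    h)| is at most the mass of X_(N h), because rho >= 0 on D. *)
Let spectral_term_integrable t : leb.-integrable setT (fun lam => (spectral_term t lam)%:E).
Proof.
have [e0 eb] : 0 < eps /\ eps < beta / 2 by move/andP: eps_range.
have mL := measurable_indic mlow.
pose c := N%:R * h.
have c0 : 0 <= c by rewrite mulr_ge0// ltW.
pose V lam := F lam * \1_low lam * `|W lam - m c lam|.
have V0 lam : 0 <= V lam by rewrite !mulr_ge0.
have iV : leb.-integrable setT (fun lam => (V lam)%:E).
  apply/integrableP; split.
    apply/measurable_EFinP; apply: measurable_funM; first exact: measurable_funM.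
    by apply: measurableT_comp => //; apply: measurable_funB => //; exact: mm.
  under eq_integral do rewrite gee0_abs ?lee_fin//.
  by apply: le_lt_trans (low_tail (leqnn N)) _; rewrite ltry.
have iM := integrable_mulr measurableT (mass (X c w)) F_integrable.
have iS := integrable_mulr measurableT (expR (`|t| * beta)) (integrable_addr measurableT iV iM).
apply: (le_integrable measurableT _ _ iS).
  apply/measurable_EFinP; apply: measurable_funM => //; apply: measurable_funM => //.
  apply: measurable_funM => //; apply: measurableT_comp => //; apply: measurable_funM => //; exact: measurable_rho.
move=> lam _; rewrite lee_fin /spectral_term.
have F0' := F0 lam; have m0 := mass_ge0 (X c w).
rewrite [leRHS]ger0_norm; last by rewrite mulr_ge0 ?expR_ge0// addr_ge0// mulr_ge0.
have [ll|nl] := pselect (low lam); last first.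
  rewrite indicE memNset// mul0r normr0 mulr_ge0 ?expR_ge0// addr_ge0// mulr_ge0//.
have rho0 : 0 <= rho beta lam by have : eps <= 2 * rho beta lam - beta := ll; lra.
have rb := rho_le beta lam.
have et : expR (t * rho beta lam) <= expR (`|t| * beta).
  rewrite ler_expR; apply: (@le_trans _ _ (`|t| * rho beta lam)).
    by rewrite ler_wpM2r// ler_norm.
  by rewrite ler_wpM2l.
have mc : `|m c lam| <= mass (X c w).
  rewrite /m /Mt normrM ger0_norm ?expR_ge0//.
  apply: le_trans (_ : _ <= 1 * `|wint th lam (X c w)|) _; last by rewrite mul1r wint_le.
  by rewrite ler_wpM2r// -expR0 ler_expR oppr_le0 mulr_ge0.
have Wm : `|W lam| <= `|W lam - m c lam| + mass (X c w).
  apply: le_trans (_ : _ <= `|W lam - m c lam| + `|m c lam|) _; last by rewrite lerD2l.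
  by rewrite -{1}(subrK (m c lam) (W lam)) ler_normD.
rewrite /V indicE mem_set// mul1r mulr1 !normrM (ger0_norm (expR_ge0 _)).
rewrite (mulrC (mass _)) -mulrDr.
rewrite (mulrC (`|W lam|)) -mulrA; apply: ler_pM; rewrite ?expR_ge0 ?mulr_ge0//.
by rewrite mulrC; apply: ler_pM.
Qed.

Let spectral_termE t lam : ((fun lam => (W lam * expR (t * rho beta lam) * g lam)) \_ low) lam = spectral_term t lam.
Proof.
by rewrite patchE /spectral_term indicE; case: (_ \in _); rewrite ?mul1r ?mul0r.
Qed.

Lemma spectral_integrable t :
  leb.-integrable low (fun lam => (W lam * expR (t * rho beta lam) * g lam)%:E).
Proof.
apply/(integrable_mkcond _ mlow).
rewrite (_ : _ \_ _ = fun lam => (spectral_term t lam)%:E); first exact: spectral_term_integrable.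
by apply/funext => lam; rewrite -spectral_termE !patchE; case: ifP.
Qed.

Lemma spectral_approximation t : N%:R * h <= t ->
  `|(\int[leb]_lam (g lam * wint th lam (X t w)))%R -
    (\int[leb]_(lam in low) (W lam * expR (t * rho beta lam) * g lam))%R| <= remainder_const * expR (gr * t).
Proof.
move=> Nt; rewrite [X in _ - X]Rintegral_mkcond.
rewrite (_ : _ \_ low = spectral_term t); last by apply/funext => lam; exact: spectral_termE.
rewrite -(RintegralB measurableT (weighted_wint_integrable _) (spectral_term_integrable t)).
have iB := integrable_subr measurableT (weighted_wint_integrable (X t w)) (spectral_term_integrable t).
apply: le_trans (le_normr_Rintegral measurableT iB) _.
rewrite -lee_fin /Rintegral fineK; last exact: (integrable_fin_num measurableT (integrable_abse iB)).
apply: le_trans (remainder_int Nt).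
apply: ge0_le_integral_nomeas => lam _; first by rewrite lee_fin.
rewrite lee_fin /remainder /spectral_term.
have -> : wint th lam (X t w) = expR (rho beta lam * t) * m t lam.
  rewrite /m /Mt [RHS]mulrA -expRD.
  by rewrite [X in expR X](_ : _ = 0) ?expR0 ?mul1r//; ring.
rewrite (mulrC t); move: (expR _) (m _ _) => e y.
have [ll|nl] := pselect (low lam).
  rewrite !indicE mem_set// memNset; last by [].
  rewrite !mul1r mul0r addr0 (_ : _ - _ = g lam * (e * (y - W lam))); last by ring.
  by rewrite normrM ler_wpM2r.
rewrite !indicE memNset// mem_set// !mul0r subr0 add0r mul1r.
by rewrite normrM ler_wpM2r.
Qed.

End Pathwise.

(** * Exchange of the frequency integral with a finite measure *)

Section Fourier.
Context {R : realType} {d : nat}.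
Variables (g : 'rV[R]_d -> R) (nu : MF R d) (th : R).
Hypothesis ig : (lebesgue_rV d).-integrable setT (fun lam => (g lam)%:E).

Let leb := @leb_rV R d.

Lemma measurable_wave_swap :
  measurable_fun setT (fun z : 'rV[R]_d * 'rV[R]_d => wave th z.2 z.1).
Proof.
rewrite (_ : (fun z => _) = (fun z : 'rV[R]_d * 'rV[R]_d => wave th z.1 z.2)); first exact: measurable_wave.
by apply/funext => z; rewrite waveC.
Qed.

Let mg : measurable_fun setT g.
Proof. by have /integrableP[/measurable_EFinP] := ig. Qed.

Lemma weighted_wave_integrable x : leb.-integrable setT (fun lam => (g lam * wave th lam x)%:E).
Proof.
apply: (le_integrable measurableT _ _ ig).
  apply/measurable_EFinP; apply: measurable_funM => //.
  exact: measurableT_comp measurable_wave_swap (pair1_measurable x).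
by move=> lam _; rewrite lee_fin normrM ler_piMr// wave_le1.
Qed.

Lemma integrable_wave_joint :
  (nu \x leb)%E.-integrable setT (fun z : 'rV[R]_d * 'rV[R]_d => (g z.2 * wave th z.2 z.1)%:E).
Proof.
apply/integrable12ltyP.
  apply/measurable_EFinP; apply: measurable_funM; last exact: measurable_wave_swap.
  exact: measurableT_comp mg measurable_snd.
have /integrableP[_ gfin] := ig.
apply: (@le_lt_trans _ _ (\int[nu]_x \int[leb]_lam `|(g lam)%:E|)%E).
  apply: ge0_le_integral_nomeas => x _; first exact: integral_ge0.
  apply: ge0_le_integral_nomeas => lam _; first by [].
  by rewrite lee_fin normrM ler_piMr// wave_le1.
rewrite integral_cst//= massE lte_mul_pinfty// ?ltry//.
- exact: integral_ge0.
- by rewrite ge0_fin_numE//; exact: integral_ge0.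
Qed.

Lemma wave_integral_fubini :
  nu.-integrable setT (fun x => ((\int[leb]_lam (g lam * wave th lam x))%R)%:E) /\
  (\int[nu]_x (\int[leb]_lam (g lam * wave th lam x)))%R = (\int[leb]_lam (g lam * wint th lam nu))%R.
Proof.
have iJ := integrable_wave_joint.
have iw := weighted_wave_integrable.
have E x : ((\int[leb]_lam (g lam * wave th lam x))%R)%:E = (\int[leb]_lam (g lam * wave th lam x)%:E)%E.
  by rewrite fineK//; exact: (integrable_fin_num measurableT (iw x)).
split.
  rewrite (_ : (fun x => _) = fubini_F leb (fun z : 'rV[R]_d * 'rV[R]_d => (g z.2 * wave th z.2 z.1)%:E)).
    exact: integrable_fubini_F.
  by apply/funext => x; rewrite E.
rewrite /Rintegral; congr fine.
transitivity (\int[nu]_x \int[leb]_lam (g lam * wave th lam x)%:E)%E.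
  by apply: eq_integral => x _; rewrite -E.
rewrite (Fubini iJ); apply: eq_integral => lam _ /=.
under eq_integral do rewrite EFinM.
rewrite integralZl//; last exact: wave_integrable.
rewrite /wint EFinM fineK//.
exact: (integrable_fin_num measurableT (wave_integrable _ _ _)).
Qed.

End Fourier.

Local Open Scope complex_scope.

(** * Complex moduli and limits through real and imaginary parts *)

Section ComplexLimits.
Context {R : realType}.
Implicit Types z l : R[i].

Lemma normc_le z : Normc.normc z <= `|complex.Re z| + `|complex.Im z|.
Proof.
case: z => a b /=; rewrite -[leRHS]ger0_norm ?addr_ge0// -sqrtr_sqr ler_wsqrtr//.
rewrite sqrrD !real_normK ?num_real// -addrA lerD2l addrC lerDl.
by rewrite mulrn_wge0// mulr_ge0.
Qed.

Lemma normc_sub_le (a b c e : R) :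
  Normc.normc ((a +i* b) - (c +i* e)) <= `|a - c| + `|b - e|.
Proof. exact: le_trans (normc_le _) _. Qed.

Lemma normc_real (a : R) : Normc.normc a%:C = `|a|.
Proof. by rewrite /= expr0n addr0 sqrtr_sqr. Qed.

Lemma Re_le_normc z : `|complex.Re z| <= Normc.normc z.
Proof. by case: z => a b /=; rewrite -sqrtr_sqr ler_wsqrtr// lerDl sqr_ge0. Qed.

Lemma Im_le_normc z : `|complex.Im z| <= Normc.normc z.
Proof. by case: z => a b /=; rewrite -sqrtr_sqr ler_wsqrtr// lerDr sqr_ge0. Qed.

Lemma gt0_complex z : 0 < z -> exists2 e, 0 < e & z = e%:C.
Proof.
case: z => a b; rewrite ltcE/= => /andP[/eqP b0 a0]; exists a => //.
by rewrite b0.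
Qed.

Lemma normCE z : `|z| = (Normc.normc z)%:C.
Proof. by rewrite normc_def; case: z. Qed.

Lemma cvg_complex T (F : set_system T) {FF : Filter F} (f : T -> R[i]) l :
  f @ F --> l <-> (complex.Re (f t) @[t --> F] --> complex.Re l /\
                   complex.Im (f t) @[t --> F] --> complex.Im l).
Proof.
split=> [/cvgrPdist_lt fl|[/cvgrPdist_lt fr /cvgrPdist_lt fi]].
  have H e : 0 < e -> \forall t \near F, Normc.normc (l - f t) < e.
    move=> e0; have e0' : 0 < e%:C by rewrite ltcE/= eqxx.
    apply: filterS (fl _ e0') => t.
    by rewrite normCE ltcE/= eqxx.
  split; apply/cvgrPdist_lt => e /H; apply: filterS => t.
    by apply: le_lt_trans; rewrite -raddfB Re_le_normc.
  by apply: le_lt_trans; rewrite -raddfB Im_le_normc.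
apply/cvgrPdist_lt => z /gt0_complex[e e0 ->].
have e20 : 0 < e / 2 by rewrite divr_gt0.
apply: filterS2 (fr _ e20) (fi _ e20) => t h1 h2.
rewrite normCE ltcE/= eqxx/=; apply: le_lt_trans (normc_le _) _.
by rewrite (splitr e) ltrD// raddfB.
Qed.

End ComplexLimits.

(** * Complex pairings in terms of real waves *)

Section ComplexPairings.
Context {R : realType} {d : nat}.
Implicit Types (lam x : 'rV[R]_d) (nu : MF R d).

Lemma cos_pihalf (y : R) : cos (y + pi / 2) = - sin y.
Proof. by rewrite cosD cos_pihalf sin_pihalf mulr0 mulr1 sub0r. Qed.

Lemma pairing_phi nu lam : pairing nu (fun x => (phi lam x)^*) =
  wint 0 lam nu +i* wint (pi / 2) lam nu.
Proof.
rewrite /pairing /Cintegral/=; congr (_ +i* _); apply: eq_Rintegral => x _.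
  by rewrite /wave addr0.
by rewrite /wave cos_pihalf.
Qed.

Lemma W_atE beta Omega (X : R -> Omega -> MF R d) t lam w :
  W_at beta X t lam w =
  (expR (- (rho beta lam * t)) * wint 0 lam (X t w)) +i*
  (expR (- (rho beta lam * t)) * wint (pi / 2) lam (X t w)).
Proof.
by rewrite /W_at pairing_phi mulNr /=; apply/eqP; rewrite eq_complex/= !mul0r subr0 addr0 !eqxx.
Qed.

Lemma continuous_measurable_complex (F : 'rV[R]_d -> R[i]) : continuous F ->
  measurable_fun setT (fun lam => complex.Re (F lam)) /\
  measurable_fun setT (fun lam => complex.Im (F lam)).
Proof.
move=> cF; split; apply: continuous_measurable_rV => lam.
  by have /cvg_complex[] := cF lam.
by have /cvg_complex[] := cF lam.
Qed.

End ComplexPairings.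

(** * Measurability of the limit in the frequency *)

Section LimitMeasurability.
Context {R : realType} {d : nat} (alpha beta : R).
Context {dO : measure_display} {Omega : measurableType dO}.
Variables (P : MF R d -> probability Omega R) (X : R -> Omega -> MF R d).
Hypothesis sbm : super_brownian_motion alpha beta P X.
Implicit Types (lam x : 'rV[R]_d) (w : Omega).

Let conv w : set 'rV[R]_d := [set lam | converges beta X 0 (w, lam) /\ converges beta X (pi / 2) (w, lam)].

Lemma W_lim_cvg w lam : conv w lam ->
  Mt beta X 0 lam t w @[t --> +oo] --> complex.Re (W_lim beta X lam w) /\
  Mt beta X (pi / 2) lam t w @[t --> +oo] --> complex.Im (W_lim beta X lam w).
Proof.
rewrite /conv /converges/= => -[/cvg_ex[/= a ca] /cvg_ex[/= b cb]].
have W : W_at beta X t lam w @[t --> +oo] --> (a +i* b).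
  apply/cvg_complex; split.
    by under eq_fun do rewrite W_atE/=.
  by under eq_fun do rewrite W_atE/=.
have -> : W_lim beta X lam w = a +i* b by apply: cvg_lim W.
by split.
Qed.

(** If either component diverges, so does the complex limit, and [lim] returns the default
    [point]. *)
Lemma W_lim_dvg w lam : ~ conv w lam -> W_lim beta X lam w = point.
Proof.
move=> nc; apply: dvgP => /cvg_ex[/= l /cvg_complex[cr ci]]; apply: nc.
split; apply/cvg_ex.
  by exists (complex.Re l); move: cr; under eq_fun do rewrite W_atE/=.
by exists (complex.Im l); move: ci; under eq_fun do rewrite W_atE/=.
Qed.

Lemma measurable_conv w : measurable (conv w).
Proof.
have H th : measurable [set lam : 'rV[R]_d | converges beta X th (w, lam)].
  have := measurableT_comp (measurable_indic (measurable_converges sbm th)) (pair1_measurable w).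
  move=> /(_ R) /(_ measurableT [set 1] (measurable_set1 1)); rewrite setTI => h.
  rewrite (_ : mkset _ = ((\1_(converges beta X th) : Omega * 'rV[R]_d -> R) \o pair w) @^-1` [set 1])//.
  apply/seteqP; split => [lam /= c|lam /=]; first by rewrite indicE mem_set.
  rewrite indicE; case: (boolP (_ \in _)) => [/set_mem//|_ /eqP].
  by rewrite eq_sym oner_eq0.
exact: (measurableI _ _ (H 0) (H (pi / 2))).
Qed.

(** On the measurable set [conv w] the limit equals the upper limit along integer times; elsewhere
    it is the constant that comes from the default value of [lim]. *)
Lemma measurable_limit w (L : 'rV[R]_d -> R) th (c : R) :
  (forall lam, conv w lam -> Mt beta X th lam t w @[t --> +oo] --> L lam) ->
  (forall lam, ~ conv w lam -> L lam = c) -> measurable_fun setT L.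
Proof.
move=> cL nL.
pose M (n : nat) lam : \bar R := (Mt beta X th lam n%:R w)%:E.
have -> : L = fun lam => \1_(conv w) lam * fine (limn_esup (M^~ lam)) + \1_(~` conv w) lam * c.
  apply/funext => lam; rewrite !indicE; have [cl|nc] := pselect (conv w lam).
    rewrite mem_set// memNset; last by [].
    rewrite mul1r mul0r addr0.
    have cM : M n lam @[n --> \oo] --> (L lam)%:E.
      apply: cvg_EFin; first exact: nearW.
      apply: (@cvg_comp _ _ _ (fun n : nat => n%:R) (fun t => Mt beta X th lam t w) _ (pinfty_nbhs R)); last exact: cL.
      exact: cvgr_idn.
    by rewrite (cvg_limn_einf_sup cM).2.
  by rewrite memNset// mem_set// mul0r mul1r add0r nL.
have mc := measurable_conv w.
apply: measurable_funD; apply: measurable_funM => //.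
- apply: measurableT_comp => //; apply: measurable_fun_limn_esup => n.
  by apply/measurable_EFinP; exact: measurable_Mt_lam.
- by apply: measurable_indic; exact: measurableC.
Qed.

Lemma measurable_W_lim w : measurable_fun setT (fun lam => complex.Re (W_lim beta X lam w)) /\
  measurable_fun setT (fun lam => complex.Im (W_lim beta X lam w)).
Proof.
split.
  apply: (@measurable_limit w _ 0 (complex.Re (point : R[i]))) => lam.
    by move=> /W_lim_cvg[].
  by move=> /W_lim_dvg ->.
apply: (@measurable_limit w _ (pi / 2) (complex.Im (point : R[i]))) => lam.
  by move=> /W_lim_cvg[].
by move=> /W_lim_dvg ->.
Qed.

End LimitMeasurability.

(** * Fourier inversion integrated against a finite measure *)

Section FourierInversion.
Context {R : realType} {d : nat}.

(** Multiplying F by the conjugate of phi mixes the phases 0 and pi / 2; Fubini's theorem then moves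
    nu inside each of the four real integrals. *)
Lemma pairing_inversion (F f : 'rV[R]_d -> R[i]) (c : R) (nu : MF R d) :
  Cintegrable (lebesgue_rV d) setT F ->
  (forall x, f x = c%:C * Cintegral (lebesgue_rV d) setT (fun lam => F lam * (phi lam x)^*)) ->
  pairing nu f = c%:C *
    (((\int[lebesgue_rV d]_lam (complex.Re (F lam) * wint 0 lam nu))%R -
      (\int[lebesgue_rV d]_lam (complex.Im (F lam) * wint (pi / 2) lam nu))%R) +i*
     ((\int[lebesgue_rV d]_lam (complex.Re (F lam) * wint (pi / 2) lam nu))%R +
      (\int[lebesgue_rV d]_lam (complex.Im (F lam) * wint 0 lam nu))%R)).
Proof.
move=> [ia ib] fE.
have wa th x := weighted_wave_integrable th ia x.
have wb th x := weighted_wave_integrable th ib x.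
have fa th := wave_integral_fubini nu th ia.
have fb th := wave_integral_fubini nu th ib.
pose A th x := (\int[lebesgue_rV d]_lam (complex.Re (F lam) * wave th lam x))%R.
pose B th x := (\int[lebesgue_rV d]_lam (complex.Im (F lam) * wave th lam x))%R.
have ReE x : complex.Re (f x) = c * (A 0 x - B (pi / 2) x).
  rewrite fE /Cintegral/= mul0r subr0; congr (_ * _).
  rewrite /A /B -(RintegralB measurableT (wa _ _) (wb _ _)); apply: eq_Rintegral => lam _.
  rewrite /wave cos_pihalf addr0; case: (F lam) => a b /=; ring.
have ImE x : complex.Im (f x) = c * (A (pi / 2) x + B 0 x).
  rewrite fE /Cintegral/= mul0r addr0; congr (_ * _).
  rewrite /A /B -(RintegralD measurableT (wa _ _) (wb _ _)); apply: eq_Rintegral => lam _.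
  rewrite /wave cos_pihalf addr0; case: (F lam) => a b /=; ring.
have [iA0 EA0] := fa 0; have [iAq EAq] := fa (pi / 2).
have [iB0 EB0] := fb 0; have [iBq EBq] := fb (pi / 2).
rewrite /pairing /Cintegral; apply/eqP; rewrite eq_complex/= !mul0r subr0 addr0; apply/andP; split; apply/eqP.
  under eq_Rintegral do rewrite ReE.
  rewrite (RintegralZl c measurableT (integrable_subr measurableT iA0 iBq)); congr (_ * _).
  by rewrite (RintegralB measurableT iA0 iBq) EA0 EBq.
under eq_Rintegral do rewrite ImE.
rewrite (RintegralZl c measurableT (integrable_addr measurableT iAq iB0)); congr (_ * _).
by rewrite (RintegralD measurableT iAq iB0) EAq EB0.
Qed.

End FourierInversion.

Lemma expR_littleo (R : realType) (K g delta z : R) : 0 < delta -> 0 < z ->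
  \forall t \near +oo, K * expR (g * t) <= z * expR ((g + delta) * t).
Proof.
move=> d0 z0.
exists (K / (z * delta)); split; first exact: num_real.
move=> t Kt; rewrite mulrDl expRD [leRHS]mulrCA [leLHS]mulrC ler_wpM2l ?expR_ge0//.
have := ltW Kt; rewrite ler_pdivrMr ?mulr_gt0// => Kt'.
apply: le_trans (_ : _ <= z * (1 + delta * t)) _; last by rewrite ler_wpM2l ?(ltW z0)// expR_ge1Dx.
by apply: le_trans Kt' _; rewrite mulrDr mulr1 mulrCA [t * _]mulrC -subr_ge0 addrK ltW.
Qed.

(** * Good paths and the final estimate *)

Section Tame.
Context {R : realType} {d : nat} (alpha beta : R).
Context {dO : measure_display} {Omega : measurableType dO}.
Variables (P : MF R d -> probability Omega R) (X : R -> Omega -> MF R d).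
Hypotheses (alpha0 : 0 < alpha) (beta0 : 0 < beta).
Hypothesis sbm : super_brownian_motion alpha beta P X.
Variables (h : R) (F : 'rV[R]_d -> R) (I eps : R).
Hypotheses (h0 : 0 < h) (F0 : forall lam, 0 <= F lam) (mF : measurable_fun setT F)
  (IF : (\int[lebesgue_rV d]_lam (expR (- (rho beta lam * h)) * F lam)%:E <= I%:E)%E)
  (eps_range : 0 < eps < beta / 2).

(** The three almost sure estimates from a common rank N on, in the form that the pathwise argument
    takes as hypotheses. *)
Definition tame th (N : nat) (w : Omega) :=
  [/\ forall n, (N <= n)%N -> forall t, n%:R * h <= t <= n%:R * h + h ->
      (dist_Mt beta X (@leb_rV R d) (fun lam => F lam * expR (rho beta lam * (n%:R * h)))%R th (n%:R * h) t w
        <= (expR (growth beta eps * h * n%:R))%:E)%E,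
    forall n, (N <= n)%N -> forall t, n%:R * h <= t <= n%:R * h + h ->
      (dist_Mt beta X (@leb_rV R d) (fun lam => F lam * \1_(low beta eps) lam)%R th (n%:R * h) t w
        <= (expR (- (eps / 4 * h) * n%:R))%:E)%E &
    forall n, (N <= n)%N ->
      (\int[@leb_rV R d]_lam (F lam * \1_(~` low beta eps) lam * `|wint th lam (X (n%:R * h) w)|)%:E
        <= (expR (growth beta eps * h * n%:R))%:E)%E].

Lemma ae_tame nu th : {ae P nu, forall w, exists N, tame th N w}.
Proof.
apply: filterS3 (ae_oscillation alpha0 beta0 sbm nu th h0 F0 mF IF eps_range)
  (ae_low_increments alpha0 beta0 sbm nu th h0 F0 mF IF eps_range)
  (ae_high alpha0 beta0 sbm nu th h0 F0 mF IF eps_range) => w [N1 H1] [N2 H2] [N3 H3].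
exists (maxn N1 (maxn N2 N3)); split => n; rewrite !geq_max => /and3P[n1 n2 n3].
- exact: H1.
- exact: H2.
- exact: H3.
Qed.

Lemma ae_W_lim nu : {ae P nu, forall w, {ae lebesgue_rV d, forall lam, low beta eps lam ->
    Mt beta X 0 lam t w @[t --> +oo] --> complex.Re (W_lim beta X lam w) /\
    Mt beta X (pi / 2) lam t w @[t --> +oo] --> complex.Im (W_lim beta X lam w)}}.
Proof.
apply: filterS2 (ae_ae_converges alpha0 beta0 sbm nu 0 h0)
  (ae_ae_converges alpha0 beta0 sbm nu (pi / 2) h0) => w.
apply: filterS2 => lam c0 cq ll.
have [e0 _] : 0 < eps /\ eps < beta / 2 by move/andP: eps_range.
have hl : beta < 2 * rho beta lam by move: ll; rewrite /low/=; lra.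
by apply: W_lim_cvg; split; [exact: c0|exact: cq].
Qed.

End Tame.

Unset Implicit Arguments.

Theorem theorem3p1 (R : realType) (d : nat) (alpha beta : R)
    (dO : measure_display) (Omega : measurableType dO)
    (P : MF R d -> probability Omega R) (X : R -> Omega -> MF R d)
    (f : 'rV[R]_d -> R[i]) :
  (1 <= d)%N -> 0 < alpha -> 0 < beta ->
  super_brownian_motion alpha beta P X ->
  classA beta f ->
  forall (eps : R) (x : 'rV[R]_d), 0 < eps < beta / 2 ->
  exists2 delta : R, 0 < delta &
    {ae P (\d_x), forall w,
      let D := [set lambda | eps <= 2 * rho beta lambda - beta] in
      let integrand t lambda := W_lim beta X lambda w *
        (expR (t * rho beta lambda))%:C * fourier f lambda in
      (forall t, Cintegrable (lebesgue_rV d) D (integrand t)) /\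
      (fun t => pairing (X t w) f) =
        (fun t => ((2 * pi) ^- d)%:C *
                  Cintegral (lebesgue_rV d) D (integrand t))
        +o_ (pinfty_nbhs R) (fun t => (expR ((beta - delta) * t))%:C)}.
Proof.
move=> _ alpha0 beta0 sbm [_ _ [_ cF] inversion [h h0 hint]] eps x eps_range.
have [e0 eb] : 0 < eps /\ eps < beta / 2 by move/andP: eps_range.
pose F lam := Normc.normc (fourier f lam).
have F0 lam : 0 <= F lam by rewrite /F; case: (fourier f lam) => a b; exact: sqrtr_ge0.
have [ma mb] := continuous_measurable_complex cF.
have mF : measurable_fun setT F.
  rewrite (_ : F = fun lam => Num.sqrt (complex.Re (fourier f lam) ^+ 2 + complex.Im (fourier f lam) ^+ 2)).
    apply: measurableT_comp; first by apply: continuous_measurable_fun; exact: sqrt_continuous.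
    by apply: measurable_funD; exact: measurable_funX.
  by apply/funext => lam; rewrite /F; case: (fourier f lam).
pose q := (2 * pi : R) ^+ d.
have q0 : 0 < q by rewrite exprn_gt0// mulr_gt0// pi_gt0.
(* The weighted integral of the class A carries the factor (2 pi)^(-d), which [q] removes. *)
pose I := q * fine (\int[lebesgue_rV d]_lambda (expR (- h * rho beta lambda) * Normc.normc (fourier f lambda) / q)%:E)%E.
have IF : (\int[lebesgue_rV d]_lam (expR (- (rho beta lam * h)) * F lam)%:E <= I%:E)%E.
  have T0 lam : 0 <= expR (- h * rho beta lam) * F lam / q.
    by rewrite divr_ge0 ?mulr_ge0 ?expR_ge0// ltW.
  rewrite /I EFinM fineK; last first.
    by rewrite ge0_fin_numE//; apply: integral_ge0 => lam _; rewrite lee_fin; exact: T0.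
  rewrite -ge0_integralZl_EFin ?(ltW q0)//.
  - apply: ge0_le_integral_nomeas => lam _; first by rewrite lee_fin mulr_ge0// expR_ge0.
    rewrite -EFinM lee_fin [X in _ <= q * X]mulrC mulVKf ?gt_eqF// mulNr [h * _]mulrC.
    by [].
  - by move=> lam _; rewrite lee_fin; exact: T0.
  - apply/measurable_EFinP; apply: measurable_funM => //; apply: measurable_funM => //.
    apply: measurableT_comp => //; apply: measurable_funM => //; exact: measurable_rho.
have IF' := F_mass_le h0 F0 mF IF.
have aF lam : `|complex.Re (fourier f lam)| <= F lam by exact: Re_le_normc.
have bF lam : `|complex.Im (fourier f lam)| <= F lam by exact: Im_le_normc.
have iF (g : 'rV[R]_d -> R) : measurable_fun setT g -> (forall lam, `|g lam| <= F lam) ->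
    (lebesgue_rV d).-integrable setT (fun lam => (g lam)%:E).
  move=> mg gF; apply/integrableP; split; first exact/measurable_EFinP.
  apply: (@le_lt_trans _ _ (expR (beta * h) * I)%:E); last by rewrite ltry.
  apply: le_trans IF'; apply: ge0_le_integral_nomeas => lam _; first by [].
  by rewrite lee_fin.
(* The errors are O(e^((beta - eps / 8) t)); half of eps / 8 is given up to make them a little o. *)
exists (eps / 16); first by rewrite divr_gt0.
apply: filterS3 (ae_tame alpha0 beta0 sbm h0 F0 mF IF eps_range \d_x 0)
  (ae_tame alpha0 beta0 sbm h0 F0 mF IF eps_range \d_x (pi / 2))
  (ae_W_lim alpha0 beta0 sbm h0 eps_range \d_x) => w [Nr [oscr incr highr]] [Nq [oscq incq highq]] cW.
have [mWr mWi] := measurable_W_lim sbm w.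
have cWr : {ae lebesgue_rV d, forall lam, low beta eps lam -> Mt beta X 0 lam t w @[t --> +oo] --> complex.Re (W_lim beta X lam w)}.
  by apply: filterS cW => lam c /c[].
have cWi : {ae lebesgue_rV d, forall lam, low beta eps lam -> Mt beta X (pi / 2) lam t w @[t --> +oo] --> complex.Im (W_lim beta X lam w)}.
  by apply: filterS cW => lam c /c[].
pose K := remainder_const beta h eps.
pose c : R := (2 * pi) ^- d.
have c0 : 0 <= c by rewrite invr_ge0 exprn_ge0// mulr_ge0// pi_ge0.
have int0 (g : 'rV[R]_d -> R) t (mg : measurable_fun setT g) (gF : forall lam, `|g lam| <= F lam) :=
  spectral_integrable h0 F0 mF IF' eps_range mWr cWr incr mg gF t.
have intq (g : 'rV[R]_d -> R) t (mg : measurable_fun setT g) (gF : forall lam, `|g lam| <= F lam) :=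
  spectral_integrable h0 F0 mF IF' eps_range mWi cWi incq mg gF t.
have app0 (g : 'rV[R]_d -> R) t (mg : measurable_fun setT g) (gF : forall lam, `|g lam| <= F lam) :=
  spectral_approximation beta0 h0 F0 mF IF' eps_range mWr cWr oscr incr highr mg gF (t := t).
have appq (g : 'rV[R]_d -> R) t (mg : measurable_fun setT g) (gF : forall lam, `|g lam| <= F lam) :=
  spectral_approximation beta0 h0 F0 mF IF' eps_range mWi cWi oscq incq highq mg gF (t := t).
pose D : set 'rV[R]_d := low beta eps.
pose integrand t lam := W_lim beta X lam w * (expR (t * rho beta lam))%:C * fourier f lam.
change ((forall t, Cintegrable (lebesgue_rV d) D (integrand t)) /\
  (fun t => pairing (X t w) f) =
  (fun t => c%:C * Cintegral (lebesgue_rV d) D (integrand t))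
    +o_ (pinfty_nbhs R) (fun t => (expR ((beta - eps / 16) * t))%:C)).
have ReE t lam : complex.Re (integrand t lam) =
    complex.Re (W_lim beta X lam w) * expR (t * rho beta lam) * complex.Re (fourier f lam) -
    complex.Im (W_lim beta X lam w) * expR (t * rho beta lam) * complex.Im (fourier f lam).
  rewrite /integrand; case: (W_lim _ _ _ _) (fourier _ _) => u v [a b] /=; ring.
have ImE t lam : complex.Im (integrand t lam) =
    complex.Re (W_lim beta X lam w) * expR (t * rho beta lam) * complex.Im (fourier f lam) +
    complex.Im (W_lim beta X lam w) * expR (t * rho beta lam) * complex.Re (fourier f lam).
  rewrite /integrand; case: (W_lim _ _ _ _) (fourier _ _) => u v [a b] /=; ring.
have mD : measurable D by exact: measurable_low.
have iRe t := integrable_subr mD (int0 _ t ma aF) (intq _ t mb bF).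
have iIm t := integrable_addr mD (int0 _ t mb bF) (intq _ t ma aF).
split.
  move=> t; split.
    rewrite (_ : (fun lam => _) = (fun lam => (complex.Re (W_lim beta X lam w) * expR (t * rho beta lam) * complex.Re (fourier f lam) -
      complex.Im (W_lim beta X lam w) * expR (t * rho beta lam) * complex.Im (fourier f lam))%:E)).
      exact: iRe.
    by apply/funext => lam; rewrite ReE.
  rewrite (_ : (fun lam => _) = (fun lam => (complex.Re (W_lim beta X lam w) * expR (t * rho beta lam) * complex.Im (fourier f lam) +
    complex.Im (W_lim beta X lam w) * expR (t * rho beta lam) * complex.Re (fourier f lam))%:E)).
    exact: iIm.
  by apply/funext => lam; rewrite ImE.
have CE t : Cintegral (lebesgue_rV d) D (integrand t) =
  ((\int[lebesgue_rV d]_(lam in D) (complex.Re (W_lim beta X lam w) * expR (t * rho beta lam) * complex.Re (fourier f lam)))%R -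
   (\int[lebesgue_rV d]_(lam in D) (complex.Im (W_lim beta X lam w) * expR (t * rho beta lam) * complex.Im (fourier f lam)))%R) +i*
  ((\int[lebesgue_rV d]_(lam in D) (complex.Re (W_lim beta X lam w) * expR (t * rho beta lam) * complex.Im (fourier f lam)))%R +
   (\int[lebesgue_rV d]_(lam in D) (complex.Im (W_lim beta X lam w) * expR (t * rho beta lam) * complex.Re (fourier f lam)))%R).
  rewrite /Cintegral; congr (_ +i* _).
    rewrite -(RintegralB mD (int0 _ t ma aF) (intq _ t mb bF)).
    by apply: eq_Rintegral => lam _; exact: ReE.
  rewrite -(RintegralD mD (int0 _ t mb bF) (intq _ t ma aF)).
  by apply: eq_Rintegral => lam _; exact: ImE.
apply/eqaddoP => z /gt0_complex[y y0 ->].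
have le0 : \forall t \near +oo, Nr%:R * h <= t.
  by exists (Nr%:R * h); split; [exact: num_real|move=> t /ltW].
have leq : \forall t \near +oo, Nq%:R * h <= t.
  by exists (Nq%:R * h); split; [exact: num_real|move=> t /ltW].
have e160 : 0 < eps / 16 by rewrite divr_gt0.
(* The factor 4 counts the real approximations: the real and imaginary parts of the Fourier
   transform, each against the two phases. *)
apply: filterS3 le0 leq (expR_littleo (c * (4 * K)) (growth beta eps) e160 y0) => t t0 tq small.
rewrite !normCE -rmorphM lecR normc_real ger0_norm ?expR_ge0//.
rewrite (_ : beta - eps / 16 = growth beta eps + eps / 16); last by rewrite /growth; field.
apply: le_trans small.
have cFi : Cintegrable (lebesgue_rV d) setT (fourier f) by split; exact: iF.
have a0 := app0 _ t ma aF t0; have aq := appq _ t ma aF tq.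
have b0 := app0 _ t mb bF t0; have bq := appq _ t mb bF tq.
have -> : ((fun t => pairing (X t w) f) - (fun t => c%:C * Cintegral (lebesgue_rV d) D (integrand t))) t =
  pairing (X t w) f - c%:C * Cintegral (lebesgue_rV d) D (integrand t) by [].
rewrite (pairing_inversion (X t w) cFi inversion) CE -mulrBr Normc.normcM.
rewrite normc_real (ger0_norm c0) -[leRHS]mulrA ler_wpM2l//; apply: le_trans (normc_sub_le _ _ _ _) _.
have tri (a b a' b' a1 b1 : R) : `|a - a'| <= a1 -> `|b - b'| <= b1 ->
    `|a - b - (a' - b')| <= a1 + b1 /\ `|a + b - (a' + b')| <= a1 + b1.
  move=> ha hb; split.
    rewrite (_ : _ - _ = (a - a') - (b - b')); last by ring.
    by apply: le_trans (ler_normB _ _) (lerD ha hb).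
  rewrite (_ : _ - _ = (a - a') + (b - b')); last by ring.
  by apply: le_trans (ler_normD _ _) (lerD ha hb).
have [h1 _] := tri _ _ _ _ _ _ a0 bq; have [_ h2] := tri _ _ _ _ _ _ aq b0.
rewrite [X in `|_ + _ - X|]addrC in h2.
apply: le_trans (lerD h1 h2) _.
by rewrite le_eqVlt; apply/orP; left; apply/eqP; rewrite -/K; ring.
Qed.
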